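(* Let $\Delta$ be a shellable $(d-1)$-dimensional polytopal complex. Then $\mathrm{sd}(\Delta)$ is almost strong Lefschetz over $\mathbb{R}$. In particular, the $g$-vector of $\mathrm{sd}(\Delta)$ is an $M$-sequence.
   Context: A polytopal complex is a finite nonempty collection of polytopes in some $\mathbb{R}^t$ containing all faces of its polytopes, such that the intersection of two of its polytopes is a face of each. Its barycentric subdivision $\mathrm{sd}(\Delta)$ is the simplicial complex whose vertices are the nonempty faces of $\Delta$ and whose faces are chains of nonempty faces under strict inclusion. A shelling of a pure $(d-1)$-dimensional polytopal complex $\mathcal C$ is an ordering $F_1,\dots,F_m$ of its facets such that either $\mathcal C$ is $0$-dimensional, or (i) the boundary complex of $F_1$ has a shelling and (ii) for $1<j\le m$, $F_j\cap\bigcup_{i<j}F_i$ is nonempty and equals $G_1\cup\dots\cup G_r$ for some shelling $G_1,\dots,G_r,\dots,G_t$ of the boundary complex of $F_j$ with $1\le r\le t$. $\mathcal C$ is shellable if it is pure and has a shelling. For a simplicial complex $\Gamma$ on vertex set $[n]$, $k[\Gamma]=k[x_1,\dots,x_n]/I_\Gamma$ is its Stanley–Reisner ring; $\Gamma$ is almost strong Lefschetz over $k$ if there exist a maximal linear system of parameters $\Theta$ of $k[\Gamma]$ and a degree-one $\omega$ such that $\omega^{s-2i}:(k[\Gamma]/\Theta)_i\to(k[\Gamma]/\Theta)_{s-i}$ is injective for all $0\le i\le\lfloor(s-1)/2\rfloor$, where $s=\dim\Gamma$. The $h$-vector $(h_0,\dots,h_d)$ of a $(d-1)$-dimensional simplicial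 complex is defined by $\sum h_i x^{d-i}=\sum f_{i-1}(x-1)^{d-i}$; the $g$-vector is $g_0=1$, $g_i=h_i-h_{i-1}$ for $1\le i\le\lfloor d/2\rfloor$. An $M$-sequence is the Hilbert function of a standard graded Artinian algebra over a field. *)

(* Defs.v *)
From HB Require Import structures.
From mathcomp Require Import all_boot all_order all_algebra.
From mathcomp Require Import boolp classical_sets cardinality reals.
From mathcomp Require Import mpoly.

Set Implicit Arguments.
Unset Strict Implicit.
Unset Printing Implicit Defensive.

Import Order.TTheory GRing.Theory Num.Theory.
Local Open Scope classical_set_scope.
Local Open Scope ring_scope.

Section Geometry.
Variables (R : realType) (t : nat).
Local Notation V := 'rV[R]_t.

Definition dotv (a x : V) : R := \sum_(i < t) a 0 i * x 0 i.

Definition conv (S : seq V) : set V :=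
  [set x | exists w : 'I_(size S) -> R,
     [/\ forall i, 0 <= w i, \sum_i w i = 1 & x = \sum_i w i *: S`_i]].

(* a polytope: convex hull of finitely many points (the empty set included) *)
Definition polytope (P : set V) : Prop := exists S : seq V, P = conv S.

(* G is a face of P: G = P ∩ H for a valid linear inequality a.x <= b
   (this includes P itself (a=0,b=0) and the empty face (a=0,b=1)) *)
Definition face (G P : set V) : Prop :=
  exists (a : V) (b : R),
    (forall x, P x -> dotv a x <= b) /\ G = [set x | P x /\ dotv a x = b].

Definition aff_indep (k : nat) (p : 'I_k.+1 -> V) : Prop :=
  row_free (\matrix_(i < k) (p (lift ord0 i) - p ord0)).

Definition has_dim (P : set V) (k : nat) : Prop :=
  (exists p : 'I_k.+1 -> V, (forall i, P (p i)) /\ aff_indep p) /\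
  (forall p : 'I_k.+2 -> V, (forall i, P (p i)) -> ~ aff_indep p).

Definition polytopal_complex (C : set (set V)) : Prop :=
  [/\ finite_set C, C !=set0,
      (forall P, C P -> polytope P),
      (forall P G, C P -> face G P -> C G) &
      (forall P Q, C P -> C Q -> face (P `&` Q) P /\ face (P `&` Q) Q)].

Definition facet (C : set (set V)) (F : set V) : Prop :=
  C F /\ (forall G, C G -> F `<=` G -> G = F).

Definition pure_dim (C : set (set V)) (k : nat) : Prop :=
  forall F, facet C F -> has_dim F k.

Definition boundary (F : set V) : set (set V) :=
  [set G | face G F /\ G <> F].

Definition lists_facets (C : set (set V)) (L : seq (set V)) : Prop :=
  (forall i j, (i < size L)%N -> (j < size L)%N ->
      nth set0 L i = nth set0 L j -> i = j) /\
  (forall F, facet C F <-> exists2 i, (i < size L)%N & F = nth set0 L i).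

(* L is a shelling of the pure k-dimensional complex C
   (indices are 0-based: F_1 of the paper is nth set0 L 0) *)
Fixpoint shelling (k : nat) (C : set (set V)) (L : seq (set V)) {struct k}
  : Prop :=
  [/\ pure_dim C k, lists_facets C L &
   match k with
   | 0 => True
   | k'.+1 =>
     (exists M, shelling k' (boundary (nth set0 L 0)) M) /\
     (forall j, (0 < j < size L)%N ->
        let U := nth set0 L j `&`
                 \bigcup_(i in [set i | (i < j)%N]) nth set0 L i in
        U !=set0 /\
        exists M r, [/\ shelling k' (boundary (nth set0 L j)) M,
                        (1 <= r <= size M)%N &
                        U = \bigcup_(l in [set l | (l < r)%N]) nth set0 M l])
   end].

Definition shellable (C : set (set V)) : Prop :=
  exists k L, shelling k C L.

Definition labels_nonempty_faces (Delta : set (set V)) (n : nat)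
  (e : 'I_n -> set V) : Prop :=
  injective e /\ (forall P, (Delta P /\ P !=set0) <-> exists i, e i = P).

(* barycentric subdivision on the vertex set 'I_n (labelled by e):
   faces are the chains of nonempty faces under (strict) inclusion *)
Definition sd_complex (n : nat) (e : 'I_n -> set V) : {set {set 'I_n}} :=
  [set S : {set 'I_n} | `[< forall i j, i \in S -> j \in S ->
                              e i `<=` e j \/ e j `<=` e i >]].

End Geometry.

Definition in_ideal (n : nat) (K : comRingType) (G : {mpoly K[n]} -> Prop)
  (p : {mpoly K[n]}) : Prop :=
  exists s : seq ({mpoly K[n]} * {mpoly K[n]}),
    (forall x, x \in s -> G x.1) /\ p = \sum_(x <- s) x.2 * x.1.

(* number of vertices of a largest face, i.e. dim Gamma + 1 *)
Definition sc_d (n : nat) (Gamma : {set {set 'I_n}}) : nat :=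
  \max_(F in Gamma) #|F|.

Definition SR_Theta_gens (K : comRingType) (n m : nat)
  (Gamma : {set {set 'I_n}}) (Theta : 'I_m -> {mpoly K[n]})
  (q : {mpoly K[n]}) : Prop :=
  (exists F : {set 'I_n}, F \notin Gamma /\ q = \prod_(i in F) 'X_i)
  \/ (exists j, q = Theta j).

Definition almost_strong_lefschetz (K : fieldType) (n : nat)
  (Gamma : {set {set 'I_n}}) : Prop :=
  let s := (sc_d Gamma).-1 in
  exists (Theta : 'I_(sc_d Gamma) -> {mpoly K[n]}) (omega : {mpoly K[n]}),
    [/\ (* Theta consists of dim Gamma + 1 = Krull dim k[Gamma] linear forms *)
        forall j, Theta j \is 1.-homog,
        (* ... and k[Gamma]/Theta is Artinian (finite-dimensional) *)
        exists N, forall p : {mpoly K[n]}, p \is N.-homog ->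
                    in_ideal (SR_Theta_gens Gamma Theta) p,
        omega \is 1.-homog &
        forall i, (2 * i < s)%N -> forall p : {mpoly K[n]}, p \is i.-homog ->
          in_ideal (SR_Theta_gens Gamma Theta) (omega ^+ (s - 2 * i) * p) ->
          in_ideal (SR_Theta_gens Gamma Theta) p].

(* f_{i-1} = number of faces with i vertices *)
Definition fnum (n : nat) (Gamma : {set {set 'I_n}}) (i : nat) : nat :=
  #|[set F in Gamma | #|F| == i]|.

(* h-vector: sum_i h_i x^(d-i) = sum_i f_(i-1) (x-1)^(d-i) *)
Definition hvec (n : nat) (Gamma : {set {set 'I_n}}) (i : nat) : int :=
  let d := sc_d Gamma in
  (\sum_(j < d.+1) (fnum Gamma j)%:R *: ('X - 1) ^+ (d - j) : {poly int})`_(d - i).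

Definition gvec (n : nat) (Gamma : {set {set 'I_n}}) : seq int :=
  mkseq (fun i => if i == 0%N then 1 else hvec Gamma i - hvec Gamma i.-1)
        (sc_d Gamma)./2.+1.

(* dim_K (K[x]/J)_i = c, with J generated by G; stated via a basis of the
   degree-i part of the quotient *)
Definition graded_piece_dim (K : fieldType) (m : nat)
  (G : {mpoly K[m]} -> Prop) (i c : nat) : Prop :=
  exists b : 'I_c -> {mpoly K[m]},
    [/\ forall j, b j \is i.-homog,
        forall a : 'I_c -> K, in_ideal G (\sum_j a j *: b j) -> forall j, a j = 0 &
        forall p : {mpoly K[m]}, p \is i.-homog ->
          exists a : 'I_c -> K, in_ideal G (p - \sum_j a j *: b j)].

(* M-sequence: the Hilbert function (padded with zeros) of a standard graded
   Artinian algebra K[x_1..x_m]/J, J homogeneous generated in positive degrees *)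
Definition M_sequence (g : seq int) : Prop :=
  exists (K : fieldType) (m : nat) (gens : seq {mpoly K[m]}),
    (forall q, q \in gens -> exists2 e, (0 < e)%N & q \is e.-homog) /\
    (forall i, exists c, graded_piece_dim (fun q => q \in gens) i c /\
                         (c%:Z = nth 0 g i)).

(* Main.v *)
Require Import Defs.
From HB Require Import structures.
From mathcomp Require Import all_boot all_order all_algebra.
From mathcomp Require Import perm mpoly boolp ring zify.

Set Implicit Arguments.
Unset Strict Implicit.
Unset Printing Implicit Defensive.

Import Order.TTheory GRing.Theory Num.Theory.
Local Open Scope ring_scope.

(* A shelling of [Delta] refines to a shelling of its barycentric subdivision:
   the subdivided facet [F_j] is the cone, with apex the vertex [F_j], over the
   subdivided boundary of [F_j], and by induction on the dimension that boundary
   is a shelled sphere whose initial part subdivides the intersection of [F_j]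
   with the earlier facets.

   The Lefschetz property is proved first for generic linear forms in
   characteristic 2.  On a sphere there is an explicit degree map, a sum over the
   facets of rational functions of the coefficients; the differential identity of
   Papadakis and Petrotou, d_I deg(g^2 x_J) = deg(g x_M)^2, shows that powers of
   the generic form act injectively below the middle degree.  Eliminating the apex
   carries this over to the cone over a sphere with one more linear form, and a
   Mayer-Vietoris argument (after Kubitzke and Nevo) adds these cones one by one;
   it only needs multiplication by the apex to be injective on the cone over the
   initial part of the boundary, which is the induction hypothesis.

   In the bases of squarefree monomials given by the restriction sets of the
   shelling, injectivity is the nonvanishing of some minors, and these are integer
   polynomials in the coefficients; being nonzero modulo 2, they are nonzero at
   some point over the reals.  The restriction sets count the h-vector, so the
   quotient by the Lefschetz element, truncated above the middle degree, has the
   g-vector as its Hilbert function. *)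

(** * Stanley-Reisner ideals of shelled complexes *)

(** Characteristic 2 does two jobs. Squares are constants for every derivation, so in
    [Deg (g ^+ 2 * xs K J)] the factors coming from [g] are not differentiated, although the
    coefficients of [g] may involve the variables. And the degree map needs no orientation of the
    sphere, because two equal contributions cancel.

    The transfer to the reals dictates that spanning by the restriction monomials be proved over an
    arbitrary commutative ring, with the product of the facet determinants kept as a factor: one
    matrix over the integer polynomials then specialises to the generic field of characteristic 2
    and to the reals. Genericity is an abstract property, the existence of dual derivations, since
    eliminating an apex replaces the coefficients by rational expressions in them, and these must be
    generic again.

    The essential geometric inputs are the diamond property, which puts a ridge of a subdivided
    boundary into two facets or none, and the fact that a polytope covered by finitely many of its
    faces lies in one of them, which turns unions of sets into statements about chains of faces. *)

Section StanleyReisner.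
Variables (n : nat) (K : comNzRingType).
Local Notation cell := ({set 'I_n} * {set 'I_n})%type.
Implicit Types (p q : {mpoly K[n]}) (m : 'X_{1..n}) (s : seq cell).
Implicit Types (S T F : {set 'I_n}).

Definition msup m : {set 'I_n} := [set i | m i != 0%N].

Definition inS s T := has (fun c : cell => T \subset c.1) s.

(** Membership in the Stanley-Reisner ideal of the complex spanned by [s]: this ideal is spanned by
    monomials, so it can be read off from the coefficients. *)
Definition vanish s p := forall m, inS s (msup m) -> p@_m = 0.

Lemma inS_sub s S T : S \subset T -> inS s T -> inS s S.
Proof.
move=> sST /hasP[c cs Tc]; apply/hasP; exists c => //; exact: subset_trans Tc.
Qed.

Lemma inS_cat s1 s2 T : inS (s1 ++ s2) T = inS s1 T || inS s2 T.
Proof. exact: has_cat. Qed.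

Lemma inS_rcons s c T : inS (rcons s c) T = inS s T || (T \subset c.1).
Proof. by rewrite /inS has_rcons orbC. Qed.

Lemma msupD m1 m2 : msup (m1 + m2) = msup m1 :|: msup m2.
Proof. by apply/setP=> i; rewrite !inE mnmDE addn_eq0 negb_and. Qed.

Lemma msupU i : msup U_(i) = [set i].
Proof. by apply/setP=> j; rewrite !inE mnm1E [j == i]eq_sym; case: (i == j). Qed.

Lemma vanish0 s : vanish s 0.
Proof. by move=> m _; rewrite mcoeff0. Qed.

Lemma vanishD s p q : vanish s p -> vanish s q -> vanish s (p + q).
Proof. by move=> hp hq m hm; rewrite mcoeffD hp ?hq ?addr0. Qed.

Lemma vanishN s p : vanish s p -> vanish s (- p).
Proof. by move=> hp m hm; rewrite mcoeffN hp ?oppr0. Qed.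

Lemma vanishB s p q : vanish s p -> vanish s q -> vanish s (p - q).
Proof. by move=> hp hq; apply/vanishD/vanishN. Qed.

Lemma vanishMl s p q : vanish s p -> vanish s (q * p).
Proof.
move=> hp m hm; rewrite mcoeffM big1 // => -[l1 l2] /=.
move: (bmnm l1) (bmnm l2) => k1 k2 /eqP e.
rewrite (hp k2) ?mulr0 //; apply: inS_sub hm.
by rewrite e msupD subsetUr.
Qed.

Lemma vanishMr s p q : vanish s p -> vanish s (p * q).
Proof. by rewrite mulrC; apply: vanishMl. Qed.

Lemma vanishZ s a p : vanish s p -> vanish s (a *: p).
Proof. by rewrite -mul_mpolyC; apply: vanishMl. Qed.

Lemma vanish_sum (I : Type) (r : seq I) (P : pred I) (F : I -> {mpoly K[n]}) s :
  (forall i, P i -> vanish s (F i)) -> vanish s (\sum_(i <- r | P i) F i).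
Proof.
move=> h; elim/big_rec: _ => [|i p Pi hp]; first exact: vanish0.
by apply: vanishD => //; apply: h.
Qed.

Lemma vanishX s m : ~~ inS s (msup m) -> vanish s 'X_[m].
Proof.
move=> hm m' hm'; rewrite mcoeffX; case: eqP => // e.
by rewrite e hm' in hm.
Qed.

Lemma vanish_sub s1 s2 p :
  (forall T, inS s2 T -> inS s1 T) -> vanish s1 p -> vanish s2 p.
Proof. by move=> h hp m hm; apply/hp/h. Qed.

Definition lf (a : 'I_n -> K) : {mpoly K[n]} := \sum_v a v *: 'X_v.

Lemma lf_homog a : lf a \is 1.-homog.
Proof.
by apply: rpred_sum => v _; apply: rpredZ; rewrite dhomogX; apply/eqP/mdeg1.
Qed.

Lemma lf_comb (a b : 'I_n -> K) c : lf (fun v => a v + c * b v) = lf a + c *: lf b.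
Proof.
rewrite /lf scaler_sumr -big_split /=; apply: eq_bigr => v _.
by rewrite scalerDl scalerA.
Qed.

(* Membership in the ideal generated by the Stanley-Reisner ideal of the
   complex spanned by the facets [c.1], [c \in s], and the linear forms with
   coefficients [a 0], ..., [a D.-1]. *)
Definition inJ s (D : nat) (a : nat -> 'I_n -> K) p :=
  exists q : nat -> {mpoly K[n]}, vanish s (p - \sum_(r < D) lf (a r) * q r).

Section J.
Variables (D : nat) (a : nat -> 'I_n -> K).

Lemma vanish_inJ s p : vanish s p -> inJ s D a p.
Proof.
move=> h; exists (fun=> 0); rewrite big1 ?subr0 // => r _; exact: mulr0.
Qed.

Lemma inJ0 s : inJ s D a 0.
Proof. exact/vanish_inJ/vanish0. Qed.

Lemma inJD s p q : inJ s D a p -> inJ s D a q -> inJ s D a (p + q).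
Proof.
move=> [f hf] [g hg]; exists (fun r => f r + g r).
under eq_bigr do rewrite mulrDr.
by rewrite big_split /= opprD addrACA; apply: vanishD.
Qed.

Lemma inJMl s p q : inJ s D a p -> inJ s D a (q * p).
Proof.
move=> [f hf]; exists (fun r => q * f r).
under eq_bigr do rewrite mulrCA.
by rewrite -mulr_sumr -mulrBr; apply: vanishMl.
Qed.

Lemma inJMr s p q : inJ s D a p -> inJ s D a (p * q).
Proof. by rewrite mulrC; apply: inJMl. Qed.

Lemma inJN s p : inJ s D a p -> inJ s D a (- p).
Proof. by rewrite -mulN1r; apply: inJMl. Qed.

Lemma inJB s p q : inJ s D a p -> inJ s D a q -> inJ s D a (p - q).
Proof. by move=> hp /inJN; apply: inJD. Qed.

Lemma inJZ s c p : inJ s D a p -> inJ s D a (c *: p).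
Proof. by rewrite -mul_mpolyC; apply: inJMl. Qed.

Lemma inJ_sum (I : Type) (r : seq I) (P : pred I) (F : I -> {mpoly K[n]}) s :
  (forall i, P i -> inJ s D a (F i)) -> inJ s D a (\sum_(i <- r | P i) F i).
Proof.
move=> h; elim/big_rec: _ => [|i p Pi hp]; first exact: inJ0.
by apply: inJD => //; apply: h.
Qed.

Lemma inJ_lf s r : (r < D)%N -> inJ s D a (lf (a r)).
Proof.
move=> rD; exists (fun k => (k == r)%:R).
rewrite (bigD1 (Ordinal rD)) //= eqxx mulr1 big1 ?addr0 ?subrr.
  exact: vanish0.
by move=> i /negbTE ne; rewrite -val_eqE /= in ne; rewrite ne mulr0.
Qed.

Lemma inJ_sub s1 s2 p :
  (forall T, inS s2 T -> inS s1 T) -> inJ s1 D a p -> inJ s2 D a p.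
Proof. by move=> h [q hq]; exists q; apply: vanish_sub hq. Qed.

Lemma mcoeff_pihomog (d : nat) p m :
  (pihomog mdeg d p)@_m = if mdeg m == d then p@_m else 0.
Proof.
rewrite pihomogE raddf_sum /= big_mkcond /=.
transitivity (\sum_(k <- msupp p) if mdeg m == d then (p@_k *: 'X_[k])@_m else 0).
  apply: eq_bigr => k _; rewrite mcoeffZ mcoeffX.
  by case: (eqVneq k m) => [->|]; rewrite ?mulr0 //; do 2 case: ifP.
case: ifP => _; last by rewrite big1.
by rewrite [in RHS](mpolyE p) raddf_sum.
Qed.

Lemma vanish_pihomog s d p : vanish s p -> vanish s (pihomog mdeg d p).
Proof. by move=> h m hm; rewrite mcoeff_pihomog; case: ifP => // _; apply: h. Qed.

Lemma pihomog_lfM b d p :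
  pihomog mdeg d (lf b * p) = if d is d'.+1 then lf b * pihomog mdeg d' p else 0.
Proof.
have hX (v : 'I_n) q : pihomog mdeg d ('X_v * q) =
    if d is d'.+1 then 'X_v * pihomog mdeg d' q else 0.
  rewrite {1}[q]mpolyE mulr_sumr raddf_sum /=.
  transitivity (\sum_(m <- msupp q)
     if d is d'.+1 then 'X_v * (q@_m *: pihomog mdeg d' 'X_[m]) else 0).
    apply: eq_bigr => m _; rewrite -scalerAr -mpolyXD linearZ /= pihomogX /= mdegD.
    rewrite mdeg1 add1n; case: d => [|d]; first by rewrite scaler0.
    rewrite eqSS pihomogX /=; case: ifP => _; last by rewrite !scaler0 mulr0.
    by rewrite -scalerAr mpolyXD.
  case: d => [|d]; first by rewrite big1.
  rewrite -mulr_sumr; congr (_ * _); rewrite [in RHS](mpolyE q) raddf_sum /=.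
  by apply: eq_bigr => m _; rewrite linearZ.
rewrite /lf mulr_suml raddf_sum /=.
transitivity (\sum_v if d is d'.+1 then b v *: 'X_v * pihomog mdeg d' p else 0).
  apply: eq_bigr => v _; rewrite -scalerAl linearZ /= hX.
  by case: d {hX} => [|d]; rewrite ?scaler0 // scalerAl.
by case: d {hX} => [|d]; [rewrite big1 | rewrite mulr_suml].
Qed.

(** Both kinds of generators are homogeneous: each multiplier is replaced by its component one
    degree lower, and nothing is left of it in degree 0. *)
Lemma inJ_pihomog s d p : inJ s D a p -> inJ s D a (pihomog mdeg d p).
Proof.
move=> [q hq]; exists (fun r => if d is d'.+1 then pihomog mdeg d' (q r) else 0).
have := vanish_pihomog d hq; rewrite pihomogB.
rewrite (_ : pihomog mdeg d (\sum_(r < D) _) =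
    \sum_(r < D) pihomog mdeg d (lf (a r) * q r)); last exact: raddf_sum.
under eq_bigr => r _ do rewrite pihomog_lfM.
by case: d => // h; under eq_bigr do rewrite mulr0.
Qed.

End J.

Definition mset S : 'X_{1..n} := [multinom (i \in S : nat) | i < n].
Definition xs S : {mpoly K[n]} := 'X_[mset S].

Lemma mnm_set S i : mset S i = (i \in S).
Proof. by rewrite mnmE. Qed.

Lemma msup_set S : msup (mset S) = S.
Proof. by apply/setP=> i; rewrite !inE mnm_set; case: (i \in S). Qed.

Lemma mdeg_set S : mdeg (mset S) = #|S|.
Proof.
rewrite mdegE -sum1_card [RHS]big_mkcond /=; apply: eq_bigr => i _.
by rewrite mnm_set; case: (i \in S).
Qed.

Lemma xs_homog S : xs S \is #|S|.-homog.
Proof. by rewrite dhomogX; apply/eqP/mdeg_set. Qed.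

Lemma xs0 : xs set0 = 1.
Proof.
rewrite /xs -mpolyX0; congr 'X_[_]; apply/mnmP => i.
by rewrite mnm_set inE mnm0E.
Qed.

Lemma xsU1 v S : v \notin S -> xs (v |: S) = 'X_v * xs S.
Proof.
move=> vS; rewrite /xs -mpolyXD; congr 'X_[_]; apply/mnmP => i.
rewrite mnmDE !mnm_set mnm1E !inE eq_sym; case: (eqVneq v i) => [<-|] //=.
by rewrite (negbTE vS).
Qed.

Lemma xs_prod S : xs S = \prod_(i in S) 'X_i.
Proof.
rewrite /xs mpolyXE_id [RHS]big_mkcond /=; apply: eq_bigr => i _.
by rewrite mnm_set; case: (i \in S); rewrite ?expr1 ?expr0.
Qed.

Lemma vanish_xs s S : ~~ inS s S -> vanish s (xs S).
Proof. by move=> h; apply: vanishX; rewrite msup_set. Qed.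

Lemma vanish_xsM s S p :
  (forall m, S \subset msup m -> inS s (msup m) -> False) -> vanish s (xs S * p).
Proof.
move=> h m hm; rewrite mcoeffM big1 // => -[l1 l2] /=.
move: (bmnm l1) (bmnm l2) => k1 k2 /eqP e.
rewrite mcoeffX; case: eqP => [e1|_]; last by rewrite mul0r.
case: (h m) => //; rewrite e msupD -e1 msup_set subsetUl //.
Qed.

(* A cell is a facet [c.1] with its restriction [c.2]: the faces of [c.1] that are
   not in the earlier facets are those containing [c.2]. *)
Definition shell s := forall s1 c s2, s = s1 ++ c :: s2 ->
  c.2 \subset c.1 /\ forall T, T \subset c.1 -> inS s1 T = ~~ (c.2 \subset T).

Lemma shell_rcons s c : shell (rcons s c) <-> [/\ shell s, c.2 \subset c.1 &
  forall T, T \subset c.1 -> inS s T = ~~ (c.2 \subset T)].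
Proof.
split=> [h|[hs hc hT] s1 c' s2].
  split; first by move=> s1 c' s2 e; apply: (h s1 c' (rcons s2 c)); rewrite e rcons_cat.
    by case: (h s c [::]) => //; rewrite cats1.
  by case: (h s c [::]) => //; rewrite cats1.
case/lastP: s2 => [|s2 c2].
  by rewrite cats1 => /rcons_inj[<- <-].
by rewrite -rcons_cons -rcons_cat => /rcons_inj[e _]; apply: (hs _ _ _ e).
Qed.

Lemma shell_catl s1 s2 : shell (s1 ++ s2) -> shell s1.
Proof.
by move=> h t1 c t2 e; apply: (h t1 c (t2 ++ s2)); rewrite e -catA.
Qed.

(** A monomial of [p] supported on the new facet is not an old face, hence is divisible by [xs c.2];
    the other monomials of [p] are non-faces of the new complex as well. Together with [vanish_new]
    this identifies the kernel of the restriction to the old complex with the ring of the new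
    simplex, shifted by [xs c.2]. *)
Lemma vanish_rcons_split s c p : shell (rcons s c) -> vanish s p ->
  exists u, vanish (rcons s c) (p - xs c.2 * u).
Proof.
move=> /shell_rcons[_ cc hT] hp.
exists (\sum_(m <- msupp p | msup m \subset c.1) p@_m *: 'X_[m - mset c.2]).
rewrite {1}[p]mpolyE (bigID (fun m => msup m \subset c.1)) /= mulr_sumr.
rewrite addrAC -sumrB big1_seq ?add0r.
  rewrite big_seq_cond; apply: vanish_sum => m /andP[mp mc]; apply: vanishZ.
  apply: vanishX; rewrite inS_rcons (negbTE mc) orbF.
  by apply: contraL mp => hm; rewrite mcoeff_msupp hp ?eqxx.
move=> m /andP[mc mp]; rewrite -scalerAr -mpolyXD addmC submK ?subrr //.
apply/mnm_lepP => i; rewrite mnm_set; case: (boolP (i \in c.2)) => //= ic.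
have := hT _ mc; case: (boolP (inS s (msup m))) => [hm|_ /esym /negbFE/subsetP/(_ _ ic)].
  by move: mp; rewrite mcoeff_msupp hp ?eqxx.
by rewrite inE lt0n.
Qed.

Lemma vanish_new s c p : shell (rcons s c) -> vanish [:: c] p ->
  vanish (rcons s c) (xs c.2 * p).
Proof.
move=> /shell_rcons[_ cc hT] hp m.
rewrite inS_rcons => /orP[hm|hm]; last first.
  by apply: (vanishMl (xs c.2) hp); rewrite /inS /= hm.
suff : vanish s (xs c.2 * p) by exact.
apply: vanish_xsM => k ck /(inS_sub ck); rewrite hT ?cc //.
by rewrite subxx.
Qed.

End StanleyReisner.

(** * Spanning by the restriction monomials, over any commutative ring *)

Section Spanning.
Variables (n : nat) (K : comNzRingType) (v0 : 'I_n).
Local Notation cell := ({set 'I_n} * {set 'I_n})%type.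
Implicit Types (p q : {mpoly K[n]}) (m : 'X_{1..n}) (s : seq cell).
Implicit Types (F : {set 'I_n}).

Definition en F (i : nat) : 'I_n := nth v0 (enum F) i.
Definition c00 : cell := (set0, set0).

Lemma en_in D F (i : 'I_D) : #|F| = D -> en F i \in F.
Proof. by move=> FD; rewrite -mem_enum mem_nth // -cardE FD. Qed.

Lemma en_inj D F : #|F| = D -> injective (fun i : 'I_D => en F i).
Proof.
move=> FD i j /eqP; rewrite nth_uniq ?enum_uniq -?cardE ?FD //.
by move/eqP/val_inj.
Qed.

Lemma en_surj D F v : #|F| = D -> v \in F -> exists i : 'I_D, v = en F i.
Proof.
move=> FD vF; have h : (index v (enum F) < D)%N.
  by rewrite -FD cardE index_mem mem_enum.
by exists (Ordinal h); rewrite /en /= nth_index // mem_enum.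
Qed.

Lemma big_facet (R : Type) (idx : R) (op : Monoid.com_law idx) D F (f : 'I_n -> R) :
  #|F| = D -> \big[op/idx]_(v in F) f v = \big[op/idx]_(i < D) f (en F i).
Proof.
move=> FD; rewrite -big_enum /= (big_nth v0) -cardE FD.
by rewrite big_mkord.
Qed.

Variables (D : nat) (a : nat -> 'I_n -> K).

Definition Amx F : 'M[K]_D := \matrix_(r, i) a r (en F i).

Lemma lf_facet (c : cell) (b : 'I_n -> K) : #|c.1| = D ->
  vanish [:: c] (lf b - \sum_(i < D) b (en c.1 i) *: 'X_(en c.1 i)).
Proof.
move=> FD; rewrite -(big_facet _ (fun v => b v *: 'X_v) FD).
rewrite /lf [X in X - _](bigID (fun v => v \in c.1)) /= addrAC subrr add0r.
apply: vanish_sum => v vF; apply: vanishZ; apply: vanishX.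
by rewrite msupU /inS /= orbF sub1set.
Qed.

(** Cramer's rule for the linear system that the forms induce on the simplex [c.1]; the adjugate
    avoids any division in the ring [K]. *)
Lemma facet_var (c : cell) v : #|c.1| = D ->
  inJ [:: c] D a (\det (Amx c.1) *: 'X_v).
Proof.
move=> FD; case: (boolP (v \in c.1)) => [/(en_surj FD)[i ->]|vF]; last first.
  apply/vanish_inJ/vanishZ/vanishX.
  by rewrite msupU /inS /= orbF sub1set.
pose A := Amx c.1.
exists (fun r => \sum_(k < D | k == r :> nat) (\adj A i k)%:MP).
have -> : \sum_(r < D) lf (a r) * (\sum_(k < D | k == r :> nat) (\adj A i k)%:MP)
   = \sum_(r < D) \adj A i r *: lf (a r).
  apply: eq_bigr => r _; rewrite (big_pred1 r) => [|k]; last by [].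
  by rewrite mulrC mul_mpolyC.
have -> : \det A *: 'X_(en c.1 i) = \sum_(r < D) \adj A i r *:
    \sum_(j < D) a r (en c.1 j) *: 'X_(en c.1 j) :> {mpoly K[n]}.
  under eq_bigr do rewrite scaler_sumr.
  rewrite exchange_big /= (bigD1 i) //= [X in _ + X]big1 => [|j ji].
    under eq_bigr do rewrite scalerA.
    rewrite -scaler_suml addr0; congr (_ *: _).
    have := congr1 (fun M : 'M_D => M i i) (mul_adj_mx A).
    by rewrite !mxE eqxx mulr1n => <-; apply: eq_bigr => r _; rewrite !mxE.
  under eq_bigr do rewrite scalerA.
  rewrite -scaler_suml; set x := \sum_(_ < _) _; suff -> : x = 0 by rewrite scale0r.
  have := congr1 (fun M : 'M_D => M i j) (mul_adj_mx A).
  rewrite !mxE [i == j]eq_sym (negbTE ji) mulr0n => <-.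
  by apply: eq_bigr => r _; rewrite !mxE.
rewrite -sumrB; apply: vanish_sum => r _; rewrite -scalerBr; apply: vanishZ.
by rewrite -opprB; apply/vanishN/lf_facet.
Qed.

Lemma facet_const (c : cell) p : #|c.1| = D ->
  inJ [:: c] D a (\det (Amx c.1) *: (p - (p@_0)%:MP)).
Proof.
move=> FD.
have -> : p - (p@_0)%:MP = \sum_(m <- msupp p | m != 0%MM) p@_m *: 'X_[m].
  rewrite {1}[p]mpolyE (bigID (fun m => m == 0%MM)) /= addrAC.
  suff -> : \sum_(m <- msupp p | m == 0%MM) p@_m *: 'X_[m] = (p@_0)%:MP :> {mpoly K[n]}.
    by rewrite subrr add0r.
  rewrite (eq_bigr (fun=> p@_0 *: 1)) => [|m /eqP->]; last by rewrite mpolyX0.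
  rewrite big_const_seq -{1}[p@_0 *: 1]mul_mpolyC mulr1.
  rewrite (count_uniq_mem 0%MM (msupp_uniq p)).
  rewrite mcoeff_msupp; case: eqP => [->|_] /=; first by rewrite mpolyC0.
  by rewrite addr0.
rewrite scaler_sumr; apply: inJ_sum => m m0.
have /existsP[v vm] : [exists v, m v != 0%N].
  apply: contraNT m0 => /existsPn h; apply/eqP/mnmP => v.
  by rewrite mnm0E; apply/eqP/negPn/h.
rewrite -(@submK _ U_(v)%MM m); last by rewrite lep1mP.
rewrite mpolyXD scalerA mulrC -scalerA scalerAr; apply/inJZ/inJMl.
exact: facet_var.
Qed.

(** On a single simplex the quotient by the forms is spanned by 1 once the determinant is inverted,
    so adding a facet costs one scalar multiple of [xs c.2]. *)
Lemma inJ_rcons s c p : shell (rcons s c) -> #|c.1| = D -> inJ s D a p ->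
  exists e, inJ (rcons s c) D a (\det (Amx c.1) *: p - e *: xs K c.2).
Proof.
move=> sh FD [q hq]; have [u hu] := vanish_rcons_split sh hq.
exists (\det (Amx c.1) * u@_0).
set Th := \sum_(r < D) _ in hq hu; set d := \det _.
have -> : d *: p - (d * u@_0) *: xs K c.2 =
   d *: Th + d *: (p - Th - xs K c.2 * u) + xs K c.2 * (d *: (u - (u@_0)%:MP)).
  rewrite -scalerA -scalerAr -!scalerDr -scalerN -scalerDr; congr (_ *: _).
  rewrite mulrBr -[_ * _%:MP]mulrC mul_mpolyC; ring.
apply: inJD; first apply: inJD.
- apply/inJZ; apply: inJ_sum => r _; apply/inJMr/inJ_lf/ltn_ord.
- exact/inJZ/vanish_inJ.
have [g hg] := facet_const u FD; exists (fun r => xs K c.2 * g r).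
under eq_bigr do rewrite mulrCA.
by rewrite -mulr_sumr -mulrBr; apply: vanish_new.
Qed.

Definition detprod s := \prod_(c <- s) \det (Amx c.1).

Lemma spanning s p : shell s -> (forall c, c \in s -> #|c.1| = D) ->
  exists e : nat -> K, inJ s D a
    (detprod s *: p - \sum_(j < size s) e j *: xs K (nth c00 s j).2).
Proof.
elim/last_ind: s => [|s c IH] sh FD.
  by exists (fun=> 0); apply: vanish_inJ.
have [sh' _ _] := (shell_rcons s c).1 sh.
have [|e he] := IH sh'; first by move=> c' h; apply: FD; rewrite mem_rcons inE h orbT.
have cD : #|c.1| = D by apply: FD; rewrite mem_rcons mem_head.
have [x hx] := inJ_rcons sh cD he.
exists (fun j => if (j < size s)%N then \det (Amx c.1) * e j else x).
rewrite /detprod big_rcons size_rcons big_ord_recr /= ltnn nth_rcons ltnn eqxx.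
move: hx; rewrite scalerBr scaler_sumr -[in X in X -> _]addrA -opprD /detprod scalerA mulrC.
congr (inJ _ _ _ (_ - (_ + _))); apply: eq_bigr => j _.
by rewrite ltn_ord nth_rcons ltn_ord scalerA.
Qed.

Lemma spanning_homog s p i : shell s -> (forall c, c \in s -> #|c.1| = D) ->
  p \is i.-homog ->
  exists e : nat -> K, inJ s D a
    (detprod s *: p - \sum_(j < size s | #|(nth c00 s j).2| == i)
                         e j *: xs K (nth c00 s j).2).
Proof.
move=> sh FD pi; have [e he] := spanning p sh FD; exists e.
have := inJ_pihomog i he; rewrite pihomogB.
rewrite (_ : pihomog mdeg i (\sum_(j < size s) _) =
    \sum_(j < size s) pihomog mdeg i (e j *: xs K (nth c00 s j).2)); last exact: raddf_sum.
rewrite pihomog_dE ?rpredZ // [in X in _ -> X]big_mkcond /=.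
congr (inJ _ _ _ (_ - _)); apply: eq_bigr => j _.
rewrite linearZ /= pihomogX /= mdeg_set; case: ifP => _ //.
by rewrite scaler0.
Qed.

End Spanning.

(** * Freeness over the polynomial ring in the linear forms *)

Section Freeness.
Variables (n : nat) (K : fieldType) (v0 : 'I_n) (D : nat) (a : nat -> 'I_n -> K).
Local Notation cell := ({set 'I_n} * {set 'I_n})%type.
Local Notation A F := (Amx v0 D a F).
Local Notation en := (en v0).
Local Notation c00 := (c00 n).
Implicit Types (p q : {mpoly K[n]}) (m : 'X_{1..n}) (s : seq cell).
Implicit Types (F : {set 'I_n}).

Definition Theta (g : {mpoly K[D]}) : {mpoly K[n]} :=
  g \mPo [tuple lf (a r) | r < D].

Definition Lv F v : {mpoly K[D]} :=
  \sum_(i < D | en F i == v) \sum_(r < D) invmx (A F) i r *: 'X_r.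

(** Restriction to the facet [F] in the coordinates given by the forms: [Lv F v] is the variable of
    [v] expressed through them on [F]. When the determinant is nonzero, the kernel is the ideal of
    the simplex and [Theta] is a section. *)
Definition rho F p : {mpoly K[D]} := p \mPo [tuple Lv F v | v < n].

Lemma ThetaM g h : Theta (g * h) = Theta g * Theta h.
Proof. exact: rmorphM. Qed.

Lemma rhoM F p q : rho F (p * q) = rho F p * rho F q.
Proof. exact: rmorphM. Qed.

Lemma Lv_en F (i : 'I_D) : #|F| = D ->
  Lv F (en F i) = \sum_(r < D) invmx (A F) i r *: 'X_r.
Proof.
move=> FD; rewrite /Lv (big_pred1 i) // => j.
by rewrite (inj_eq (en_inj (v0 := v0) FD)).
Qed.

Lemma Lv_out F v : #|F| = D -> v \notin F -> Lv F v = 0.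
Proof.
move=> FD vF; rewrite /Lv big1 // => i /eqP e.
by rewrite -e en_in in vF.
Qed.

Lemma rhoX F v : rho F 'X_v = Lv F v.
Proof. by rewrite /rho comp_mpolyXU -tnth_nth tnth_mktuple. Qed.

Lemma ThetaX (r : 'I_D) : Theta 'X_r = lf (a r).
Proof. by rewrite /Theta comp_mpolyXU -tnth_nth tnth_mktuple. Qed.

Lemma rho_lf F (r : 'I_D) : #|F| = D -> \det (A F) != 0 ->
  rho F (lf (a r)) = 'X_r.
Proof.
move=> FD dF; rewrite /lf /rho raddf_sum /=.
transitivity (\sum_(v in F) a r v *: Lv F v).
  rewrite [RHS]big_mkcond; apply: eq_bigr => v _.
  rewrite comp_mpolyZ -/(rho F _) rhoX; case: ifPn => // vF.
  by rewrite Lv_out ?scaler0.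
rewrite (big_facet v0 _ _ FD) /=.
under eq_bigr do rewrite Lv_en // scaler_sumr.
rewrite exchange_big /= (bigD1 r) //= [X in _ + X]big1 => [|k kr].
  under eq_bigr do rewrite scalerA.
  rewrite -scaler_suml addr0 (_ : \sum_(_ < D) _ = 1) ?scale1r //.
  have uA : A F \in unitmx by rewrite unitmxE unitfE.
  have := congr1 (fun M : 'M_D => M r r) (mulmxV uA).
  by rewrite !mxE eqxx mulr1n => <-; apply: eq_bigr => i _; rewrite !mxE.
under eq_bigr do rewrite scalerA.
rewrite -scaler_suml (_ : \sum_(_ < D) _ = 0) ?scale0r //.
have uA : A F \in unitmx by rewrite unitmxE unitfE.
have := congr1 (fun M : 'M_D => M r k) (mulmxV uA).
rewrite !mxE [r == k]eq_sym (negbTE kr) mulr0n => h; rewrite -[RHS]h.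
by apply: eq_bigr => i _; rewrite !mxE.
Qed.

Lemma rhoXm F m : rho F 'X_[m] = \prod_(v < n) Lv F v ^+ m v.
Proof.
rewrite /rho comp_mpolyX; apply: eq_bigr => v _; by rewrite tnth_mktuple.
Qed.

Lemma rho_vanish (c : cell) p : #|c.1| = D -> vanish [:: c] p -> rho c.1 p = 0.
Proof.
move=> FD hp; rewrite [p]mpolyE /rho raddf_sum /= big1_seq // => m /= mp.
rewrite comp_mpolyZ -/(rho _ _) rhoXm.
case: (boolP (msup m \subset c.1)) => [mc|/subsetPn[v vm vc]].
  by rewrite hp ?scale0r // /inS /= mc.
rewrite (bigD1 v) //= Lv_out // expr0n; move: vm; rewrite inE => /negbTE ->.
by rewrite mul0r scaler0.
Qed.

Lemma ThetaK F g : #|F| = D -> \det (A F) != 0 -> rho F (Theta g) = g.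
Proof.
move=> FD dF.
have -> : Theta g = \sum_(m <- msupp g) g@_m *: Theta 'X_[m].
  rewrite /Theta {1}[g]mpolyE raddf_sum /=.
  by apply: eq_bigr => m _; rewrite comp_mpolyZ.
rewrite /rho raddf_sum /= [RHS]mpolyE; apply: eq_bigr => m _.
rewrite comp_mpolyZ /Theta; congr (_ *: _).
rewrite comp_mpolyX rmorph_prod /= [RHS]mpolyXE_id; apply: eq_bigr => r _.
by rewrite rmorphXn /= tnth_mktuple -/(rho F _) rho_lf.
Qed.

Lemma Theta_rho (c : cell) p : #|c.1| = D -> \det (A c.1) != 0 ->
  vanish [:: c] (p - Theta (rho c.1 p)).
Proof.
move=> FD dF; pose P p := vanish [:: c] (p - Theta (rho c.1 p)).
have PM p1 p2 : P p1 -> P p2 -> P (p1 * p2).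
  rewrite /P rhoM ThetaM; move: (Theta (rho c.1 p1)) (Theta (rho c.1 p2)) => q1 q2 h1 h2.
  rewrite (_ : _ - _ = p1 * (p2 - q2) + (p1 - q1) * q2); last by ring.
  by apply: vanishD; [apply: vanishMl | apply: vanishMr].
have P1 : P 1 by rewrite /P /rho /Theta !comp_mpoly1 subrr; apply: vanish0.
have PX v : P 'X_v.
  rewrite /P rhoX; case: (boolP (v \in c.1)) => [/(en_surj v0 FD)[i ->]|vc].
    rewrite Lv_en //.
    have -> : Theta (\sum_(r < D) invmx (A c.1) i r *: 'X_r) =
        \sum_(r < D) invmx (A c.1) i r *: lf (a r).
      rewrite /Theta raddf_sum /=; apply: eq_bigr => r _.
      by rewrite comp_mpolyZ -/(Theta _) ThetaX.
    have -> : 'X_(en c.1 i) = \sum_(r < D) invmx (A c.1) i r *: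
       \sum_(j < D) a r (en c.1 j) *: 'X_(en c.1 j) :> {mpoly K[n]}.
      have uA : A c.1 \in unitmx by rewrite unitmxE unitfE.
      under eq_bigr do rewrite scaler_sumr.
      rewrite exchange_big /= (bigD1 i) //= [X in _ + X]big1 => [|j ji].
        under eq_bigr do rewrite scalerA.
        rewrite -scaler_suml addr0 (_ : \sum_(_ < D) _ = 1) ?scale1r //.
        have := congr1 (fun M : 'M_D => M i i) (mulVmx uA).
        by rewrite !mxE eqxx mulr1n => <-; apply: eq_bigr => r _; rewrite !mxE.
      under eq_bigr do rewrite scalerA.
      rewrite -scaler_suml (_ : \sum_(_ < D) _ = 0) ?scale0r //.
      have := congr1 (fun M : 'M_D => M i j) (mulVmx uA).
      rewrite !mxE [i == j]eq_sym (negbTE ji) mulr0n => h; rewrite -[RHS]h.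
      by apply: eq_bigr => r _; rewrite !mxE.
    rewrite -sumrB; apply: vanish_sum => r _; rewrite -scalerBr; apply: vanishZ.
    by rewrite -opprB; apply/vanishN/lf_facet.
  rewrite Lv_out // /Theta comp_mpoly0 subr0; apply: vanishX.
  by rewrite msupU /inS /= orbF sub1set.
have -> : Theta (rho c.1 p) = \sum_(m <- msupp p) p@_m *: Theta (rho c.1 'X_[m]).
  rewrite {1}[p]mpolyE /rho raddf_sum /Theta raddf_sum /=.
  by apply: eq_bigr => m _; rewrite !comp_mpolyZ.
rewrite {1}[p]mpolyE -sumrB.
apply: vanish_sum => m _ /=; rewrite -scalerBr; apply: vanishZ.
suff : P 'X_[m] by [].
move: (P) PM P1 PX => Q QM Q1 QX; rewrite mpolyXE_id; apply: (big_ind Q) => // v _.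
by elim: (m v) => [|k IH]; rewrite ?expr0 // exprS; apply: QM.
Qed.

Lemma Lv_neq0 F v : #|F| = D -> \det (A F) != 0 -> v \in F -> Lv F v != 0.
Proof.
move=> FD dF /(en_surj v0 FD)[i ->]; rewrite Lv_en //; apply/eqP => h.
have uA : A F \in unitmx by rewrite unitmxE unitfE.
have r0 r : invmx (A F) i r = 0.
  have := congr1 (mcoeff U_(r)) h; rewrite raddf_sum /= mcoeff0 (bigD1 r) //=.
  rewrite mcoeffZ mcoeffXU eqxx mulr1 big1 ?addr0 // => k kr.
  by rewrite mcoeffZ mcoeffXU (negbTE kr) mulr0.
have := congr1 (fun M : 'M_D => M i i) (mulVmx uA).
rewrite !mxE eqxx big1 => [/esym/eqP|r _]; first by rewrite oner_eq0.
by rewrite r0 mul0r.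
Qed.

Lemma detprod_neq0 (s : seq cell) :
  (forall c, c \in s -> \det (A c.1) != 0) -> detprod v0 D a s != 0.
Proof. by move=> sd; rewrite /detprod prodf_seq_neq0; apply/allP => c cs /=; apply: sd. Qed.

Section List.
Variable s : seq cell.
Hypotheses (sh : shell s) (sD : forall c, c \in s -> #|c.1| = D).
Hypothesis sd : forall c, c \in s -> \det (A c.1) != 0.

Lemma free_span p : exists g : nat -> {mpoly K[D]},
  vanish s (p - \sum_(j < size s) xs K (nth c00 s j).2 * Theta (g j)).
Proof.
elim/last_ind: s sh sD sd => [|t c IH] sht tD td; first by exists (fun=> 0).
have [sh' _ _] := (shell_rcons t c).1 sht.
have ct : c \in rcons t c by rewrite mem_rcons mem_head.
have [||g hg] := IH sh'; try by move=> c' h; [apply: tD || apply: td];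
  rewrite mem_rcons inE h orbT.
have [u hu] := vanish_rcons_split sht hg.
exists (fun j => if (j < size t)%N then g j else rho c.1 u).
rewrite size_rcons big_ord_recr /= ltnn nth_rcons ltnn eqxx.
rewrite (eq_bigr (fun j : 'I_(size t) => xs K (nth c00 t j).2 * Theta (g j))).
  rewrite opprD addrA; set q := p - _ in hu *.
  rewrite (_ : q - _ = (q - xs K c.2 * u) + xs K c.2 * (u - Theta (rho c.1 u))).
    apply: vanishD => //; apply: vanish_new => //.
    by apply: Theta_rho; [exact: tD | exact: td].
  by rewrite mulrBr addrA subrK.
by move=> j _; rewrite ltn_ord nth_rcons ltn_ord.
Qed.

(** Restriction to the old complex kills the last restriction monomial, so induction deals with the
    old coefficients. On the new facet one term remains, and [rho] sends its monomial to a product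
    of nonzero linear forms. *)
Lemma free_indep (g : nat -> {mpoly K[D]}) :
  vanish s (\sum_(j < size s) xs K (nth c00 s j).2 * Theta (g j)) ->
  forall j, (j < size s)%N -> g j = 0.
Proof.
elim/last_ind: s sh sD sd => [|t c IH] sht tD td // hv.
have [sh' cc hT] := (shell_rcons t c).1 sht.
have ct : c \in rcons t c by rewrite mem_rcons mem_head.
have e : \sum_(j < size (rcons t c)) xs K (nth c00 (rcons t c) j).2 * Theta (g j) =
  \sum_(j < size t) xs K (nth c00 t j).2 * Theta (g j) + xs K c.2 * Theta (g (size t)).
  rewrite size_rcons big_ord_recr /= nth_rcons ltnn eqxx; congr (_ + _).
  by apply: eq_bigr => j _; rewrite nth_rcons ltn_ord.
rewrite e in hv.
have hc : vanish t (xs K c.2 * Theta (g (size t))).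
  by apply/vanishMr/vanish_xs; rewrite hT ?cc // subxx.
have g0 j : (j < size t)%N -> g j = 0.
  apply: IH => //; try by move=> c' h; [apply: tD || apply: td];
    rewrite mem_rcons inE h orbT.
  have hv' : vanish t (\sum_(j < size t) xs K (nth c00 t j).2 * Theta (g j)
       + xs K c.2 * Theta (g (size t))).
    by apply: vanish_sub hv => T; rewrite inS_rcons => ->.
  by have := vanishB hv' hc; rewrite addrK.
move=> j; rewrite size_rcons ltnS leq_eqVlt => /orP[/eqP->|/g0 //].
move: hv; rewrite big1 => [|i _]; last first.
  by rewrite g0 // /Theta comp_mpoly0 mulr0.
rewrite add0r => hv.
have cD := tD _ ct; have cd := td _ ct.
have hvc : vanish [:: c] (xs K c.2 * Theta (g (size t))).
  by apply: vanish_sub hv => T; rewrite inS_rcons /inS /= orbF orbC => ->.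
have := rho_vanish cD hvc; rewrite rhoM ThetaK //.
move/eqP; rewrite mulf_eq0 => /orP[|/eqP//].
rewrite /xs rhoXm => /eqP h; exfalso; move/eqP: h; apply/negP.
rewrite prodf_seq_neq0; apply/allP => v _ /=; rewrite mnm_set.
case: (boolP (v \in c.2)) => vc; last by rewrite expr0 oner_eq0.
by rewrite expr1 Lv_neq0 // (subsetP cc).
Qed.

(** The multipliers of the forms are themselves expanded in the free basis; comparison of constant
    terms then isolates the [e j]. *)
Lemma indep (e : nat -> K) :
  inJ s D a (\sum_(j < size s) e j *: xs K (nth c00 s j).2) ->
  forall j, (j < size s)%N -> e j = 0.
Proof.
move=> [q hq] j js.
have /choice [g hg] : forall r, exists g : nat -> {mpoly K[D]},
  vanish s (q r - \sum_(j < size s) xs K (nth c00 s j).2 * Theta (g j)).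
  by move=> r; apply: free_span.
pose G j := (e j)%:MP_[D] - \sum_(r < D) 'X_r * g r j.
have hG : vanish s (\sum_(j < size s) xs K (nth c00 s j).2 * Theta (G j)).
  have -> : \sum_(j < size s) xs K (nth c00 s j).2 * Theta (G j) =
    (\sum_(j < size s) e j *: xs K (nth c00 s j).2 - \sum_(r < D) lf (a r) * q r) +
    \sum_(r < D) lf (a r) * (q r - \sum_(j < size s) xs K (nth c00 s j).2 * Theta (g r j)).
    under [X in _ = _ + X]eq_bigr do rewrite mulrBr.
    rewrite sumrB addrA subrK.
    under [X in _ = _ - X]eq_bigr do rewrite mulr_sumr.
    rewrite exchange_big /= -sumrB; apply: eq_bigr => k _.
    rewrite /G {1}/Theta comp_mpolyB comp_mpolyC mulrBr -[_ * _%:MP]mulrC mul_mpolyC.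
    congr (_ - _); rewrite raddf_sum /= mulr_sumr; apply: eq_bigr => r _.
    by rewrite -/(Theta _) ThetaM ThetaX mulrCA.
  by apply: vanishD => //; apply: vanish_sum => r _; apply: vanishMl.
have := congr1 (mcoeff 0%MM) (free_indep hG js).
rewrite /G mcoeffB mcoeffC eqxx mulr1 raddf_sum /= mcoeff0 big1 ?subr0 // => r _.
by rewrite rmorphM /= mcoeffX mnm1_eq0 mul0r.
Qed.

End List.
End Freeness.

(** * Derivations in characteristic 2 *)

Definition derivation (K : comNzRingType) (d : K -> K) :=
  (forall x y, d (x + y) = d x + d y) /\
  (forall x y, d (x * y) = d x * y + x * d y).

Section Derivation.
Variables (K : comNzRingType) (d : K -> K).
Hypothesis hd : derivation d.

Lemma derivD x y : d (x + y) = d x + d y. Proof. exact: hd.1. Qed.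
Lemma derivM x y : d (x * y) = d x * y + x * d y. Proof. exact: hd.2. Qed.

Lemma deriv0 : d 0 = 0.
Proof. by apply: (addIr (d 0)); rewrite -derivD !add0r. Qed.

Lemma deriv1 : d 1 = 0.
Proof.
by apply: (addIr (d 1)); rewrite add0r -[in RHS](mulr1 1) derivM mulr1 mul1r.
Qed.

Lemma derivN x : d (- x) = - d x.
Proof. by apply: (addrI (d x)); rewrite -derivD !subrr deriv0. Qed.

Lemma deriv_sum (I : Type) (r : seq I) (P : pred I) (F : I -> K) :
  d (\sum_(i <- r | P i) F i) = \sum_(i <- r | P i) d (F i).
Proof. by elim/big_rec2: _ => [|i x y _ <-]; rewrite ?deriv0 ?derivD. Qed.

Lemma deriv_sqr x : (forall x : K, x + x = 0) -> d (x ^+ 2) = 0.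
Proof. by move=> c2; rewrite expr2 derivM mulrC c2. Qed.

Lemma deriv_mx m p q (A : 'M[K]_(m, p)) (B : 'M[K]_(p, q)) :
  map_mx d (A *m B) = map_mx d A *m B + A *m map_mx d B.
Proof.
apply/matrixP => i j; rewrite !mxE deriv_sum -big_split /=.
by apply: eq_bigr => k _; rewrite !mxE derivM.
Qed.

End Derivation.

(** * Permanents in characteristic 2 and their iterated derivatives *)

Section Permanent.
Variables (K : comNzRingType) (X : finType) (z : X -> nat -> K).
Hypothesis c2 : forall x : K, x + x = 0.
Implicit Type T : {set X}.

(* The sum of [\prod_(s < k) z (phi s) s] over the injections [phi] of
   [{0, ..., k - 1}] into [T]. *)
Fixpoint Q (k : nat) T : K :=
  if k is k'.+1 then \sum_(i in T) z i k' * Q k' (T :\ i) else 1.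

Lemma Q_card k T : (#|T| < k)%N -> Q k T = 0.
Proof.
elim: k T => [|k IH] T //= Tk; apply: big1 => i iT; rewrite IH ?mulr0 //.
by move: Tk; rewrite (cardsD1 i) iT add1n.
Qed.

(** Expansion along the last row, where all signs are 1 in characteristic 2. *)
Lemma Q_det k (f : 'I_k -> X) : injective f ->
  Q k [set f i | i : 'I_k] = \det (\matrix_(s < k, i < k) z (f i) s).
Proof.
have sgn e : (-1) ^+ e = 1 :> K.
  have m1 : -1 = 1 :> K by apply/eqP; rewrite eq_sym -subr_eq0 opprK c2.
  by rewrite m1 expr1n.
elim: k f => [|k IH] f fI; first by rewrite det_mx00.
rewrite (expand_det_row _ ord_max) /= big_imset => [|i j _ _ /fI//] /=.
apply: eq_bigr => l _; rewrite !mxE /cofactor sgn mul1r; congr (_ * _).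
have gI : injective (fun i => f (lift l i)) by move=> i j /fI /lift_inj.
rewrite (_ : _ :\ _ = [set f (lift l i) | i : 'I_k]).
  rewrite (IH _ gI); congr (\det _); apply/matrixP => s i; rewrite !mxE.
  by rewrite lift_max.
apply/setP => x; rewrite !inE; apply/andP/imsetP => [[xl /imsetP[i _ e]]|[i _ ->]].
  case: (unliftP l i) => [i' ei|ei]; first by exists i'; rewrite // e ei.
  by rewrite e ei eqxx in xl.
split; last by apply/imsetP; exists (lift l i).
by rewrite (inj_eq fI) eq_sym neq_lift.
Qed.

Definition tgl T j := if j \in T then T :\ j else j |: T.

Lemma sum_tgl T j (g : X -> K) :
  \sum_(i in tgl T j) g i = g j + \sum_(i in T) g i.
Proof.
rewrite /tgl; case: ifPn => jT; last by rewrite big_setU1.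
by rewrite (big_setD1 _ jT) /= addrA c2 add0r.
Qed.

(** The derivation replaces one index [i] in use by [j], and also keeps it. Injections using both
    [i] and [j] cancel in pairs, by exchanging the two arguments; what is left has the same form
    whether or not [j] lies in [T], with [tgl T j] in both cases. *)
Lemma Q_deriv (d : K -> K) j (zeta : X -> K) k T : derivation d ->
  (forall i s, (s < k)%N -> d (z i s) = zeta i * (z j s + z i s)) ->
  d (Q k T) = \sum_(i in T :\ j) zeta i * (Q k (tgl T j :\ i) + Q k T).
Proof.
move=> hd; elim: k T => [|k IH] T hz.
  by rewrite /= (deriv1 hd) big1 // => i _; rewrite c2 mulr0.
rewrite [in LHS]/= (deriv_sum hd).
have -> : \sum_(l in T) d (z l k * Q k (T :\ l)) =
   \sum_(l in T) zeta l * (z j k + z l k) * Q k (T :\ l) +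
   \sum_(l in T) \sum_(i in T :\ l :\ j)
      zeta i * (z l k * (Q k (tgl (T :\ l) j :\ i) + Q k (T :\ l))).
  rewrite -big_split /=; apply: eq_bigr => l _; rewrite (derivM hd) hz //.
  rewrite IH => [|i s sk]; last by rewrite hz // ltnW.
  by congr (_ + _); rewrite mulr_sumr; apply: eq_bigr => i _; rewrite mulrCA.
have -> : \sum_(l in T) zeta l * (z j k + z l k) * Q k (T :\ l) =
   \sum_(l in T :\ j) zeta l * (z j k + z l k) * Q k (T :\ l).
  rewrite (big_setID [set j]) /= [X in X + _]big1 ?add0r // => l.
  by rewrite !inE => /andP[_ /eqP->]; rewrite c2 mulr0 mul0r.
rewrite (exchange_big_dep (fun i => i \in T :\ j)) /=; last first.
  by move=> l i _; rewrite !inE => /and3P[-> _ ->].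
rewrite -big_split /=; apply: eq_bigr => i iTj.
move: (iTj); rewrite !inE => /andP[ij iT].
rewrite -mulr_sumr -mulrA -mulrDr; congr (_ * _).
rewrite [X in _ + X = _](eq_bigl (fun l => l \in T :\ i)); last first.
  by move=> l; rewrite !inE ij iT /= andbT andbC [i == l]eq_sym.
rewrite [\sum_(i0 in T) _](big_setD1 i) //= mulrDl.
under [X in _ + X = _]eq_bigr do rewrite mulrDr.
rewrite big_split /= addrACA [in X in _ = X]addrA [in X in _ = X]addrC.
rewrite [in X in _ = X]addrCA.
set S2 := \sum_(l in T :\ i) z l k * Q k (T :\ l).
set S1 := \sum_(l in T :\ i) _ * _; set S3 := \sum_(l in tgl T j :\ i) _.
suff -> : S3 = z j k * Q k (T :\ i) + S1.
  by rewrite addrC [in RHS]addrC; congr (_ + _); rewrite addrC.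
rewrite /S3 /S1 /tgl; case: ifPn => jT; last first.
  rewrite (big_setD1 j) /=; last by rewrite !inE eq_sym ij eqxx.
  rewrite (_ : (j |: T) :\ i :\ j = T :\ i); last first.
    apply/setP => x; rewrite !inE; case: (eqVneq x j) => [->|] //=.
    by rewrite (negbTE jT) andbF.
  congr (_ + _); apply: eq_bigr => l; rewrite !inE => /andP[li lT].
  rewrite (negbTE jT) andbF; congr (_ * Q _ _); apply/setP => x; rewrite !inE.
  case: (eqVneq x j) => [->|] /=; last by rewrite andbCA.
  by rewrite (_ : j != l) //; apply: contraNneq jT => ->.
rewrite [in RHS](big_setD1 j) /=; last by rewrite !inE eq_sym ij.
rewrite !inE eqxx /= [in RHS]addrA.
rewrite (_ : j |: T :\ j = T); last by rewrite setD1K.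
rewrite c2 add0r; apply: eq_big => [x|l]; first by rewrite !inE andbCA.
rewrite !inE => /and3P[li lj lT]; rewrite [j == l]eq_sym lj jT /=.
congr (_ * Q _ _); apply/setP => x; rewrite !inE.
by case: (x == l); case: (x == i); case: (x == j).
Qed.

Section Iterate.
Variables (d : nat -> K -> K) (j : nat -> X) (y : X -> K) (N : nat).
Variables (Om : K) (T0 : {set X}).
Hypothesis hd : forall k, (k < N)%N -> derivation (d k).
Hypothesis dy : forall k i, (k < N)%N -> d k (y i) = y (j k) * y i * z i k.
Hypothesis dz : forall k i s, (k < N)%N -> (s < N)%N ->
  d k (z i s) = y (j k) * z i k * (z (j k) s + z i s).
Hypothesis dOm : forall k, (k < N)%N ->
  d k Om = Om * y (j k) * (z (j k) k + \sum_(i in T0) z i k).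

Fixpoint iterD k x := if k is k'.+1 then d k' (iterD k' x) else x.
Fixpoint iterT k := if k is k'.+1 then tgl (iterT k') (j k') else T0.

Lemma iterTE k i : (i \in iterT k) = (i \in T0) (+) odd (\sum_(s < k) (j s == i)).
Proof.
elim: k => [|k IH]; first by rewrite big_ord0 addbF.
rewrite big_ord_recr /= oddD addbA -IH /tgl.
case: ifPn => jT; rewrite !inE.
  by case: (eqVneq i (j k)) => [->|_] /=; rewrite ?jT ?addbF.
by case: (eqVneq i (j k)) => [->|_] /=; rewrite ?(negbTE jT) ?addbF.
Qed.

(** The product shape survives each step: the derivatives of [Om], of the factors [y] and of [Q]
    combine, by cancellation in pairs, into the expansion that defines [Q k.+1] on the toggled
    set. *)
Lemma iterDE k : (k <= N)%N ->
  iterD k Om = Om * \prod_(s < k) y (j s) * Q k (iterT k).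
Proof.
elim: k => [|k IH] kN; first by rewrite big_ord0 !mulr1.
rewrite [LHS]/= IH ?(ltnW kN) //; have hk := hd kN.
rewrite !(derivM hk) dOm // big_ord_recr /=.
have dY m : d k (\prod_(s < m) y (j s)) =
    \prod_(s < m) y (j s) * y (j k) * \sum_(s < m) z (j s) k.
  elim: m => [|m IHm]; first by rewrite !big_ord0 (deriv1 hk) mulr0.
  by rewrite !big_ord_recr /= (derivM hk) IHm dy //; ring.
have dzk i s : (s < k)%N -> d k (z i s) = (y (j k) * z i k) * (z (j k) s + z i s).
  by move=> sk; rewrite dz // (ltn_trans sk).
rewrite dY (Q_deriv _ hk dzk).
set T := iterT k; set Y := \prod_(s < k) _; set yj := y (j k).
have eT m : \sum_(i in iterT m) z i k =
    \sum_(i in T0) z i k + \sum_(s < m) z (j s) k.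
  elim: m => [|m IHm] /=; first by rewrite big_ord0 addr0.
  by rewrite sum_tgl IHm big_ord_recr /=; ring.
have eS : \sum_(i in T :\ j k) yj * z i k * (Q k (tgl T (j k) :\ i) + Q k T) =
   yj * (\sum_(i in T :\ j k) z i k * Q k (tgl T (j k) :\ i)
         + (\sum_(i in T :\ j k) z i k) * Q k T).
  rewrite mulr_suml -big_split mulr_sumr; apply: eq_bigr => i _ /=; ring.
rewrite eS.
transitivity (Om * Y * yj * ((\sum_(i in tgl T (j k)) z i k) * Q k T +
   (\sum_(i in T :\ j k) z i k * Q k (tgl T (j k) :\ i)
         + (\sum_(i in T :\ j k) z i k) * Q k T))).
  by rewrite sum_tgl /T eT; ring.
rewrite mulrA; congr (_ * _).
rewrite addrCA -mulrDl /tgl; case: ifPn => jT.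
  by rewrite c2 mul0r addr0.
have -> : T :\ j k = T.
  by apply/setP => x; rewrite !inE; case: eqP => // ->; rewrite (negbTE jT).
rewrite !big_setU1 //= -addrA c2 addr0 addrC setU1K //.
Qed.

End Iterate.
End Permanent.

(* The entries [a r v], [r < m], [v \in W], admit dual derivations; over a
   field of rational functions in these entries one takes the partial
   derivatives. *)
Definition generic (n : nat) (K : fieldType) (m : nat) (W : {set 'I_n})
    (a : nat -> 'I_n -> K) :=
  exists d : nat -> 'I_n -> K -> K,
    (forall r v, (r < m)%N -> v \in W -> derivation (d r v)) /\
    (forall r v r' v', (r < m)%N -> (r' < m)%N -> v \in W -> v' \in W ->
       d r v (a r' v') = ((r == r') && (v == v'))%:R).

(** * The contribution of one facet to the degree map *)

Section Facet.
Variables (n : nat) (K : fieldType) (v0 : 'I_n) (D : nat) (a : nat -> 'I_n -> K).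
Local Notation A F := (Amx v0 D a F).
Local Notation en := (en v0).
Implicit Types (F J M W : {set 'I_n}) (u v : 'I_n).

Definition Bm F := invmx (A F).
Definition yo F (i : 'I_D) := \sum_(r < D) Bm F i r.
(* The point supported on [F] where all the forms [lf (a r)], [r < D], take
   the value 1. *)
Definition yF F v := \sum_(i < D | en F i == v) yo F i.
(** For [u] in [F], [zF F u k] is the logarithmic derivative of [yF F u] with respect to [a k v],
    divided by [yF F v]; see [dyF]. *)
Definition zF F v (s : nat) :=
  \sum_(i < D | en F i == v) (\sum_(r < D | r == s :> nat) Bm F i r) / yo F i.
(** The weight of a facet in the degree map. By [wF_Q] it is the full permanent of the [zF], which
    brings it within reach of [iterDE]. *)
Definition wF F := \det (Bm F) / \prod_(i < D) yo F i.

Section Fixed.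
Variable F : {set 'I_n}.
Hypothesis FD : #|F| = D.

Lemma yF_en (i : 'I_D) : yF F (en F i) = yo F i.
Proof. by rewrite /yF (big_pred1 i) // => j; rewrite (inj_eq (en_inj (v0 := v0) FD)). Qed.

Lemma zF_en (i r : 'I_D) : zF F (en F i) r = Bm F i r / yo F i.
Proof.
rewrite /zF (big_pred1 i) => [|j]; last by rewrite (inj_eq (en_inj (v0 := v0) FD)).
by rewrite (big_pred1 r).
Qed.

Lemma en_outE v (i : 'I_D) : v \notin F -> (en F i == v) = false.
Proof. by move=> vF; apply/eqP => e; rewrite -e en_in in vF. Qed.

Lemma yF_out v : v \notin F -> yF F v = 0.
Proof. by move=> vF; rewrite /yF big_pred0 // => i; apply: en_outE. Qed.

Lemma zF_out v s : v \notin F -> zF F v s = 0.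
Proof. by move=> vF; rewrite /zF big_pred0 // => i; apply: en_outE. Qed.

End Fixed.

Section Generic.
Hypothesis c2 : forall x : K, x + x = 0.
Variables (W : {set 'I_n}) (d : nat -> 'I_n -> K -> K).
Hypothesis hd : forall r v, (r < D)%N -> v \in W -> derivation (d r v).
Hypothesis da : forall r v r' v', (r < D)%N -> (r' < D)%N -> v \in W -> v' \in W ->
  d r v (a r' v') = ((r == r') && (v == v'))%:R.

Lemma oppK (x : K) : - x = x.
Proof. by apply/eqP; rewrite eq_sym -subr_eq0 opprK c2. Qed.

Section OneFacet.
Variable F : {set 'I_n}.
Hypotheses (FD : #|F| = D) (FW : F \subset W).
Let B := Bm F.
Let enW (i : 'I_D) : en F i \in W.
Proof. by apply: (subsetP FW); apply: en_in. Qed.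

(* Differentiating a normalised linear relation [u *m A = 0] among the rows
   puts all the unit vectors in the row space of [A]. *)
Lemma A_unit : A F \in unitmx.
Proof.
apply/negPn/negP => nu.
have /rowV0Pn[x /sub_kermxP xA x0] : kermx (A F) != 0.
  by rewrite kermx_eq0 row_free_unit.
have /existsP[r xr] : [exists r, x 0 r != 0].
  apply: contraNT x0 => /existsPn h; apply/eqP/rowP => r.
  by rewrite mxE; apply/eqP/negPn/h.
have [u ur uA] : exists2 u : 'rV_D, u 0 r = 1 & u *m A F = 0.
  by exists ((x 0 r)^-1 *: x); rewrite ?mxE ?mulVf // -scalemxAl xA scaler0.
case/negP: nu; rewrite -row_full_unit -sub1mx; apply/row_subP => j; rewrite row1.
have hj := hd (ltn_ord r) (enW j).
have := congr1 (map_mx (d r (en F j))) uA.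
rewrite (deriv_mx hj) (_ : map_mx _ (0 : 'rV_D) = 0); last first.
  by apply/rowP => k; rewrite !mxE (deriv0 hj).
rewrite (_ : u *m _ = delta_mx 0 j).
  move/eqP; rewrite addr_eq0 => /eqP e.
  by rewrite -[delta_mx 0 j]opprK -e -mulNmx submxMl.
apply/rowP => i; rewrite !mxE (bigD1 r) //= !mxE da // eqxx ur mul1r.
rewrite (inj_eq (en_inj (v0 := v0) FD)) eq_sym big1 ?addr0 //= => k kr.
by rewrite !mxE da // val_eqE [r == k]eq_sym (negbTE kr) mulr0.
Qed.

Section OneDerivation.
Variables (k : 'I_D) (v : 'I_n).
Hypothesis vW : v \in W.
Let dd := d k v.
Let hdd : derivation dd := hd (ltn_ord k) vW.

Lemma dB i s : dd (B i s) = B i k * \sum_(l < D | en F l == v) B l s.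
Proof.
have uA := A_unit.
have : map_mx dd (B *m A F) = 0.
  rewrite mulVmx //; apply/matrixP => x y; rewrite !mxE.
  by case: (x == y); rewrite ?(deriv1 hdd) ?(deriv0 hdd).
rewrite (deriv_mx hdd) => /(congr1 (mulmxr B)) /=.
rewrite mulmxDl -mulmxA mulmxV // mulmx1 mul0mx => /eqP; rewrite addr_eq0 => /eqP e.
have := congr1 (fun M : 'M_D => M i s) e; rewrite !mxE => ->; rewrite oppK.
transitivity (\sum_(l < D) (if en F l == v then B i k * B l s else 0)).
  apply: eq_bigr => l _; rewrite !mxE (bigD1 k) //= !mxE /dd da // eqxx /=.
  rewrite big1 ?addr0 => [|r rk]; last first.
    by rewrite !mxE da // val_eqE [k == r]eq_sym (negbTE rk) mulr0.
  by rewrite eq_sym; case: eqP; rewrite ?mulr1 ?mulr0 ?mul0r.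
by rewrite -big_mkcond mulr_sumr.
Qed.

Lemma dyo i : dd (yo F i) = B i k * yF F v.
Proof.
rewrite /yo (deriv_sum hdd) /yF.
under eq_bigr do rewrite dB.
by rewrite -mulr_sumr exchange_big.
Qed.

End OneDerivation.

(** A zero coordinate has zero derivatives; differentiating by the entries of a column [j] with
    [yo F j != 0] would then annihilate a whole row of the inverse matrix. *)
Lemma yo_neq0 i : yo F i != 0.
Proof.
apply/eqP => y0; have uA := A_unit.
have [j yj] : exists j, yo F j != 0.
  apply/existsP; apply: contraT => /existsPn h.
  have B1 : B *m const_mx 1 = 0 :> 'cV_D.
    apply/colP => j; rewrite !mxE; under eq_bigr do rewrite mxE mulr1.
    by apply/eqP/negPn/h.
  have : A F *m (B *m const_mx 1) = const_mx 1 :> 'cV_D by rewrite mulmxA mulmxV // mul1mx.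
  rewrite B1 mulmx0 => /colP/(_ i)/esym/eqP; rewrite !mxE oner_eq0 //.
have Bi r : B i r = 0.
  have := dyo r (enW j) i; rewrite y0 (deriv0 (hd (ltn_ord r) (enW j))) yF_en //.
  by move/esym/eqP; rewrite mulf_eq0 (negbTE yj) orbF => /eqP.
have := congr1 (fun M : 'M_D => M i i) (mulVmx uA).
rewrite !mxE eqxx big1 => [/esym/eqP|r _]; first by rewrite oner_eq0.
by rewrite -/(Bm F) Bi mul0r.
Qed.

Lemma yF_neq0 v : v \in F -> yF F v != 0.
Proof. by move=> /(en_surj v0 FD)[i ->]; rewrite yF_en ?yo_neq0. Qed.

Lemma yzF v (s : 'I_D) : yF F v * zF F v s = \sum_(l < D | en F l == v) B l s.
Proof.
case: (boolP (v \in F)) => [/(en_surj v0 FD)[i ->]|vF]; last first.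
  by rewrite yF_out // mul0r big_pred0 // => i; apply: en_outE.
rewrite yF_en // zF_en // mulrC divfK ?yo_neq0 // (big_pred1 i) // => j.
by rewrite (inj_eq (en_inj (v0 := v0) FD)).
Qed.

Lemma wF_Q : wF F = Q (zF F) D F.
Proof.
have eF : F = [set en F i | i : 'I_D].
  apply/setP => v; apply/idP/imsetP => [/(en_surj v0 FD)[i ->]|[i _ ->]]; last exact: en_in.
  by exists i.
rewrite {3}eF (Q_det _ c2 (en_inj (v0 := v0) FD)).
transitivity (\det (diag_mx (\row_i (yo F i)^-1) *m B)).
  rewrite /wF det_mulmx det_diag mulrC -prodfV; congr (_ * _).
  by apply: eq_bigr => i _; rewrite mxE.
rewrite -det_tr; congr (\det _); apply/matrixP => s i.
by rewrite mxE mul_diag_mx !mxE zF_en // mulrC.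
Qed.

Lemma wF_neq0 : wF F != 0.
Proof.
rewrite mulf_neq0 //.
  by rewrite -unitfE -unitmxE unitmx_inv A_unit.
by rewrite invr_eq0 prodf_seq_neq0; apply/allP => i _ /=; apply: yo_neq0.
Qed.

Section Rules.
Variables (k : nat) (v : 'I_n).
Hypotheses (kD : (k < D)%N) (vW : v \in W).
Let dd := d k v.
Let hdd : derivation dd := hd kD vW.
Let ko := Ordinal kD.

Let dyo' i : dd (yo F i) = B i ko * yF F v.
Proof. exact: (dyo ko vW). Qed.
Let dB' i s : dd (B i s) = B i ko * \sum_(l < D | en F l == v) B l s.
Proof. exact: (dB ko vW). Qed.

Lemma dyF u : dd (yF F u) = yF F v * yF F u * zF F u k.
Proof.
case: (boolP (u \in F)) => [/(en_surj v0 FD)[i ->]|uF]; last first.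
  by rewrite yF_out // (deriv0 hdd) mulr0 mul0r.
rewrite yF_en // dyo' (zF_en FD i ko) mulrC -mulrA; congr (_ * _).
by rewrite mulrC divfK ?yo_neq0.
Qed.

Lemma dzF u s : (s < D)%N ->
  dd (zF F u s) = yF F v * zF F u k * (zF F v s + zF F u s).
Proof.
move=> sD; pose so := Ordinal sD.
case: (boolP (u \in F)) => [/(en_surj v0 FD)[i ->]|uF]; last first.
  by rewrite !(zF_out FD _ uF) // (deriv0 hdd) mulr0 mul0r.
have y0 := yo_neq0 i.
have dV : dd (yo F i)^-1 = B i ko * yF F v / yo F i ^+ 2.
  have e : dd (yo F i) * (yo F i)^-1 + yo F i * dd (yo F i)^-1 = 0.
    by rewrite -(derivM hdd) divff // (deriv1 hdd).
  move: e; rewrite dyo' => /eqP; rewrite addr_eq0 oppK => /eqP e.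
  by apply: (mulfI y0); rewrite -e; field.
rewrite (zF_en FD i so) (zF_en FD i ko) (derivM hdd) dB' dV.
rewrite -(yzF v so) /= -/B -/ko -/so.
set x := B i ko; set b := Bm F i so; set Z := zF F v s.
by field.
Qed.

(** An instance of [Q_deriv] on all of [F]. For [v] in [F] the smaller sets have too few elements
    for an injection of [D] indices; for [v] outside [F] every term contains [yF F v], which is
    0. *)
Lemma dwF : dd (wF F) = wF F * yF F v * (zF F v k + \sum_(i in F) zF F i k).
Proof.
have dz i s : (s < D)%N -> dd (zF F i s) =
    (yF F v * zF F i k) * (zF F v s + zF F i s) by move=> sD; rewrite dzF.
rewrite wF_Q (Q_deriv c2 F hdd dz) -(sum_tgl c2).
rewrite /tgl; case: ifPn => vF.
  rewrite mulr_sumr; apply: eq_bigr => i iF; rewrite [X in X + _]Q_card ?add0r.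
    by ring.
  have := cardsD1 v F; have := cardsD1 i (F :\ v); rewrite iF vF FD /=.
  by move=> e1 e2; rewrite e2 e1 !add1n ltnS leqnSn.
by rewrite yF_out // mulr0 mul0r big1 // => i _; rewrite mul0r mul0r.
Qed.

Lemma dOmF J : dd (wF F * \prod_(u in J) yF F u) =
  wF F * \prod_(u in J) yF F u * yF F v * (zF F v k + \sum_(i in F :\: J) zF F i k).
Proof.
have dP : dd (\prod_(u in J) yF F u) =
   \prod_(u in J) yF F u * yF F v * \sum_(u in J) zF F u k.
  elim/big_rec2: _ => [|u x y _]; first by rewrite (deriv1 hdd) mulr0.
  by move=> e; rewrite (derivM hdd) dyF e; ring.
have -> : \sum_(i in F :\: J) zF F i k = \sum_(i in F) zF F i k + \sum_(u in J) zF F u k.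
  rewrite [X in _ = X + _](big_setID J) [X in _ = _ + X](big_setID F) /= setIC.
  rewrite [\sum_(i in J :\: F) _]big1 ?addr0 => [|u].
    by rewrite addrAC c2 add0r.
  by rewrite inE => /andP[uF _]; rewrite zF_out.
by rewrite (derivM hdd) dwF dP; ring.
Qed.

End Rules.

(* The differential identity of Papadakis and Petrotou on one facet. *)
Lemma diff_facet (I : nat -> 'I_n) J M :
  (forall k, (k < D)%N -> I k \in W) ->
  (forall v, ((\sum_(s < D) (I s == v)) + (v \in J) = 2 * (v \in M))%N) ->
  iterD (fun k => d k (I k)) D (wF F * \prod_(u in J) yF F u) =
  (wF F * \prod_(u in M) yF F u) ^+ 2.
Proof.
move=> IW par.
rewrite (@iterDE _ _ (zF F) c2 _ I (yF F) D _ (F :\: J)) //; first last.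
- by move=> k kD; apply: dOmF; rewrite ?IW.
- by move=> k i s kD sD; apply: dzF; rewrite ?IW.
- by move=> k i kD; apply: dyF; rewrite ?IW.
- by move=> k kD; apply: hd; rewrite ?IW.
have JM v : v \in J -> v \in M.
  by move=> vJ; have := par v; rewrite vJ; case: (v \in M) => //; rewrite addn1.
have eP : \prod_(u in J) yF F u * \prod_(s < D) yF F (I s) =
    (\prod_(u in M) yF F u) ^+ 2.
  rewrite (eq_bigr (fun s : 'I_D => \prod_v yF F v ^+ (I s == v))); last first.
    move=> s _; rewrite (bigD1 (I s)) //= eqxx expr1 big1 ?mulr1 // => v.
    by rewrite eq_sym => /negbTE ->.
  rewrite exchange_big /= big_mkcond -big_split /= [in RHS]big_mkcond -prodrXl.
  apply: eq_bigr => v _; rewrite prodrXr.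
  have := par v; case: (v \in J); case: (v \in M) => e.
  - by rewrite -exprS -addn1 e.
  - by rewrite addn1 in e.
  - by rewrite mul1r -[in LHS](addn0 (\sum_(_ < _) _)%N) e.
  - by rewrite mul1r expr1n -[in LHS](addn0 (\sum_(_ < _) _)%N) e.
rewrite -[X in X * Q _ _ _]mulrA eP.
(* If [M] leaves [F], a coordinate outside [F] makes both sides vanish. *)
case: (boolP (M \subset F)) => [MF|/subsetPn[v vM vF]]; last first.
  have -> : \prod_(u in M) yF F u = 0 by rewrite (bigD1 v) //= yF_out ?mul0r.
  by rewrite expr0n /= !mulr0 mul0r expr0n.
(* Starting from [F :\: J], the toggles restore exactly the members of [J], the vertices listed an
   odd number of times by [I]. So [Q] is the weight once more, and it completes the square. *)
rewrite (_ : iterT _ _ _ = F) -?wF_Q; first by ring.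
apply/setP => v; rewrite iterTE !inE.
have -> : odd (\sum_(s < D) (I s == v)) = (v \in J).
  have := congr1 odd (par v); rewrite oddM oddD /=.
  by case: (odd _) => /=; case: (v \in J).
case: (boolP (v \in J)) => [/JM/(subsetP MF) ->|_] //=; by rewrite addbF.
Qed.

End OneFacet.
End Generic.
End Facet.

(** * Spheres *)

Section IterSquares.
Variables (K : comNzRingType) (d : nat -> K -> K) (N : nat).
Hypothesis c2 : forall x : K, x + x = 0.
Hypothesis hd : forall k, (k < N)%N -> derivation (d k).

Lemma iterD0 k : (k <= N)%N -> iterD d k 0 = 0.
Proof. by elim: k => // k IH kN; rewrite /= IH ?(ltnW kN) // (deriv0 (hd kN)). Qed.

Lemma iterD_sum (I : Type) (r : seq I) (F : I -> K) k : (k <= N)%N ->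
  iterD d k (\sum_(i <- r) F i) = \sum_(i <- r) iterD d k (F i).
Proof.
by elim: k => // k IH kN; rewrite /= IH ?(ltnW kN) // (deriv_sum (hd kN)).
Qed.

Lemma iterD_sqr x y k : (k <= N)%N -> iterD d k (x ^+ 2 * y) = x ^+ 2 * iterD d k y.
Proof.
elim: k => // k IH kN; rewrite /= IH ?(ltnW kN) // (derivM (hd kN)).
by rewrite (deriv_sqr (hd kN)) // mul0r add0r.
Qed.

End IterSquares.

Lemma shell_nth (n : nat) (c0 : {set 'I_n} * {set 'I_n}) s j : shell s -> (j < size s)%N ->
  (nth c0 s j).2 \subset (nth c0 s j).1 /\
  forall T : {set 'I_n}, T \subset (nth c0 s j).1 -> inS (take j s) T = ~~ ((nth c0 s j).2 \subset T).
Proof.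
move=> sh js; apply: (sh _ _ (drop j.+1 s)).
by rewrite -drop_nth // cat_take_drop.
Qed.

Lemma sum_old_facets (T : Type) (P : pred T) (x0 : T) (s : seq T) :
  (\sum_(j < size s) (P (nth x0 s j) && has P (take j s)) = (count P s).-1)%N.
Proof.
elim/last_ind: s => [|s c IH]; first by rewrite big_ord0.
rewrite size_rcons big_ord_recr /= nth_rcons ltnn eqxx -cats1 take_size_cat //.
rewrite count_cat /= addn0 has_count.
rewrite (eq_bigr (fun j : 'I_(size s) => (P (nth x0 s j) && has P (take j s) : nat))).
  by rewrite IH; case: (count P s) (P c) => [|k] [].
by move=> j _; rewrite nth_cat ltn_ord take_cat ltn_ord.
Qed.

Section Sphere.
Variables (n : nat) (K : fieldType) (v0 : 'I_n) (D : nat) (a : nat -> 'I_n -> K).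
Local Notation cell := ({set 'I_n} * {set 'I_n})%type.
Local Notation A F := (Amx v0 D a F).
Local Notation en := (en v0).
Local Notation yF := (yF v0 D a).
Local Notation zF := (zF v0 D a).
Local Notation wF := (wF v0 D a).
Local Notation yo := (yo v0 a).
Local Notation Bm := (Bm v0 D a).
Local Notation c00 := (c00 n).
Implicit Types (F J M W T : {set 'I_n}) (u v : 'I_n) (p q g : {mpoly K[n]}).

Lemma meval_vanish (c : cell) p : #|c.1| = D -> vanish [:: c] p -> p.@[yF c.1] = 0.
Proof.
move=> cD hp; rewrite mevalE big1_seq // => m /= mp.
case: (boolP (msup m \subset c.1)) => [mc|/subsetPn[v vm vc]].
  by rewrite hp ?mul0r // /inS /= mc.
rewrite (bigD1 v) //= yF_out // expr0n; move: vm; rewrite inE => /negbTE ->.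
by rewrite mul0r mulr0.
Qed.

Lemma meval_lf F b : (lf b).@[yF F] = \sum_v b v * yF F v.
Proof.
rewrite /lf /meval raddf_sum /=; apply: eq_bigr => v _.
by rewrite -/(meval _ _) mevalZ mevalXU.
Qed.

Lemma meval_xs F M : (xs K M).@[yF F] = \prod_(v in M) yF F v.
Proof.
rewrite mevalX [RHS]big_mkcond /=; apply: eq_bigr => v _.
by rewrite mnm_set; case: (v \in M); rewrite ?expr1 ?expr0.
Qed.

Lemma sum_facet F (f : 'I_n -> K) : #|F| = D ->
  \sum_v f v * yF F v = \sum_(i < D) f (en F i) * yo F i.
Proof.
move=> FD; transitivity (\sum_(v in F) f v * yF F v).
  rewrite [RHS]big_mkcond; apply: eq_bigr => v _; case: ifPn => // vF.
  by rewrite yF_out ?mulr0.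
by rewrite (big_facet v0 _ _ FD); apply: eq_bigr => i _; rewrite yF_en.
Qed.

Hypothesis c2 : forall x : K, x + x = 0.
Variables (W : {set 'I_n}) (d : nat -> 'I_n -> K -> K).
Hypothesis hd : forall r v, (r < D.+1)%N -> v \in W -> derivation (d r v).
Hypothesis da : forall r v r' v', (r < D.+1)%N -> (r' < D.+1)%N ->
  v \in W -> v' \in W -> d r v (a r' v') = ((r == r') && (v == v'))%:R.

Let hd' r v : (r < D)%N -> v \in W -> derivation (d r v).
Proof. by move=> rD; apply: hd; rewrite ltnW. Qed.
Let da' r v r' v' : (r < D)%N -> (r' < D)%N -> v \in W -> v' \in W ->
  d r v (a r' v') = ((r == r') && (v == v'))%:R.
Proof. by move=> rD rD'; apply: da; rewrite ltnW. Qed.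

Let unitA F (FD : #|F| = D) (FW : F \subset W) : A F \in unitmx.
Proof. exact: (A_unit v0 hd' da' FD FW). Qed.

Lemma lf_yF F r : #|F| = D -> F \subset W -> (r < D)%N -> (lf (a r)).@[yF F] = 1.
Proof.
move=> FD FW rD; pose ro := Ordinal rD; rewrite meval_lf sum_facet //.
have := mulmxV (unitA FD FW) => e.
transitivity (\sum_(s < D) (A F *m Bm F) ro s).
  rewrite /yo; under eq_bigr do rewrite mulr_sumr.
  rewrite exchange_big /=; apply: eq_bigr => s _; rewrite mxE.
  by apply: eq_bigr => i _; rewrite mxE.
rewrite e (bigD1 ro) //= mxE eqxx big1 ?addr0 // => s sr.
by rewrite mxE eq_sym (negbTE sr).
Qed.

(* Cramer's rule, with the minor written independently of any enumeration of
   the vertices: the index [None] stands for the column of ones. *)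
Definition zz (o : option 'I_n) (s : nat) : K := if o is Some v then a s v else 1.

(** The point is that the factor [Q] depends on the ridge [T] alone: the two facets through [T]
    contribute equally to [Deg (xs K T)], and the contributions cancel. *)
Lemma cramer F T : #|F| = D -> F \subset W -> T \subset F -> (#|T|.+1 = D)%N ->
  wF F * \prod_(v in T) yF F v * Q zz D (None |: [set Some v | v in T]) = 1.
Proof.
move=> FD FW TF TD.
have /set0Pn[u] : F :\: T != set0.
  by rewrite -card_gt0 cardsD (setIidPr TF) FD -TD subSnn.
rewrite inE => /andP[uT uF].
have eT : T = F :\ u.
  apply/eqP; rewrite eqEcard subsetD1 TF uT /=.
  by have := cardsD1 u F; rewrite uF FD -TD add1n => -[<-].
have [i ei] := en_surj v0 FD uF.
pose f (l : 'I_D) := if l == i then None else Some (en F l).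
have fI : injective f.
  move=> l l'; rewrite /f; case: eqP => [->|_]; case: eqP => [->|_] // [].
  exact: (en_inj (v0 := v0) FD).
have -> : None |: [set Some v | v in T] = [set f l | l : 'I_D].
  apply/setP => o; rewrite !inE; apply/orP/imsetP => [[/eqP->|/imsetP[v vT ->]]|[l _ ->]].
  - by exists i; rewrite // /f eqxx.
  - move: vT; rewrite eT !inE => /andP[vu /(en_surj v0 FD)[l el]].
    exists l; rewrite // /f; case: eqP => [e|_]; last by rewrite el.
    by rewrite el e -ei eqxx in vu.
  rewrite /f; case: (eqVneq l i) => [_|li]; [by left | right].
  apply/imsetP; exists (en F l); last by [].
  rewrite eT !inE en_in // andbT ei.
  by rewrite (inj_eq (en_inj (v0 := v0) FD)).
rewrite (Q_det _ c2 fI) (expand_det_col _ i).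
have -> : \sum_(s < D) (\matrix_(s0, i0) zz (f i0) s0) s i *
    cofactor (\matrix_(s0 < D, i0 < D) zz (f i0) s0) s i = \det (A F) * yo F i.
  rewrite /yo mulr_sumr; apply: eq_bigr => s _.
  rewrite mxE /f eqxx mul1r /Bm /invmx unitA // mxE mulrA divff ?mul1r; last first.
    by rewrite -unitfE -unitmxE unitA.
  rewrite mxE /cofactor; congr (_ * \det _); apply/matrixP => x y; rewrite !mxE.
  by rewrite eq_sym (negbTE (neq_lift _ _)).
have yi0 := yo_neq0 v0 c2 hd' da' FD FW i.
have -> : wF F * \prod_(v in T) yF F v = \det (Bm F) / yo F i.
  have -> : wF F = \det (Bm F) / \prod_(v in F) yF F v.
    rewrite (big_facet v0 _ (yF F) FD) /=; congr (_ / _).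
    by apply: eq_bigr => k _; rewrite yF_en.
  rewrite (big_setD1 u) //= -eT {1}ei yF_en // invfM mulrA mulfVK //.
  rewrite prodf_seq_neq0; apply/allP => v _ /=; apply/implyP => vT.
  by apply: (yF_neq0 v0 c2 hd' da' FD FW); apply: (subsetP TF).
rewrite [\det (A F) * _]mulrC mulrA divfK // -det_mulmx mulVmx ?det1 //.
exact: unitA.
Qed.

Variable s : seq cell.
Hypotheses (sh : shell s) (sD : forall c, c \in s -> #|c.1| = D).
Hypothesis sW : forall c, c \in s -> c.1 \subset W.
Hypothesis PM : forall T, (#|T|.+1 = D)%N ->
  count (fun c : cell => T \subset c.1) s \in [:: 0%N; 2].

(** At the evaluation points every [lf (a r)] with [r < D] equals 1, so multiplication by these
    forms does not change [Deg]. It is a degree map on the quotient because it also vanishes below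
    degree [D]. *)
Definition Deg p := \sum_(c <- s) wF c.1 * p.@[yF c.1].

Lemma DegD p q : Deg (p + q) = Deg p + Deg q.
Proof.
by rewrite /Deg -big_split; apply: eq_bigr => c _; rewrite mevalD mulrDr.
Qed.

Lemma DegZ x p : Deg (x *: p) = x * Deg p.
Proof.
by rewrite /Deg mulr_sumr; apply: eq_bigr => c _; rewrite mevalZ mulrCA.
Qed.

Lemma Deg0 : Deg 0 = 0.
Proof. by rewrite -(scale0r 0) DegZ mul0r. Qed.

Lemma DegB p q : Deg (p - q) = Deg p - Deg q.
Proof. by rewrite DegD -scaleN1r DegZ mulN1r. Qed.

Lemma Deg_sum (I : Type) (r : seq I) (P : pred I) (F : I -> {mpoly K[n]}) :
  Deg (\sum_(i <- r | P i) F i) = \sum_(i <- r | P i) Deg (F i).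
Proof. by elim/big_rec2: _ => [|i x y _ <-]; rewrite ?Deg0 ?DegD. Qed.

Lemma Deg_vanish p : vanish s p -> Deg p = 0.
Proof.
move=> hp; rewrite /Deg big1_seq // => c /= cs; rewrite meval_vanish ?mulr0 ?sD //.
apply: vanish_sub hp => T; rewrite /inS /= orbF => h.
by apply/hasP; exists c.
Qed.

Lemma Deg_lfM r p : (r < D)%N -> Deg (lf (a r) * p) = Deg p.
Proof.
move=> rD; rewrite /Deg big_seq [RHS]big_seq; apply: eq_bigr => c cs.
by rewrite mevalM lf_yF ?sD ?sW // mul1r.
Qed.

Lemma Deg_ridge T : (#|T|.+1 = D)%N -> Deg (xs K T) = 0.
Proof.
move=> TD; pose x := (Q zz D (None |: [set Some v | v in T]))^-1.
have e : Deg (xs K T) = \sum_(c <- s | T \subset c.1) x.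
  rewrite /Deg [RHS]big_mkcond big_seq [RHS]big_seq; apply: eq_bigr => c cs.
  rewrite meval_xs; case: ifPn => [Tc|/subsetPn[v vT vc]].
    have h := cramer (sD cs) (sW cs) Tc TD.
    have q0 : Q zz D (None |: [set Some v | v in T]) != 0.
      by apply/eqP => q0; move/eqP: h; rewrite q0 mulr0 eq_sym oner_eq0.
    by apply: (mulIf q0); rewrite h mulVf.
  by rewrite (bigD1 v) //= yF_out ?sD // mul0r mulr0.
rewrite e big_const_seq; have := PM TD; rewrite !inE => /orP[]/eqP-> //=.
by rewrite addr0 c2.
Qed.

(** Induction on the number of vertices missing from the support. A squarefree monomial is a ridge;
    otherwise a repeated vertex [v] is traded for vertices outside the support by a combination of
    the forms. *)
Lemma Deg_mon (m : 'X_{1..n}) : (mdeg m).+1 = D -> Deg 'X_[m] = 0.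
Proof.
have [k] := ubnP (D - #|msup m|)%N; elim: k m => // k IH m hk mD.
case: (boolP [exists v, 1 < m v]%N) => [/existsP[v mv]|/existsPn m1]; last first.
  have -> : m = mset (msup m).
    by apply/mnmP => i; rewrite mnm_set inE; have := m1 i; case: (m i) => [|[]].
  apply: Deg_ridge; rewrite -mdeg_set -mD; congr (mdeg _).+1.
  by apply/mnmP => i; rewrite mnm_set inE; have := m1 i; case: (m i) => [|[]].
pose m' := (m - U_(v))%MM.
have em : m = (U_(v) + m')%MM.
  by rewrite addmC submK // lep1mP; apply: contraTneq mv => ->.
have sm : msup m' = msup m.
  apply/setP => i; rewrite !inE mnmBE mnm1E; case: (eqVneq v i) => [<-|_] /=.
    by rewrite subn1; case: (m v) mv => [|[]].
  by rewrite subn0.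
have m'D : (#|msup m| < D.-1)%N.
  rewrite -sm; apply: (@leq_ltn_trans (mdeg m')).
    rewrite mdegE -sum1_card big_mkcond; apply: leq_sum => i _.
    by rewrite inE; case: (m' i).
  by rewrite -mD /= em mdegD mdeg1.
case: (boolP (inS s (msup m))) => [/hasP[c cs mc]|h]; last first.
  exact/Deg_vanish/vanishX.
have FD := sD cs; have FW := sW cs; set F := c.1 in mc FD FW.
have vF : v \in F by apply: (subsetP mc); rewrite inE; apply: contraTneq mv => ->.
have /set0Pn[u] : F :\: msup m != set0.
  rewrite -card_gt0 cardsD (setIidPr mc) FD; lia.
rewrite inE => /andP[um uF].
have [j ej] := en_surj v0 FD vF; have [i ei] := en_surj v0 FD uF.
have yi0 := yo_neq0 v0 c2 hd' da' FD FW i.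
(* On [F] the form [lf b] is the variable of [v] minus [t] times that of [u]. It is a combination of
   the [lf (a r)] with coefficient sum [yo F j - t * yo F i], which this choice makes 0, so
   multiplication by [lf b] kills [Deg]. *)
pose t := yo F j / yo F i.
pose b w := \sum_(r < D) (Bm F j r - t * Bm F i r) * a r w.
have BA (l l' : 'I_D) : \sum_(r < D) Bm F l r * a r (en F l') = (l == l')%:R.
  have := congr1 (fun M : 'M_D => M l l') (mulVmx (unitA FD FW)).
  by rewrite !mxE => <-; apply: eq_bigr => r _; rewrite !mxE.
have bE (l : 'I_D) : b (en F l) = (j == l)%:R - t * (i == l)%:R.
  rewrite /b; under eq_bigr do rewrite mulrBl -mulrA.
  by rewrite sumrB BA -mulr_sumr BA.
have lfb : lf b = \sum_(r < D) (Bm F j r - t * Bm F i r) *: lf (a r).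
  rewrite /lf /b; under eq_bigr do rewrite scaler_suml.
  rewrite exchange_big /=; apply: eq_bigr => r _; rewrite scaler_sumr.
  by apply: eq_bigr => w _; rewrite scalerA.
have : Deg (lf b * 'X_[m']) = 0.
  rewrite lfb mulr_suml Deg_sum.
  under eq_bigr do rewrite -scalerAl DegZ Deg_lfM //.
  rewrite -mulr_suml sumrB -mulr_sumr -/(yo F i) -/(yo F j) /t divfK //.
  by rewrite subrr mul0r.
rewrite {1}/lf mulr_suml (bigD1 v) //= DegD Deg_sum [X in _ + X]big1 => [|w wv].
  rewrite addr0 -scalerAl DegZ -mpolyXD -em {1}ej bE eqxx.
  rewrite (_ : i == j = false) ?mulr0 ?subr0 ?mul1r //.
  apply/eqP => ij; rewrite ei ij -ej in um; case/negP: um.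
  by rewrite inE; apply: contraTneq mv => ->.
rewrite -scalerAl DegZ -mpolyXD.
case: (boolP (w \in msup m)) => [wm|wm].
  have [l el] := en_surj v0 FD (subsetP mc _ wm).
  have jl : (j == l) = false by apply/eqP => e; rewrite el -e -ej eqxx in wv.
  have il : (i == l) = false by apply/eqP => e; rewrite ei e -el wm in um.
  by rewrite {1}el bE jl il mulr0 subr0 mul0r.
rewrite IH ?mulr0 //; last by rewrite -mD em !mdegD !mdeg1.
rewrite msupD msupU sm cardsU1 wm; lia.
Qed.

Lemma Deg_small p i : (i < D)%N -> p \is i.-homog -> Deg p = 0.
Proof.
have base q : q \is D.-1.-homog -> (0 < D)%N -> Deg q = 0.
  move=> hq D0; rewrite [q]mpolyE Deg_sum big1_seq // => m /= mq.
  by rewrite DegZ Deg_mon ?mulr0 // (dhomog_mf hq mq) prednK.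
have [k] := ubnP (D - i)%N; elim: k i p => // k IH i p hk iD hp.
have D0 : (0 < D)%N by apply: leq_trans iD.
have [e|ne] := eqVneq i.+1 D; first by apply: base => //; rewrite -e.
rewrite -(Deg_lfM p D0); apply: (IH i.+1); first by lia.
  by rewrite ltn_neqAle ne.
by rewrite -add1n; apply: dhomogM => //; apply: lf_homog.
Qed.

(** In degree [D] the multipliers of the forms have degree [D.-1], where [Deg] vanishes. *)
Lemma Deg_inJ p : p \is D.-homog -> inJ s D a p -> Deg p = 0.
Proof.
move=> hp [q hq]; have := Deg_vanish (vanish_pihomog D hq).
rewrite pihomogB pihomog_dE // (_ : pihomog mdeg D (\sum_(r < D) _) =
    \sum_(r < D) pihomog mdeg D (lf (a r) * q r)); last exact: raddf_sum.
rewrite DegB Deg_sum [X in _ - X]big1 ?subr0 // => r _.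
case: D r (@Deg_lfM r) (@Deg_small) => [[]//|D'] r h1 h2.
rewrite pihomog_lfM h1 //; apply: (h2 _ D') => //; exact: pihomogP.
Qed.

(** Double counting of ridges: the restriction of a facet has one vertex for each of its ridges that
    is already present, and every ridge is new once and old once. *)
Lemma sum_restrictions : (2 * \sum_(j < size s) #|(nth c00 s j).2| = D * size s)%N.
Proof.
pose old j T := inS (take j s) T.
have cell_in (j : 'I_(size s)) : nth c00 s j \in s by apply: mem_nth.
have ridges (j : 'I_(size s)) (f : {set 'I_n} -> nat) :
    (\sum_(v in (nth c00 s j).1) f ((nth c00 s j).1 :\ v) =
     \sum_(T : {set 'I_n} | #|T|.+1 == D) (if T \subset (nth c00 s j).1 then f T else 0))%N.
  set F := (nth c00 s j).1; have FD : #|F| = D by apply: sD (cell_in j).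
  have iF : {in F &, injective (fun v => F :\ v)}.
    move=> u v uF vF /setP/(_ u); rewrite !inE eqxx uF /= andbT.
    by case: eqP.
  rewrite -big_mkcondr /= -(big_imset f iF) /=; apply: eq_bigl => T.
  apply/imsetP/andP => [[v vF ->]|[/eqP TD TF]].
    by rewrite subD1set; have := cardsD1 v F; rewrite vF FD add1n => ->.
  have /set0Pn[u] : F :\: T != set0.
    by rewrite -card_gt0 cardsD (setIidPr TF) FD -TD subSnn.
  rewrite inE => /andP[uT uF]; exists u => //.
  apply/eqP; rewrite eqEcard subsetD1 TF uT /=.
  by have := cardsD1 u F; rewrite uF FD -TD add1n => -[<-].
have cR (j : 'I_(size s)) : #|(nth c00 s j).2| =
    (\sum_(T : {set 'I_n} | #|T|.+1 == D) ((T \subset (nth c00 s j).1) && old j T))%N.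
  have [cc hT] := shell_nth c00 sh (ltn_ord j).
  rewrite (eq_bigr (fun T => if T \subset (nth c00 s j).1 then (old j T : nat) else 0%N)).
    rewrite -(ridges j (fun T => old j T : nat)) -sum1_card big_mkcond [RHS]big_mkcond /=.
    apply: eq_bigr => v _; case: (boolP (v \in (nth c00 s j).1)) => vF; last first.
      by rewrite (contraNF (subsetP cc v) vF).
    by rewrite /old hT ?subD1set // subsetD1 cc negbK; case: (v \in _).
  by move=> T _; case: ifP.
rewrite (eq_bigr _ (fun j _ => cR j)) exchange_big /=.
have -> : (D * size s = \sum_(T : {set 'I_n} | #|T|.+1 == D) count (fun c : cell => T \subset c.1) s)%N.
  transitivity (\sum_(j < size s) \sum_(v in (nth c00 s j).1) 1)%N.
    rewrite (eq_bigr (fun=> D)) => [|j _]; last by rewrite sum1_card (sD (cell_in j)).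
    by rewrite sum_nat_const card_ord mulnC.
  rewrite (eq_bigr _ (fun j _ => ridges j (fun=> 1%N))) exchange_big /=.
  apply: eq_bigr => T _; rewrite -sum1_count (big_nth c00) big_mkord.
  by rewrite [RHS]big_mkcond.
rewrite big_distrr /=; apply: eq_bigr => T /eqP TD.
rewrite (sum_old_facets (fun c : cell => T \subset c.1)).
by have := PM TD; rewrite !inE => /orP[]/eqP->.
Qed.

Let m := size s.
Let R (j : 'I_m) := (nth c00 s j).2.
Let cj (j : 'I_m) := nth c00 s j.
Let cjs j : cj j \in s. Proof. exact: mem_nth. Qed.

Lemma R_sub j : R j \subset (cj j).1.
Proof. by have [] := shell_nth c00 sh (ltn_ord j). Qed.

Lemma R_new (i j : 'I_m) : (i < j)%N -> ~~ (R j \subset (cj i).1).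
Proof.
move=> ij; have [cc hT] := shell_nth c00 sh (ltn_ord j).
apply: contraT => /negPn h; have := hT _ cc; rewrite subxx => /negbT/negP[].
apply/hasP; exists (cj i) => //; rewrite /cj -(nth_take _ ij) mem_nth //.
by rewrite size_take ltn_ord.
Qed.

Definition Gram : 'M[K]_m := \matrix_(i, j) Deg (xs K (R i) * xs K (R j)).

(** [Gram] factors through the evaluations at the facet points, and the shelling makes the
    evaluation matrix triangular: no restriction is contained in an earlier facet. *)
Lemma Gram_unit : \det Gram != 0.
Proof.
pose E : 'M[K]_m := \matrix_(j, i) (xs K (R j)).@[yF (cj i).1].
pose w : 'rV[K]_m := \row_i wF (cj i).1.
have -> : Gram = E *m diag_mx w *m E^T.
  apply/matrixP => i j; rewrite !mxE /Deg (big_nth c00) big_mkord.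
  apply: eq_bigr => k _; rewrite mul_mx_diag !mxE mevalM; ring.
rewrite !det_mulmx det_tr det_diag.
have dE : \det E != 0.
  rewrite -det_tr det_trig.
    rewrite prodf_seq_neq0; apply/allP => j _ /=; rewrite !mxE meval_xs.
    rewrite prodf_seq_neq0; apply/allP => v _ /=; apply/implyP => vR.
    apply: (yF_neq0 v0 c2 hd' da' (sD (cjs j)) (sW (cjs j))).
    exact: (subsetP (R_sub j)).
  apply/is_trig_mxP => i j ij; rewrite !mxE meval_xs.
  have /subsetPn[v vR vc] := R_new ij.
  by rewrite (bigD1 v) //= (yF_out v0 a (sD (cjs i)) vc) mul0r.
rewrite !mulf_neq0 // prodf_seq_neq0; apply/allP => j _ /=; rewrite mxE.
exact: (wF_neq0 v0 c2 hd' da' (sD (cjs j)) (sW (cjs j))).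
Qed.

(* In the Leibniz expansion of the Gram determinant only the permutations
   pairing complementary degrees survive, because the degrees of all the
   restrictions add up to [D * m / 2]. *)
Lemma Gram_mask_unit :
  \det (\matrix_(i, j) (if (#|R i| + #|R j| == D)%N then Gram i j else 0)) != 0.
Proof.
suff -> : \det (\matrix_(i, j) (if (#|R i| + #|R j| == D)%N then Gram i j else 0)) =
   \det Gram by apply: Gram_unit.
rewrite /determinant; apply: eq_bigr => t _; congr (_ * _).
case: (boolP [forall i, #|R i| + #|R (t i)| == D]%N) => [/forallP h|/forallPn[i ni]].
  by apply: eq_bigr => i _; rewrite mxE h.
rewrite (bigD1 i) //= mxE (negbTE ni) mul0r; apply/esym.
have /existsP[k hk] : [exists k, #|R k| + #|R (t k)| < D]%N.
  apply: contraNT ni => /existsPn h.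
  have le k : (D <= #|R k| + #|R (t k)|)%N by rewrite leqNgt h.
  have : (\sum_k (#|R k| + #|R (t k)| - D) == 0)%N.
    have e : (\sum_k (#|R k| + #|R (t k)| - D) + \sum_(k < m) D = \sum_k (#|R k| + #|R (t k)|))%N.
      by rewrite -big_split; apply: eq_bigr => k _; rewrite /= subnK.
    move: e; rewrite [in X in _ = X -> _]big_split /= sum_nat_const card_ord.
    rewrite -(reindex_inj (h := t) (F := fun k => #|R k|) (P := predT) (perm_inj)) /=.
    have e1 : (2 * \sum_(k < m) #|R k| = D * m)%N := sum_restrictions.
    rewrite mulnC; move: e1; set X := (\sum_(k < m) #|R k|)%N; lia.
  rewrite sum_nat_eq0 => /forallP/(_ i) /=.
  by rewrite subn_eq0 => h2; rewrite eqn_leq h2 le.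
rewrite (bigD1 k) //= mxE (Deg_small hk) ?mul0r //.
by apply: dhomogM; apply: xs_homog.
Qed.

Lemma det_facet c : c \in s -> \det (A c.1) != 0.
Proof. by move=> cs; rewrite -unitfE -unitmxE unitA ?sD ?sW. Qed.

Lemma span_homog p i : p \is i.-homog ->
  exists e : 'I_m -> K, inJ s D a (p - \sum_(j < m | #|R j| == i) e j *: xs K (R j)).
Proof.
move=> hp; have [e he] := spanning_homog v0 a sh sD hp.
exists (fun j => (detprod v0 D a s)^-1 * e j).
have := inJZ (detprod v0 D a s)^-1 he; rewrite scalerBr scalerA mulVf ?(detprod_neq0 det_facet) //.
rewrite scale1r scaler_sumr.
by under eq_bigr do rewrite scalerA.
Qed.

(** Poincare duality: the masked Gram matrix is the pairing between complementary degrees in the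
    restriction basis, and its invertibility makes the pairing perfect. *)
Lemma duality p i : (i <= D)%N -> p \is i.-homog ->
  (forall j : 'I_m, (i + #|R j| = D)%N -> Deg (p * xs K (R j)) = 0) -> inJ s D a p.
Proof.
move=> iD hp hj; have [e he] := span_homog hp.
pose x : 'rV[K]_m := \row_j (if #|R j| == i then e j else 0).
set G' := \matrix_(i, j) (if (#|R i| + #|R j| == D)%N then Gram i j else 0).
have xG : x *m G' = 0.
  apply/rowP => k; rewrite !mxE.
  case: (eqVneq (i + #|R k|)%N D) => [ik|ik]; last first.
    rewrite big1 // => j _; rewrite !mxE; case: eqP => [->|]; last by rewrite mul0r.
    by rewrite (negbTE ik) mulr0.
  have hq : p - \sum_(j < m | #|R j| == i) e j *: xs K (R j) \is i.-homog.
    apply: rpredB => //; apply: rpred_sum => j /eqP <-; apply: rpredZ; exact: xs_homog.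
  have := Deg_inJ _ (inJMr (xs K (R k)) he); rewrite -{1}ik.
  move/(_ (dhomogM hq (xs_homog _ _))); rewrite mulrBl DegB hj // sub0r => /eqP.
  rewrite oppr_eq0 => /eqP e1; rewrite -[RHS]e1 mulr_suml Deg_sum [RHS]big_mkcond /=.
  apply: eq_bigr => j _; rewrite !mxE; case: eqP => [ji|_]; last by rewrite mul0r.
  by rewrite ji ik eqxx -scalerAl DegZ.
have x0 : x = 0.
  have uG : G' \in unitmx by rewrite unitmxE unitfE Gram_mask_unit.
  by rewrite -[x]mulmx1 -(mulmxV uG) mulmxA xG mul0mx.
rewrite -[p](subrK (\sum_(j < m | #|R j| == i) e j *: xs K (R j))).
rewrite [X in _ + X]big1 ?addr0 // => j ji.
by have := congr1 (fun M : 'rV_m => M 0 j) x0; rewrite !mxE ji => ->; rewrite scale0r.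
Qed.

Lemma Deg_xsM p M : Deg (p * xs K M) = \sum_(c <- s) p.@[yF c.1] * (wF c.1 * \prod_(v in M) yF c.1 v).
Proof. by apply: eq_bigr => c _; rewrite mevalM meval_xs mulrCA. Qed.

Lemma sqr_sum (I : Type) (r : seq I) (F : I -> K) :
  (\sum_(i <- r) F i) ^+ 2 = \sum_(i <- r) F i ^+ 2.
Proof.
elim: r => [|i r IH]; first by rewrite !big_nil expr0n.
by rewrite !big_cons sqrrD IH mulr2n c2 addr0.
Qed.

(** If [Deg (g ^+ 2 * xs K J)] were 0, so would be its iterated derivative. The values of [g ^+ 2]
    are constants, and by [diff_facet] and the additivity of squaring the derivative is the square
    of [Deg (g * xs K M)]. *)
Lemma Deg_sqr g J M i : M \subset W -> J \subset M -> (#|M| + i = D)%N ->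
  (#|J| + 2 * i = D)%N -> Deg (g * xs K M) != 0 -> Deg (g ^+ 2 * xs K J) != 0.
Proof.
move=> MW JM Mi Ji; apply: contraNneq => g0.
(* Each vertex of [J] once and each of [M :\: J] twice: with one more copy of [J], every vertex of
   [M] is counted twice. The length is [D], one derivative for each row. *)
pose l := enum J ++ enum (M :\: J) ++ enum (M :\: J).
have cMJ : #|M :\: J| = i by rewrite cardsD (setIidPr JM); lia.
have sl : size l = D by rewrite !size_cat -!cardE cMJ; lia.
pose I k := nth v0 l k.
have lM u : u \in l -> u \in M.
  rewrite !mem_cat !mem_enum !inE => /orP[/(subsetP JM)|/orP[]/andP[]] //.
have IW k : (k < D)%N -> I k \in W.
  by move=> kD; apply/(subsetP MW)/lM/mem_nth; rewrite sl.
have par v : ((\sum_(k < D) (I k == v)) + (v \in J) = 2 * (v \in M))%N.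
  have -> : (\sum_(k < D) (I k == v) = count_mem v l)%N.
    rewrite -sum1_count (big_nth v0) sl big_mkord [RHS]big_mkcond; apply: eq_bigr => k _.
    by rewrite /= /I; case: (_ == _).
  rewrite !count_cat !count_uniq_mem ?enum_uniq // !mem_enum !inE.
  by case: (boolP (v \in J)) => [/(subsetP JM) ->|] //; case: (v \in M).
have hk k : (k < D)%N -> derivation (d k (I k)).
  by move=> kD; apply: hd'; rewrite ?IW.
have := congr1 (iterD (fun k => d k (I k)) D) g0.
rewrite Deg_xsM (iterD_sum hk) // (iterD0 hk) //.
rewrite big_seq (eq_bigr (fun c : cell =>
   (g.@[yF c.1] * (wF c.1 * \prod_(v in M) yF c.1 v)) ^+ 2)).
  by rewrite -big_seq -sqr_sum -Deg_xsM => /eqP; rewrite sqrf_eq0.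
move=> c cs; rewrite expr2 mevalM -expr2 (iterD_sqr c2 hk) // exprMn; congr (_ * _).
exact: (diff_facet v0 c2 hd' da' (sD cs) (sW cs) IW par).
Qed.

(** Among the data only the last form involves [a D v]: the points and weights are built from the
    rows below [D], and squares are constants. Differentiation by [a D v] therefore replaces
    [lf (a D)] by the variable of [v]. *)
Lemma Deg_om g J v : v \in W -> v \notin J ->
  Deg (lf (a D) * g ^+ 2 * xs K J) = 0 -> Deg (g ^+ 2 * xs K (v |: J)) = 0.
Proof.
move=> vW vJ h0; have hv := hd (ltnSn D) vW.
have killB c : c \in s -> forall i r, d D v (Bm c.1 i r) = 0.
  move=> cs i r; have uA := unitA (sD cs) (sW cs).
  have : map_mx (d D v) (Bm c.1 *m A c.1) = 0.
    rewrite mulVmx //; apply/matrixP => x y; rewrite !mxE.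
    by case: (x == y); rewrite ?(deriv1 hv) ?(deriv0 hv).
  rewrite (deriv_mx hv) (_ : map_mx _ (A c.1) = 0) ?mulmx0 ?addr0; last first.
    apply/matrixP => x y; rewrite !mxE da //.
    - by rewrite eq_sym ltn_eqF.
    - exact: (ltnW (ltn_ord _)).
    - by apply: (subsetP (sW cs)); apply: en_in; apply: sD.
  move/(congr1 (mulmxr (Bm c.1))); rewrite /= mul0mx -mulmxA mulmxV // mulmx1.
  by move/matrixP/(_ i r); rewrite !mxE.
have killy c u : c \in s -> d D v (yF c.1 u) = 0.
  move=> cs; rewrite /yF (deriv_sum hv) big1 // => i _.
  by rewrite /yo (deriv_sum hv) big1 // => r _; apply: killB.
have killV x : d D v x = 0 -> d D v x^-1 = 0.
  have [->|x0] := eqVneq x 0; first by rewrite invr0.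
  move=> dx; have := derivM hv x x^-1; rewrite divff // (deriv1 hv) dx mul0r add0r.
  by move/esym/eqP; rewrite mulf_eq0 (negbTE x0) => /eqP.
have killw c : c \in s -> d D v (wF c.1) = 0.
  move=> cs; rewrite (wF_Q v0 a c2 (sD cs)).
  rewrite (Q_deriv (zeta := fun=> 0) (j := v0) c2 _ hv).
    by rewrite big1 // => i _; rewrite mul0r.
  move=> u k _; rewrite mul0r /zF (deriv_sum hv) big1 // => i _.
  rewrite (derivM hv) killV ?mulr0 ?addr0; last first.
    by rewrite /yo (deriv_sum hv) big1 // => r _; apply: killB.
  by rewrite (deriv_sum hv) big1 ?mul0r // => r _; apply: killB.
have := congr1 (d D v) h0; rewrite (deriv0 hv) /Deg (deriv_sum hv) => e1; rewrite -[RHS]e1.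
rewrite big_seq [RHS]big_seq; apply: eq_bigr => c cs.
rewrite !mevalM -!expr2 !meval_xs meval_lf big_setU1 //=.
have killJ : d D v (\prod_(u in J) yF c.1 u) = 0.
  elim/big_rec: _ => [|u x _ IH]; first exact: (deriv1 hv).
  by rewrite (derivM hv) IH killy // mul0r mulr0 addr0.
have gen (w l x P yv : K) : d D v w = 0 -> d D v P = 0 -> d D v l = yv ->
    d D v (w * (l * x ^+ 2 * P)) = w * (x ^+ 2 * (yv * P)).
  move=> hw hP hl; rewrite (derivM hv w) hw mul0r add0r (derivM hv (l * x ^+ 2)).
  rewrite hP mulr0 addr0 (derivM hv l) hl (deriv_sqr hv) // mulr0 addr0.
  by ring.
have dl : d D v (\sum_u a D u * yF c.1 u) = yF c.1 v.
  rewrite (deriv_sum hv) (bigD1 v) //= (derivM hv) killy // da // !eqxx mul1r mulr0 addr0.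
  rewrite big1 ?addr0 // => u uv; rewrite (derivM hv) killy // mulr0 addr0.
  case: (boolP (u \in W)) => uW; last by rewrite yF_out ?mulr0 ?sD //; apply: contra uW; apply/subsetP/sW.
  by rewrite da // [v == u]eq_sym (negbTE uv) andbF mul0r.
by rewrite (gen _ _ _ _ _ (killw _ cs) killJ dl).
Qed.

Definition nonnull p i := exists2 j : 'I_m, (i + #|R j| = D)%N & Deg (p * xs K (R j)) != 0.

Lemma not_inJ_nonnull p i : (i <= D)%N -> p \is i.-homog -> ~ inJ s D a p -> nonnull p i.
Proof.
move=> iD hp nJ.
case: (boolP [exists j : 'I_m, (i + #|R j| == D)%N && (Deg (p * xs K (R j)) != 0)]).
  by move=> /existsP[j /andP[/eqP ij h]]; exists j.
move/existsPn => h; case: nJ; apply: (duality iD hp) => j ij.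
by have := h j; rewrite ij eqxx /= negbK => /eqP.
Qed.

(** Below the middle degree, a restriction [R j] pairing with [g] has room for a vertex [v] besides
    a set [J] of the required size. [Deg_om], then [Deg_sqr] with [M = R j], would carry a vanishing
    for [J] over to [R j]. *)
Lemma Deg_omega g i : (2 * i < D)%N -> nonnull g i ->
  exists J, (#|J| + 2 * i).+1 = D /\ Deg (lf (a D) * g ^+ 2 * xs K J) != 0.
Proof.
move=> iD [j ij gj].
have RW : R j \subset W by apply: subset_trans (R_sub j) (sW (cjs j)).
have /card_gt0P[v vR] : (0 < #|R j|)%N by lia.
have [J JR cJ] : exists2 J : {set 'I_n}, J \subset R j :\ v & #|J| = (D - 2 * i).-1.
  have h : ((D - 2 * i).-1 <= #|R j :\ v|)%N.
    have := cardsD1 v (R j); rewrite vR add1n => e; lia.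
  pose l := take (D - 2 * i).-1 (enum (R j :\ v)).
  exists [set x in l].
    by apply/subsetP => x; rewrite inE => /mem_take; rewrite mem_enum.
  by rewrite cardsE (card_uniqP _) ?take_uniq ?enum_uniq // size_takel // -cardE.
exists J; split; first lia.
move: JR; rewrite subsetD1 => /andP[JR vJ].
apply: contraNneq gj => h0.
have := Deg_om (subsetP RW _ vR) vJ h0.
apply: contra_eq => h; apply: (@Deg_sqr _ _ (R j) i) => //.
- by rewrite subUset sub1set vR.
- by rewrite addnC.
- by rewrite cardsU1 vJ; lia.
- by move: h; rewrite eqb_id.
Qed.

(** [Deg_omega] pairs [lf (a D) * g] nontrivially with [g * xs K J]; the latter expands in
    restriction monomials, so one of these pairs nontrivially too. *)
Lemma omega_nonnull g i : (2 * i < D)%N -> g \is i.-homog -> nonnull g i ->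
  nonnull (lf (a D) * g) i.+1.
Proof.
move=> iD hg gn; have [J [cJ hJ]] := Deg_omega iD gn.
have hq : g * xs K J \is (i + #|J|).-homog by apply: dhomogM => //; apply: xs_homog.
have [e he] := span_homog hq.
have hlg : lf (a D) * g \is (1 + i).-homog by apply: dhomogM => //; apply: lf_homog.
have dd : (1 + i + (i + #|J|) = D)%N by lia.
have hq' : g * xs K J - \sum_(j < m | #|R j| == (i + #|J|)%N) e j *: xs K (R j)
    \is (i + #|J|).-homog.
  by apply: rpredB => //; apply: rpred_sum => j /eqP <-; apply: rpredZ; apply: xs_homog.
have hh := dhomogM hlg hq'; rewrite dd in hh.
have := Deg_inJ hh (inJMl (lf (a D) * g) he); rewrite mulrBr DegB => /eqP; rewrite subr_eq0.
rewrite mulrA -[X in Deg (X * _)]mulrA -expr2 => /eqP e1.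
rewrite e1 mulr_sumr Deg_sum in hJ.
case: (boolP [exists j : 'I_m, (i.+1 + #|R j| == D)%N && (Deg (lf (a D) * g * xs K (R j)) != 0)]).
  by move=> /existsP[j /andP[/eqP ij h]]; exists j.
move/existsPn => h; rewrite big1 ?eqxx // in hJ => j /eqP ji.
rewrite -scalerAr DegZ; have := h j; rewrite ji -[i.+1]add1n dd eqxx /=.
by rewrite negbK => /eqP ->; rewrite mulr0.
Qed.

Lemma omegaX_nonnull g i (q : nat) : (2 * (i + q) <= D)%N -> g \is i.-homog -> nonnull g i ->
  lf (a D) ^+ q * g \is (i + q).-homog /\ nonnull (lf (a D) ^+ q * g) (i + q).
Proof.
move=> iq hg gn; elim: q iq => [|q IH] iq; first by rewrite expr0 mul1r addn0.
have [|h1 h2] := IH; first by lia.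
rewrite exprS -mulrA addnS; split; last by apply: omega_nonnull => //; lia.
by rewrite -add1n; apply: dhomogM => //; apply: lf_homog.
Qed.

(** A [p] outside the ideal is moved to a nonnull [h] in the middle degree. There [Deg (h ^+ 2)] or
    [Deg (lf (a D) * h ^+ 2)], according to parity, is nonzero; but it is the pairing of [p] with
    its Lefschetz image. *)
Theorem sphere_lefschetz p i : (2 * i <= D)%N -> p \is i.-homog ->
  inJ s D a (lf (a D) ^+ (D - 2 * i) * p) -> inJ s D a p.
Proof.
move=> iD hp hJ; apply: contrapT => nJ.
have iD' : (i <= D)%N by lia.
have hn := not_inJ_nonnull iD' hp nJ.
pose q := (D - 2 * i)./2; have eq2 := odd_double_half (D - 2 * i); rewrite -/q in eq2.
have iq : (2 * (i + q) <= D)%N by lia.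
have [hh hhn] := omegaX_nonnull iq hp hn; set h := _ * p in hh hhn.
have hom x : lf (a D) ^+ x \is x.-homog.
  by rewrite -[X in X.-homog]mul1n; apply/dhomogMn/lf_homog.
have h0 : Deg (lf (a D) ^+ (D - 2 * i) * p * p) = 0.
  have e : (D - 2 * i + i + i = D)%N by lia.
  have hh2 := dhomogM (dhomogM (hom (D - 2 * i)%N) hp) hp; rewrite e in hh2.
  exact: Deg_inJ hh2 (inJMr _ hJ).
have [od|ev] := boolP (odd (D - 2 * i)).
  rewrite od in eq2.
  have [|J [cJ]] := @Deg_omega h (i + q) _ hhn; first by lia.
  have /cards0_eq -> : #|J| = 0%N by lia.
  rewrite xs0 mulr1 (_ : _ * h ^+ 2 = lf (a D) ^+ (D - 2 * i) * p * p) ?h0 ?eqxx //.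
  by rewrite -eq2 exprD expr1 -muln2 exprM /h; ring.
rewrite (negbTE ev) add0n in eq2; case: hhn => j ij hj.
have RW : R j \subset W by apply: subset_trans (R_sub j) (sW (cjs j)).
have := @Deg_sqr h set0 (R j) (i + q) RW (sub0set _) _ _ hj.
rewrite cards0 xs0 mulr1 (_ : h ^+ 2 = lf (a D) ^+ (D - 2 * i) * p * p).
  by rewrite h0 eqxx => H; have := H (ltac:(lia)) (ltac:(lia)).
by rewrite -eq2 -muln2 exprM /h; ring.
Qed.

End Sphere.

(** * Cones and Mayer-Vietoris *)

Lemma mpoly_gen_ind (n : nat) (K : comNzRingType) (P : {mpoly K[n]} -> Prop) :
  (forall c, P c%:MP) -> (forall v, P 'X_v) ->
  (forall p q, P p -> P q -> P (p + q)) -> (forall p q, P p -> P q -> P (p * q)) ->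
  forall p, P p.
Proof.
move=> PC PX PD PM p; rewrite [p]mpolyE.
apply: (big_ind P) => [||m _]; [by rewrite -(mpolyC0 n); apply: PC | exact: PD |].
rewrite -mul_mpolyC; apply: (PM _ _) => //; rewrite mpolyXE_id.
apply: (big_ind P) => [||v _]; [by rewrite -(mpolyC1 n); apply: PC | exact: PM |].
elim: (m v) => [|k IH]; first by rewrite expr0 -(mpolyC1 n); apply: PC.
by rewrite exprS; apply: PM.
Qed.

Lemma deriv_inv0 (K : fieldType) (d : K -> K) x : derivation d -> d x = 0 -> d x^-1 = 0.
Proof.
move=> hd; have [->|x0] := eqVneq x 0; first by rewrite invr0.
move=> dx; have := derivM hd x x^-1; rewrite divff // (deriv1 hd) dx mul0r add0r.
by move/esym/eqP; rewrite mulf_eq0 (negbTE x0) => /eqP.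
Qed.

Section ConeLists.
Variables (n : nat) (f : 'I_n).
Local Notation cell := ({set 'I_n} * {set 'I_n})%type.
Implicit Types (s : seq cell) (T : {set 'I_n}).

Definition cone s := [seq (f |: c.1, c.2) | c : cell <- s].
(** For base facets already present in the earlier complex: faces without the apex are old there, so
    the apex belongs to the restriction. *)
Definition coneR s := [seq (f |: c.1, f |: c.2) | c : cell <- s].
Definition avoids s := forall c : cell, c \in s -> f \notin c.1.

Lemma avoids_cat s1 s2 : avoids (s1 ++ s2) <-> avoids s1 /\ avoids s2.
Proof.
split=> [h|[h1 h2] c]; first by split=> c cs; apply: h; rewrite mem_cat cs ?orbT.
by rewrite mem_cat => /orP[/h1|/h2].
Qed.

Lemma sub_cone (T F : {set 'I_n}) : f \notin T -> (T \subset f |: F) = (T \subset F).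
Proof.
move=> fT; apply/subsetP/subsetP => h v vT; have := h v vT; rewrite !inE.
  by case: eqP => // e; rewrite -e vT in fT.
by move=> ->; rewrite orbT.
Qed.

Lemma sub_coneD T (F : {set 'I_n}) : (T \subset f |: F) = (T :\ f \subset F).
Proof. by rewrite subDset. Qed.

Lemma inS_cone s T : inS (cone s) T = inS s (T :\ f).
Proof. by rewrite /inS has_map; apply: eq_has => c /=; rewrite sub_coneD. Qed.

Lemma inS_coneR s T : inS (coneR s) T = inS s (T :\ f).
Proof. by rewrite /inS has_map; apply: eq_has => c /=; rewrite sub_coneD. Qed.

Lemma setD1_id T : f \notin T -> T :\ f = T.
Proof. by move=> fT; apply/setDidPl; rewrite disjoint_sym disjoints1. Qed.

Lemma inS_avoids s T : avoids s -> f \in T -> inS s T = false.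
Proof.
move=> sa fT; apply/hasP => -[c cs /subsetP/(_ _ fT)].
by rewrite (negbTE (sa _ cs)).
Qed.

Lemma shell_restr s c : shell s -> c \in s -> c.2 \subset c.1.
Proof.
move=> sh cs; have := nth_index c cs; rewrite -index_mem in cs.
by move=> <-; have [] := shell_nth c sh cs.
Qed.

Lemma shell_cone s : shell s -> avoids s -> shell (cone s).
Proof.
elim/last_ind: s => [|s c IH] sh av; first by move=> [|? ?] ? ?.
have [sh' cc hT] := (shell_rcons s c).1 sh.
have /avoids_cat[av1 av2] : avoids (s ++ [:: c]) by rewrite cats1.
have fc : f \notin c.1 by apply: av2; rewrite inE.
rewrite /cone map_rcons; apply/shell_rcons; split; first exact: IH.
  by apply: subset_trans cc _; apply: subsetUr.
move=> T /=; rewrite sub_coneD => h; rewrite -/(cone s) inS_cone hT //.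
by rewrite subsetD1 (contraNN (subsetP cc f) fc) andbT.
Qed.

(** The new cone meets the old complex in the base part [sG]. Over [sG] the new faces must contain
    the apex, whence [coneR]; over [sN] the shelling of the base decides, with or without the
    apex. *)
Lemma shell_join s1 sG sN : shell s1 -> shell (sG ++ sN) ->
  avoids s1 -> avoids (sG ++ sN) ->
  (forall T, f \notin T -> inS (sG ++ sN) T -> inS s1 T = inS sG T) ->
  shell (s1 ++ coneR sG ++ cone sN).
Proof.
move=> sh1 shc av1 /avoids_cat[avG avN] h; rewrite catA.
have shG : forall u, (exists w, sG = u ++ w) -> shell (s1 ++ coneR u).
  elim/last_ind => [|u c IH] [w ew]; first by rewrite cats0.
  rewrite /coneR map_rcons -rcons_cat; apply/shell_rcons.
  have [cc hT] : c.2 \subset c.1 /\ forall T, T \subset c.1 -> inS u T = ~~ (c.2 \subset T).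
    by apply: (shc u c (w ++ sN)); rewrite ew cat_rcons -catA.
  have fc : f \notin c.1 by apply: avG; rewrite ew mem_cat mem_rcons mem_head.
  split; first by apply: IH; exists (c :: w); rewrite ew cat_rcons.
    exact: setUS.
  move=> T /= hTc; rewrite -/(coneR u) inS_cat inS_coneR subUset sub1set.
  case: (boolP (f \in T)) => fT /=.
    rewrite (inS_avoids av1 fT) /= hT -?sub_coneD //.
    by rewrite subsetD1 (contraNN (subsetP cc f) fc) andbT.
  have cT : inS sG T.
    apply/hasP; exists c; first by rewrite ew mem_cat mem_rcons mem_head.
    by rewrite -(sub_cone _ fT).
  by rewrite h // ?cT // inS_cat cT.
have shN : forall u, (exists w, sN = u ++ w) -> shell ((s1 ++ coneR sG) ++ cone u).
  elim/last_ind => [|u c IH] [w ew].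
    by rewrite cats0; apply: shG; exists [::]; rewrite cats0.
  rewrite /cone map_rcons -rcons_cat; apply/shell_rcons.
  have [cc hT] : c.2 \subset c.1 /\
      forall T, T \subset c.1 -> inS (sG ++ u) T = ~~ (c.2 \subset T).
    by apply: (shc (sG ++ u) c w); rewrite ew cat_rcons -catA.
  have fc : f \notin c.1 by apply: avN; rewrite ew mem_cat mem_rcons mem_head.
  split; first by apply: IH; exists (c :: w); rewrite ew cat_rcons.
    by apply: subset_trans cc _; apply: subsetUr.
  move=> T /= hTc; rewrite -/(cone u) !inS_cat inS_coneR inS_cone.
  case: (boolP (f \in T)) => fT /=.
    rewrite (inS_avoids av1 fT) /= -inS_cat hT -?sub_coneD //.
    by rewrite subsetD1 (contraNN (subsetP cc f) fc) andbT.
  have cT : T \subset c.1 by rewrite -(sub_cone _ fT).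
  rewrite setD1_id // h // ?orbb -?inS_cat ?hT //.
  rewrite inS_cat; apply/orP; right; apply/hasP; exists c => //.
  by rewrite ew mem_cat mem_rcons mem_head.
by apply: shN; exists [::]; rewrite cats0.
Qed.

End ConeLists.

(** * Elimination of the apex of a cone *)

Section Elimination.
Variables (n : nat) (K : fieldType) (f : 'I_n) (a : nat -> 'I_n -> K).
Local Notation cell := ({set 'I_n} * {set 'I_n})%type.
Implicit Types (p q : {mpoly K[n]}) (m : 'X_{1..n}) (s : seq cell).
Hypothesis af : a 0 f != 0.

Definition elim_row (b : 'I_n -> K) v := b v - b f / a 0 f * a 0 v.
Definition elim_rows r := elim_row (a r.+1).
(** The apex variable as solved from [lf (a 0) = 0]. The substitution [phi] inserts it, while [psi]
    sets the apex variable to 0. *)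
Definition elimf : {mpoly K[n]} := lf (fun v => - (if v == f then 0 else a 0 v) / a 0 f).
Definition phi p : {mpoly K[n]} := p \mPo [tuple (if v == f then elimf else 'X_v) | v < n].
Definition psi p : {mpoly K[n]} := p \mPo [tuple (if v == f then 0 else 'X_v) | v < n].

Lemma phiM p q : phi (p * q) = phi p * phi q. Proof. exact: rmorphM. Qed.
Lemma phiD p q : phi (p + q) = phi p + phi q. Proof. exact: rmorphD. Qed.
Lemma psiM p q : psi (p * q) = psi p * psi q. Proof. exact: rmorphM. Qed.
Lemma psiD p q : psi (p + q) = psi p + psi q. Proof. exact: rmorphD. Qed.
Lemma phiB p q : phi (p - q) = phi p - phi q. Proof. exact: rmorphB. Qed.
Lemma psiB p q : psi (p - q) = psi p - psi q. Proof. exact: rmorphB. Qed.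
Lemma phi_sum (I : Type) (r : seq I) (P : pred I) (F : I -> {mpoly K[n]}) :
  phi (\sum_(i <- r | P i) F i) = \sum_(i <- r | P i) phi (F i).
Proof. exact: rmorph_sum. Qed.
Lemma psi_sum (I : Type) (r : seq I) (P : pred I) (F : I -> {mpoly K[n]}) :
  psi (\sum_(i <- r | P i) F i) = \sum_(i <- r | P i) psi (F i).
Proof. exact: rmorph_sum. Qed.
Lemma phiX v : phi 'X_v = if v == f then elimf else 'X_v.
Proof. by rewrite /phi comp_mpolyXU -tnth_nth tnth_mktuple. Qed.
Lemma psiX v : psi 'X_v = if v == f then 0 else 'X_v.
Proof. by rewrite /psi comp_mpolyXU -tnth_nth tnth_mktuple. Qed.

Lemma phi_lf b : phi (lf b) = lf (elim_row b).
Proof.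
rewrite {1}/lf /phi raddf_sum /=.
under eq_bigr => v _ do rewrite comp_mpolyZ -/(phi _) phiX.
rewrite (bigD1 f) //= eqxx /elimf /lf scaler_sumr [in RHS](bigD1 f) //=.
rewrite [X in X + _](bigD1 f) //= eqxx oppr0 mul0r scale0r scaler0 add0r.
rewrite {1}/elim_row divfK // subrr scale0r add0r -big_split /=.
apply: eq_bigr => v vf; rewrite (negbTE vf) scalerA -scalerDl; congr (_ *: _).
by rewrite /elim_row addrC; field.
Qed.

Lemma phi_sub p : exists q, p - phi p = lf (a 0) * q.
Proof.
elim/mpoly_gen_ind: p => [c|v|p q [x hx] [y hy]|p q [x hx] [y hy]].
- by exists 0; rewrite /phi comp_mpolyC subrr mulr0.
- rewrite phiX; case: eqP => [->|_]; last by exists 0; rewrite subrr mulr0.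
  exists ((a 0 f)^-1)%:MP; rewrite [RHS]mulrC mul_mpolyC /elimf /lf.
  rewrite scaler_sumr (bigD1 f) //= [in RHS](bigD1 f) //= eqxx oppr0 mul0r scale0r add0r.
  rewrite scalerA mulVf // scale1r -sumrN; congr (_ + _).
  apply: eq_bigr => w wf; rewrite (negbTE wf) scalerA -scaleNr; congr (_ *: _).
  by field.
- by exists (x + y); rewrite phiD mulrDr -hx -hy; ring.
- exists (x * q + phi p * y).
  rewrite phiM mulrDr mulrA -hx mulrCA -hy; ring.
Qed.

Lemma phi_xs (T : {set 'I_n}) : f \notin T -> phi (xs K T) = xs K T.
Proof.
move=> fT; rewrite /phi comp_mpolyX [RHS]mpolyXE_id; apply: eq_bigr => v _.
rewrite tnth_mktuple; case: eqP => // ->.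
by rewrite mnm_set (negbTE fT) !expr0.
Qed.

Lemma psi_phi p : psi (phi p) = phi p.
Proof.
elim/mpoly_gen_ind: p => [c|v|p q hp hq|p q hp hq].
- by rewrite /phi comp_mpolyC /psi comp_mpolyC.
- rewrite phiX; case: eqP => [_|/eqP/negbTE ne]; last by rewrite psiX ne.
  rewrite /elimf {1}/lf /psi raddf_sum /=; apply: eq_bigr => w _.
  rewrite comp_mpolyZ -/(psi _) psiX; case: eqP => // _.
  by rewrite oppr0 mul0r !scale0r.
- by rewrite phiD psiD hp hq.
- by rewrite phiM psiM hp hq.
Qed.

Lemma psi_lf b : b f = 0 -> psi (lf b) = lf b.
Proof.
move=> bf; rewrite {1}/lf /psi raddf_sum /=; apply: eq_bigr => w _.
rewrite comp_mpolyZ -/(psi _) psiX; case: eqP => // ->.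
by rewrite bf !scale0r.
Qed.

Lemma elim_row_f b : elim_row b f = 0.
Proof. by rewrite /elim_row divfK // subrr. Qed.

Lemma vanish_phi s p : vanish (cone f s) p -> vanish s (phi p).
Proof.
move=> hp; rewrite [p]mpolyE /phi raddf_sum /= big_seq; apply: vanish_sum => m mp.
rewrite comp_mpolyZ; apply: vanishZ; rewrite -/(phi _).
set T := msup m :\ f.
have fT : f \notin T by rewrite !inE eqxx.
have -> : m = (mset T + (m - mset T))%MM.
  rewrite addmC submK //; apply/mnm_lepP => i; rewrite mnm_set /T !inE.
  by case: (m i) => [|k]; rewrite ?andbF //; case: (_ && _).
rewrite mpolyXD phiM -/(xs K T) phi_xs //; apply/vanishMr/vanish_xs.
by apply: contraTN mp => h; rewrite mcoeff_msupp hp ?eqxx // inS_cone.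
Qed.

Lemma vanish_psi s p : avoids f s -> vanish s p -> vanish (cone f s) (psi p).
Proof.
move=> sa hp; rewrite [p]mpolyE /psi raddf_sum /= big_seq; apply: vanish_sum => m mp.
rewrite comp_mpolyZ; apply: vanishZ; rewrite comp_mpolyX.
have [fm|fm] := eqVneq (m f) 0%N; last first.
  rewrite (bigD1 f) //= tnth_mktuple eqxx expr0n (negbTE fm) mul0r.
  exact: vanish0.
rewrite (_ : \prod_(i < n) _ = 'X_[m]).
  apply: vanishX; rewrite inS_cone setD1_id ?inE ?fm //.
  by apply: contraTN mp => h; rewrite mcoeff_msupp hp ?eqxx.
rewrite [RHS]mpolyXE_id; apply: eq_bigr => v _; rewrite tnth_mktuple.
by case: eqP => // ->; rewrite fm !expr0.
Qed.

(** With [elim_cone], this identifies the quotient of the cone by [D.+1] forms with the quotient of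
    its base by the [D] eliminated forms. *)
Lemma cone_elim s D p : inJ (cone f s) D.+1 a p -> inJ s D elim_rows (phi p).
Proof.
move=> [q hq]; exists (fun r => phi (q r.+1)); have := vanish_phi hq.
rewrite phiB phi_sum big_ord_recl phiM phi_lf.
rewrite (_ : lf (elim_row (a 0)) = 0) ?mul0r ?add0r; last first.
  by rewrite /lf big1 // => v _; rewrite /elim_row divff // mul1r subrr scale0r.
by under eq_bigr do rewrite phiM phi_lf.
Qed.

Lemma elim_cone s D p : avoids f s -> inJ s D elim_rows (phi p) -> inJ (cone f s) D.+1 a p.
Proof.
move=> sa [q hq]; have [x hx] := phi_sub p.
have -> : p = phi p + lf (a 0) * x by rewrite -hx addrC subrK.
apply: inJD; last exact/inJMr/inJ_lf.
have := vanish_psi sa hq; rewrite psiB psi_phi psi_sum.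
have hz r : elim_rows r f = 0 by apply: elim_row_f.
under eq_bigr => r _ do rewrite psiM (psi_lf (hz _)).
move=> hv; rewrite -[phi p](subrK (\sum_(r < D) lf (elim_rows r) * psi (q r))).
apply: inJD; first exact: vanish_inJ.
apply: inJ_sum => r _; apply: inJMr.
have -> : lf (elim_rows r) = lf (a r.+1) + (- (a r.+1 f / a 0 f)) *: lf (a 0).
  rewrite -lf_comb /lf; apply: eq_bigr => v _; congr (_ *: _).
  by rewrite /elim_rows /elim_row mulNr.
apply: inJD; first by apply: inJ_lf; rewrite ltnS.
exact/inJZ/inJ_lf.
Qed.

Lemma phi_homog p i : p \is i.-homog -> phi p \is i.-homog.
Proof.
move=> hp; rewrite [p]mpolyE /phi raddf_sum /= big_seq; apply: rpred_sum => m mp.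
rewrite comp_mpolyZ; apply: rpredZ; rewrite comp_mpolyX -(dhomog_mf hp mp) /= mdegE.
elim/big_rec2: _ => [|v d q _ hq]; first exact: dhomog1.
rewrite tnth_mktuple; apply: dhomogM => //; rewrite -[X in X.-homog]mul1n.
apply: dhomogMn; case: ifP => _; first exact: lf_homog.
by rewrite dhomogX; apply/eqP/mdeg1.
Qed.

Lemma phiXn p k : phi (p ^+ k) = phi p ^+ k.
Proof. exact: rmorphXn. Qed.

End Elimination.

Lemma inJ_ext (n : nat) (K : comNzRingType) s D (a b : nat -> 'I_n -> K) p :
  (forall r v, (r < D)%N -> a r v = b r v) -> inJ s D a p -> inJ s D b p.
Proof.
move=> ab [q hq]; exists q; suff <- : \sum_(r < D) lf (a r) * q r = \sum_(r < D) lf (b r) * q r by [].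
apply: eq_bigr => r _; congr (_ * _); apply: eq_bigr => v _.
by rewrite ab.
Qed.

Section GenericElim.
Variables (n : nat) (K : fieldType) (f : 'I_n) (W : {set 'I_n}) (a : nat -> 'I_n -> K).
Hypothesis fW : f \in W.

Lemma generic_neq0 m : (0 < m)%N -> generic m W a -> a 0 f != 0.
Proof.
move=> m0 [d [hd da]]; apply/eqP => a0.
have := da 0%N f 0%N f m0 m0 fW fW; rewrite a0 (deriv0 (hd 0%N f m0 fW)) !eqxx.
by move/esym/eqP; rewrite oner_eq0.
Qed.

Lemma deriv_elim (d : K -> K) r v' x : derivation d ->
  d (a 0 v') = 0 -> d (a 0 f) = 0 -> d (a r.+1 f) = 0 -> d (a r.+1 v') = x ->
  d (elim_rows f a r v') = x.
Proof.
move=> hv h1 h2 h3 h4; rewrite /elim_rows /elim_row (derivD hv) (derivN hv).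
rewrite (derivM hv (_ / _)) h1 (derivM hv (a r.+1 f)) h3 (deriv_inv0 hv h2) h4.
by rewrite mul0r !mulr0 !addr0 mul0r oppr0 addr0.
Qed.

Lemma generic_elim m : generic m.+1 W a -> generic m (W :\ f) (elim_rows f a).
Proof.
move=> [d [hd da]]; exists (fun r => d r.+1); split=> [r v rm|r v r' v' rm rm'].
  by rewrite !inE => /andP[_ vW]; apply: hd.
rewrite !inE => /andP[vf vW] /andP[vf' vW'].
have hv := hd r.+1 v rm vW.
by apply: (deriv_elim hv); rewrite da //= (negbTE vf) andbF.
Qed.

(** Row [D] is, up to a nonzero scalar, what the apex variable becomes after elimination.
    Multiplication by the apex is thus multiplication by a Lefschetz form, provided that the
    enlarged family is again generic. *)
Definition elim_rows0 D r v : K :=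
  if (r < D)%N then elim_rows f a r v else if v == f then 0 else a 0 v.

Lemma generic_elim0 D : generic D.+1 W a -> generic D.+1 (W :\ f) (elim_rows0 D).
Proof.
move=> ga; have af := generic_neq0 (ltn0Sn D) ga; case: ga => d [hd da].
pose c r := a r.+1 f / a 0 f.
(* [d 0 v] alone moves entry [v] of the eliminated row [r] by [- c r]; the added terms compensate
   for this, giving the last row dual derivations of its own. *)
pose d' r v x := if (r < D)%N then d r.+1 v x
   else d 0%N v x + \sum_(k < D) c k * d k.+1 v x.
have de r v v' r' : (r < D)%N -> (r' < D)%N -> v \in W :\ f -> v' \in W :\ f ->
    d r.+1 v (elim_rows f a r' v') = ((r == r') && (v == v'))%:R.
  rewrite !inE => rD rD' /andP[vf vW] /andP[vf' vW']; have hv := hd r.+1 v rD vW.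
  by apply: (deriv_elim hv); rewrite da //= (negbTE vf) andbF.
exists d'; split=> [r v rD|r v r' v' rD rD'].
  rewrite !inE => /andP[vf vW]; rewrite /d'; case: (boolP (r < D)%N) => [rD'|_].
    by apply: hd.
  have h0 := hd 0%N v (ltn0Sn D) vW.
  split=> x y.
    rewrite (derivD h0) [RHS]addrACA; congr (_ + _).
    rewrite -big_split /=; apply: eq_bigr => k _.
    by rewrite (derivD (hd k.+1 v (ltn_ord k) vW)) mulrDr.
  rewrite (derivM h0) mulrDl mulrDr addrACA; congr (_ + _).
  rewrite mulr_suml mulr_sumr -big_split /=; apply: eq_bigr => k _.
  by rewrite (derivM (hd k.+1 v (ltn_ord k) vW)); ring.
move=> vWf vWf'; move: (vWf) (vWf'); rewrite !inE => /andP[vf vW] /andP[vf' vW'].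
rewrite /d' /elim_rows0; case: (ltnP r D) => rD1; case: (ltnP r' D) => rD2.
- exact: de.
- by rewrite (negbTE vf') da //= (_ : (r == r') = false) //; apply/eqP; lia.
- rewrite (_ : (r == r') = false) /=; last by apply/eqP; lia.
  have h0 := hd 0%N v (ltn0Sn D) vW.
  have -> : d 0%N v (elim_rows f a r' v') = - (c r' * (v == v')%:R).
    rewrite /elim_rows /elim_row (derivD h0) (derivN h0) !(derivM h0).
    rewrite (deriv_inv0 h0) !da //= ?(negbTE vf) ?andbF //.
    by rewrite mul0r !mulr0 addr0 mul0r !add0r.
  rewrite (bigD1 (Ordinal rD2)) //= de // eqxx /= big1 ?addr0 ?addNr // => k kr.
  rewrite de //; move: kr; rewrite -val_eqE /= => /negbTE ->.
  by rewrite mulr0.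
rewrite (negbTE vf') da //= big1 ?addr0 => [|k _]; last first.
  by rewrite (da k.+1 v 0%N v' (ltn_ord k) (ltn0Sn D) vW vW') mulr0.
by rewrite (_ : r == r') //; apply/eqP; lia.
Qed.

End GenericElim.

Section Combination.
Variables (n : nat) (K : fieldType).
Local Notation cell := ({set 'I_n} * {set 'I_n})%type.
Local Notation c00 := (c00 n).
Implicit Types (s : seq cell) (e : nat -> K).

Definition comb s e : {mpoly K[n]} := \sum_(j < size s) e j *: xs K (nth c00 s j).2.

Lemma comb_cat s1 s2 e :
  comb (s1 ++ s2) e = comb s1 e + comb s2 (fun j => e (size s1 + j)%N).
Proof.
rewrite /comb size_cat big_split_ord /=; congr (_ + _); apply: eq_bigr => j _.
  by rewrite nth_cat ltn_ord.
by rewrite nth_cat ltnNge leq_addr /= addKn.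
Qed.

Lemma comb_cone f s e : comb (cone f s) e = comb s e.
Proof.
rewrite /comb size_map; apply: eq_bigr => j _.
by rewrite (nth_map c00) ?ltn_ord.
Qed.

Lemma comb_coneR f s e : avoids f s -> shell s -> comb (coneR f s) e = 'X_f * comb s e.
Proof.
move=> av sh; rewrite /comb size_map mulr_sumr; apply: eq_bigr => j _.
rewrite (nth_map c00) ?ltn_ord //= xsU1 -?scalerAr //.
have js : nth c00 s j \in s by apply: mem_nth.
by apply: contraNN (av _ js); apply/subsetP/(shell_restr sh).
Qed.

Lemma comb0 s e : (forall j, (j < size s)%N -> e j = 0) -> comb s e = 0.
Proof. by move=> h; rewrite /comb big1 // => j _; rewrite h ?ltn_ord // scale0r. Qed.

Lemma vanish_comb t s e : (forall c, c \in s -> ~~ inS t c.2) -> vanish t (comb s e).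
Proof.
move=> h; apply: vanish_sum => j _; apply/vanishZ/vanish_xs/h/mem_nth/ltn_ord.
Qed.

Lemma shell_new s1 s2 c : shell (s1 ++ s2) -> c \in s2 -> ~~ inS s1 c.2.
Proof.
move=> sh cs; have js : (index c s2 < size s2)%N by rewrite index_mem.
have := shell_nth c sh (j := (size s1 + index c s2)%N); rewrite size_cat ltn_add2l.
move=> /(_ js); rewrite nth_cat ltnNge leq_addr /= addKn nth_index // => -[cc hT].
have := hT _ cc; rewrite subxx => /negbT; apply: contraNN.
rewrite take_cat ltnNge leq_addr /= inS_cat => -> //.
Qed.

End Combination.

Lemma generic_sub (n : nat) (K : fieldType) m m' (W W' : {set 'I_n}) (a : nat -> 'I_n -> K) :
  (m' <= m)%N -> W' \subset W -> generic m W a -> generic m' W' a.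
Proof.
move=> mm /subsetP WW [d [hd da]]; exists d; split=> [r v rm vW|r v r' v' rm rm' vW vW'].
  by apply: hd; [apply: leq_trans mm | apply: WW].
by apply: da; rewrite ?WW // (leq_trans _ mm).
Qed.

Lemma generic_det (n : nat) (K : fieldType) (v0 : 'I_n) D W (a : nat -> 'I_n -> K) (F : {set 'I_n}) :
  generic D W a -> #|F| = D -> F \subset W -> \det (Amx v0 D a F) != 0.
Proof.
move=> [d [hd da]] FD FW; rewrite -unitfE -unitmxE.
exact: (A_unit v0 hd da FD FW).
Qed.

(** * Gluing a cone to the earlier complex *)

Section MayerVietoris.
Variables (n : nat) (K : fieldType) (v0 : 'I_n) (D : nat) (a : nat -> 'I_n -> K).
Local Notation cell := ({set 'I_n} * {set 'I_n})%type.
Local Notation c00 := (c00 n).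
Implicit Types (s : seq cell) (e : nat -> K) (p : {mpoly K[n]}).

Definition good s := [/\ shell s, (forall c, c \in s -> #|c.1| = D) &
  forall c, c \in s -> \det (Amx v0 D a c.1) != 0].

Lemma good_catl s1 s2 : good (s1 ++ s2) -> good s1.
Proof.
by move=> [h1 h2 h3]; split=> [|c cs|c cs]; [exact: shell_catl h1 | apply: h2 | apply: h3];
  rewrite mem_cat cs.
Qed.

Lemma span_comb s p i : good s -> p \is i.-homog ->
  exists2 e, (forall j, (j < size s)%N -> #|(nth c00 s j).2| != i -> e j = 0) &
    inJ s D a (p - comb s e).
Proof.
move=> [sh sD sd] hp; have [e he] := spanning_homog v0 a sh sD hp.
have d0 := detprod_neq0 sd.
exists (fun j => if #|(nth c00 s j).2| == i then (detprod v0 D a s)^-1 * e j else 0).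
  by move=> j _ /negbTE ->.
have := inJZ (detprod v0 D a s)^-1 he; rewrite scalerBr scalerA mulVf // scale1r.
rewrite scaler_sumr big_mkcond /comb /=.
congr (inJ _ _ _ (_ - _)); apply: eq_bigr => j _; case: ifP => _.
  by rewrite scalerA.
by rewrite scale0r.
Qed.

Lemma comb_indep s e : good s -> inJ s D a (comb s e) ->
  forall j, (j < size s)%N -> e j = 0.
Proof. by move=> [sh sD sd]; apply: (indep sh sD sd). Qed.

(** In the restriction basis of the union, restriction to [s1] kills the coefficients of its cells.
    Restriction to the cone over [sG] leaves ['X_f] times the part from [coneR], which the
    injectivity hypothesis removes; the rest is independent on the whole cone. *)
Lemma mayer_vietoris f s1 sG sN p i :
  avoids f (sG ++ sN) -> shell (sG ++ sN) ->
  good (s1 ++ coneR f sG ++ cone f sN) -> good (cone f (sG ++ sN)) ->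
  p \is i.-homog ->
  (forall q, q \is i.-1.-homog -> (0 < i)%N ->
     inJ (cone f sG) D a ('X_f * q) -> inJ (cone f sG) D a q) ->
  inJ s1 D a p -> inJ (cone f (sG ++ sN)) D a p ->
  inJ (s1 ++ coneR f sG ++ cone f sN) D a p.
Proof.
set s := s1 ++ _ => av shc gs gc hp inj h1 h2.
have [avG avN] := (avoids_cat f sG sN).1 av.
have shG := shell_catl shc.
have [shs _ _] := gs.
have [e e0 he] := span_comb gs hp.
pose e2 j := e (size s1 + j)%N; pose e3 j := e2 (size (coneR f sG) + j)%N.
have es : comb s e = comb s1 e + ('X_f * comb sG e2 + comb sN e3).
  by rewrite comb_cat comb_cat comb_coneR // comb_cone.
have sub1 T : inS s1 T -> inS s T by rewrite inS_cat => ->.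
have subc T : inS (cone f (sG ++ sN)) T -> inS s T.
  by rewrite inS_cone !inS_cat inS_coneR inS_cone orbA => /orP[]->; rewrite ?orbT.
have z1 j : (j < size s1)%N -> e j = 0.
  apply: comb_indep (good_catl gs) _ j.
  have h := inJB h1 (inJ_sub sub1 he); rewrite subKr comb_cat in h.
  have hv : vanish s1 (comb (coneR f sG ++ cone f sN) (fun j => e (size s1 + j)%N)).
    by apply: vanish_comb => c cs; apply: (shell_new shs).
  by have := inJB h (vanish_inJ D a hv); rewrite addrK.
rewrite (comb0 z1) add0r in es.
have h3 : inJ (cone f (sG ++ sN)) D a ('X_f * comb sG e2 + comb sN e3).
  by have := inJB h2 (inJ_sub subc he); rewrite subKr es.
have gG : good (cone f sG) by move: gc; rewrite /cone map_cat => /good_catl.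
have z2 j : (j < size sG)%N -> e2 j = 0.
  (* In degree 0 the cells of [coneR] do not occur, since their restrictions contain the apex; this
     is why [i.-1] only matters for positive [i]. *)
  move=> jG; have i0 : (0 < i)%N \/ e2 j = 0.
    case: i {hp inj} e0 => [e0|]; [right | by left].
    apply: e0; first by rewrite !size_cat !size_map; lia.
    rewrite nth_cat ltnNge leq_addr /= addKn nth_cat size_map jG (nth_map c00) //=.
    by rewrite -lt0n; apply/card_gt0P; exists f; rewrite !inE eqxx.
  case: i0 => // i0; move: j jG; suff : inJ (cone f sG) D a (comb (cone f sG) e2).
    by move=> h j jG; apply: (comb_indep gG h); rewrite size_map.
  rewrite comb_cone; apply: inj => //.
    apply: rpred_sum => j _.
    have [ej|ej] := eqVneq (e2 j) 0; first by rewrite ej scale0r rpred0.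
    suff -> : i.-1 = #|(nth c00 sG j).2| by apply/rpredZ/xs_homog.
    have : #|(nth c00 s (size s1 + j)).2| == i.
      apply: contraNT ej => h; apply/eqP/e0 => //.
      by rewrite !size_cat !size_map; have := ltn_ord j; lia.
    rewrite nth_cat ltnNge leq_addr /= addKn nth_cat size_map ltn_ord (nth_map c00) //=.
    rewrite cardsU1; have js : nth c00 sG j \in sG by apply: mem_nth.
    rewrite (contraNN (subsetP (shell_restr shG js) f) (avG _ js)) /= add1n.
    by move/eqP <-.
  have subG T : inS (cone f sG) T -> inS (cone f (sG ++ sN)) T.
    by rewrite !inS_cone inS_cat => ->.
  have hv : vanish (cone f sG) (comb sN e3).
    apply: vanish_comb => c cs; rewrite inS_cone.
    have cc : c.2 \subset c.1 by apply: (shell_restr shc); rewrite mem_cat cs orbT.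
    rewrite setD1_id; first exact: (shell_new shc).
    by apply: contraNN (avN _ cs); apply/subsetP.
  by have := inJB (inJ_sub subG h3) (vanish_inJ D a hv); rewrite addrK.
rewrite (comb0 z2) mulr0 add0r in es h3.
have z3 j : (j < size sN)%N -> e3 j = 0.
  move=> jN; pose e4 k := if (k < size sG)%N then 0 else e3 (k - size sG)%N.
  have -> : e3 j = e4 (size sG + j)%N by rewrite /e4 ltnNge leq_addr /= addKn.
  apply: (comb_indep gc); last by rewrite size_map size_cat ltn_add2l.
  rewrite comb_cone comb_cat [X in X + _](comb0 _) ?add0r => [|k kG]; last by rewrite /e4 kG.
  suff -> : comb sN (fun j => e4 (size sG + j)%N) = comb sN e3 by [].
  by apply: eq_bigr => k _; rewrite /e4 ltnNge leq_addr /= addKn.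
by move: he; rewrite es (comb0 z3) subr0.
Qed.

End MayerVietoris.

(** A shellable closed pseudomanifold whose facets have [D] vertices. The count 0 is for sets [T]
    that are not faces. *)
Definition sphere (n : nat) (D : nat) (s : seq ({set 'I_n} * {set 'I_n})) :=
  [/\ shell s, (forall c, c \in s -> #|c.1| = D) &
      forall T : {set 'I_n}, (#|T|.+1 = D)%N ->
        count (fun c : {set 'I_n} * {set 'I_n} => T \subset c.1) s \in [:: 0%N; 2]].

(** The exponent is that of a complex of dimension [D.-1], and row [D] of [a] is the Lefschetz form.
    The quantification over [W] and [a] lets the induction pass to eliminated rows on the vertices
    other than an apex. *)
Definition almostL (n : nat) (D : nat) (s : seq ({set 'I_n} * {set 'I_n})) :=
  forall (K : fieldType), (forall x : K, x + x = 0) ->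
  forall (W : {set 'I_n}) (a : nat -> 'I_n -> K), generic D.+1 W a ->
  (forall c, c \in s -> c.1 \subset W) ->
  forall i (p : {mpoly K[n]}), ((2 * i).+1 < D)%N -> p \is i.-homog ->
  inJ s D a (lf (a D) ^+ (D.-1 - 2 * i) * p) -> inJ s D a p.

Section Steps.
Variables (n : nat) (v0 f : 'I_n) (D : nat).
Local Notation cell := ({set 'I_n} * {set 'I_n})%type.
Implicit Types (s : seq cell).

Lemma inJMX (K : comNzRingType) s d (a : nat -> 'I_n -> K) x k l p : (k <= l)%N ->
  inJ s d a (x ^+ k * p) -> inJ s d a (x ^+ l * p).
Proof.
by move=> kl h; rewrite -(subnK kl) exprD -mulrA; apply: inJMl.
Qed.

Lemma cone_sub s (W : {set 'I_n}) : (forall c, c \in cone f s -> c.1 \subset W) -> avoids f s ->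
  forall c : cell, c \in s -> c.1 \subset W :\ f.
Proof.
move=> h av c cs; rewrite subsetD1 av // andbT.
have : (f |: c.1, c.2) \in cone f s by apply: map_f cs.
by move=> /h /=; rewrite subUset => /andP[].
Qed.

(** The cone has the same quotient as its base, so its exponent [D - 2 * i] is the full Lefschetz
    exponent of the base sphere, one dimension lower. *)
Lemma almostL_cone s : sphere D s -> avoids f s -> almostL D.+1 (cone f s).
Proof.
move=> [sh sD PM] av K c2 W a ga sW i p iD hp hJ.
case: s sh sD PM av sW hJ => [|c s] sh sD PM av sW hJ.
  by apply: vanish_inJ => m.
have fW : f \in W.
  have := sW (f |: c.1, c.2); rewrite mem_head => /(_ isT)/subsetP; apply.
  by rewrite !inE eqxx.
have af := generic_neq0 fW (ltn0Sn _) ga.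
have [d [hd da]] := generic_elim fW ga.
apply: (elim_cone af av).
apply: (sphere_lefschetz v0 c2 hd da sh sD (cone_sub sW av) PM (i := i)).
- by lia.
- exact: phi_homog.
by have := cone_elim af hJ; rewrite phiM phiXn phi_lf.
Qed.

(** The old complex, the cone over the whole boundary and their union have facets of equal size,
    hence the same exponents. [LG] is applied one dimension lower and in degree [i.-1]; its exponent
    is positive there, so it contains the injectivity of the apex itself. *)
Lemma almostL_join s1 sG sN :
  (forall c, c \in s1 -> #|c.1| = D.+1) ->
  shell (s1 ++ coneR f sG ++ cone f sN) -> avoids f (sG ++ sN) ->
  sphere D (sG ++ sN) -> almostL D sG -> almostL D.+1 s1 ->
  almostL D.+1 (s1 ++ coneR f sG ++ cone f sN).
Proof.
move=> s1D shs av sph LG L1 K c2 W a ga sW i p iD hp hJ.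
have [shc cD _] := sph; have [avG avN] := (avoids_cat f sG sN).1 av.
case: (boolP ((sG == [::]) && (sN == [::]))) => [/andP[/eqP e1 /eqP e2]|ne].
  move: hJ sW; rewrite e1 e2 !cats0 => hJ sW; apply: (L1 K c2 W a ga sW i) => //.
have gD : generic D.+1 W a by apply: generic_sub ga.
have sD c : c \in s1 ++ coneR f sG ++ cone f sN -> #|c.1| = D.+1.
  rewrite !mem_cat => /orP[/s1D //|/orP[]/mapP[c' cs ->]] /=.
    by rewrite cardsU1 avG // cD // mem_cat cs.
  by rewrite cardsU1 avN // cD // mem_cat cs orbT.
have gs : good v0 D.+1 a (s1 ++ coneR f sG ++ cone f sN).
  by split=> // c cs; apply: (generic_det v0 gD (sD c cs) (sW c cs)).
have subc c : c \in cone f (sG ++ sN) -> #|c.1| = D.+1 /\ c.1 \subset W.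
  rewrite /cone map_cat mem_cat => /orP[]/mapP[c' cs ->] /=.
    have h : (f |: c'.1, f |: c'.2) \in s1 ++ coneR f sG ++ cone f sN.
      by rewrite !mem_cat (map_f (fun c : cell => (f |: c.1, f |: c.2))) // orbT.
    by split; [exact: (sD _ h) | exact: (sW _ h)].
  have h : (f |: c'.1, c'.2) \in s1 ++ coneR f sG ++ cone f sN.
    by rewrite !mem_cat (map_f (fun c : cell => (f |: c.1, c.2))) // !orbT.
  by split; [exact: (sD _ h) | exact: (sW _ h)].
have gc : good v0 D.+1 a (cone f (sG ++ sN)).
  split=> [|c /subc[]//|c /subc[h1 h2]]; first exact: shell_cone.
  exact: (generic_det v0 gD h1 h2).
have fW : f \in W.
  have [c cs] : exists c, c \in sG ++ sN.
    by case: (sG) (sN) ne => [|c ? ?] => [[|c ?]|] // _; exists c; rewrite mem_head.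
  have [] := subc (f |: c.1, c.2) (map_f _ cs).
  by move=> _ /subsetP; apply; rewrite !inE eqxx.
have af := generic_neq0 fW (ltn0Sn _) ga.
have cW := cone_sub (fun c cs => (subc c cs).2) av.
apply: (mayer_vietoris av shc gs gc hp) => [q hq i0 hq1||].
- apply: (elim_cone af avG).
  have g0 := generic_elim0 fW gD.
  suff : inJ sG D (elim_rows0 f a D) (phi f a q).
    by apply: inJ_ext => r v rD; rewrite /elim_rows0 rD.
  apply: (LG K c2 _ _ g0 _ i.-1); first by move=> c cs; apply: cW; rewrite mem_cat cs.
  + by lia.
  + exact: phi_homog.
  apply: (@inJMX _ _ _ _ _ 1); first by lia.
  rewrite expr1; have := cone_elim af hq1; rewrite phiM phiX eqxx.
  have -> : elimf f a = (- (a 0 f)^-1) *: lf (elim_rows0 f a D D).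
    rewrite /elimf /lf scaler_sumr; apply: eq_bigr => v _; rewrite scalerA /elim_rows0 ltnn.
    by congr (_ *: _); rewrite mulNr mulrC mulNr.
  move=> h; have := inJZ (- a 0 f) h.
  rewrite -scalerAl scalerA mulrNN divff // scale1r.
  by apply: inJ_ext => r v rD; rewrite /elim_rows0 rD.
- apply: (L1 K c2 W a ga _ i) => //; first by move=> c cs; apply: sW; rewrite mem_cat cs.
  by apply: inJ_sub hJ => T; rewrite inS_cat => ->.
apply: (almostL_cone sph av c2 ga (fun c cs => (subc c cs).2) iD hp).
apply: inJ_sub hJ => T.
by rewrite inS_cone !inS_cat inS_coneR inS_cone orbA => /orP[]->; rewrite ?orbT.
Qed.

Lemma almostL_nil : @almostL n D [::].
Proof. by move=> K c2 W a ga _ i p _ _ _; apply: vanish_inJ. Qed.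

End Steps.

(** * Specialisation of generic coefficients *)

Section FractionDerivation.
Variables (A : idomainType) (d : A -> A).
Hypothesis hd : derivation d.
Local Notation "x %:F" := (@FracField.tofrac A x).
Implicit Types x y : {fraction A}.

Lemma frac_ex x : exists u : A * A, (u.2 != 0) && (x == u.1%:F / u.2%:F).
Proof.
elim/quotW: x => r; exists (\n_r, \d_r); rewrite denom_ratioP /=; apply/eqP.
have d0 : (\d_r)%:F != 0 by rewrite tofrac_eq0 denom_ratioP.
apply: (canRL (mulfK d0)); rewrite !piE; apply/eqmodP => /=.
rewrite FracField.equivfE /FracField.mulf !numden_Ratio ?mulr1 ?oner_eq0 ?denom_ratioP //.
by rewrite mulrC.
Qed.

(** The quotient rule on a chosen representative; [dfracE] makes it independent of the choice. *)
Definition dfrac x : {fraction A} :=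
  let: (u, v) := xchoose (frac_ex x) in (d u * v - u * d v)%:F / (v * v)%:F.

Lemma dfracE u v : v != 0 -> dfrac (u%:F / v%:F) = (d u * v - u * d v)%:F / (v * v)%:F.
Proof.
move=> v0; rewrite /dfrac; case: xchoose (xchooseP (frac_ex (u%:F / v%:F))) => u' v' /=.
move=> /andP[v'0 /eqP]; have F0 (w : A) : w != 0 -> w%:F != 0 by rewrite tofrac_eq0.
move=> /eqP; rewrite eqr_div ?F0 // -!tofracM tofrac_eq => /eqP e.
have de := congr1 d e; rewrite !(derivM hd) in de.
apply/eqP; rewrite eqr_div ?F0 ?mulf_neq0 // -!tofracM; apply/eqP; congr (_%:F).
have e1 : d u' * v = d u * v' + u * d v' - u' * d v by rewrite de addrK.
have -> : (d u' * v' - u' * d v') * (v * v) =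
    (d u' * v) * v' * v - (u' * v) * d v' * v by ring.
rewrite e1 -e; have -> : (d u * v - u * d v) * (v' * v') =
    d u * v' * v' * v - (u * v') * v' * d v by ring.
by rewrite [in RHS]e; ring.
Qed.

Lemma derivation_dfrac : derivation dfrac.
Proof.
have F0 (w : A) : w != 0 -> w%:F != 0 by rewrite tofrac_eq0.
split=> x y; have [[u v] /= /andP[v0 /eqP ->]] := frac_ex x;
  have [[u' v'] /= /andP[v'0 /eqP ->]] := frac_ex y.
  rewrite addf_div ?F0 // -!tofracM -!tofracD !dfracE ?mulf_neq0 //.
  rewrite !(derivD hd) !(derivM hd) addf_div ?F0 ?mulf_neq0 // -!tofracM -!tofracD.
  apply/eqP; rewrite eqr_div ?F0 ?mulf_neq0 // -!tofracM tofrac_eq.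
  by apply/eqP; ring.
rewrite mulf_div -!tofracM !dfracE ?mulf_neq0 // !(derivM hd) !mulf_div -!tofracM.
rewrite addf_div ?F0 ?mulf_neq0 // -!tofracM -!tofracD.
apply/eqP; rewrite eqr_div ?F0 ?mulf_neq0 // -!tofracM tofrac_eq.
by apply/eqP; ring.
Qed.

Lemma dfrac_tofrac u : dfrac u%:F = (d u)%:F.
Proof.
rewrite -[u%:F]divr1 -tofrac1 dfracE ?oner_neq0 // (deriv1 hd) mulr0 subr0 !mulr1.
by rewrite tofrac1 divr1.
Qed.

End FractionDerivation.

Section GenericPoint.
Variables (k : idomainType) (n m : nat).

(** One variable for each entry of the rows [0, ..., m]. A larger [r] falls back on row 0 through
    [inord], outside the range that [generic m.+1] sees. *)
Definition gvar (r : nat) (v : 'I_n) : 'I_#|{: 'I_m.+1 * 'I_n}| := enum_rank (inord r, v).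

Definition gfield : fieldType := {fraction {mpoly k[#|{: 'I_m.+1 * 'I_n}|]}}.

Lemma gfield_char2 : (forall x : k, x + x = 0) -> forall x : gfield, x + x = 0.
Proof.
move=> k2 x; have e2 : 2%:R = 0 :> k by rewrite mulr2n k2.
rewrite -mulr2n -mulr_natr -(rmorph_nat (@FracField.tofrac _)).
by rewrite -(rmorph_nat (@mpolyC _ _)) /= e2 mpolyC0 tofrac0 mulr0.
Qed.

Lemma generic_gvar :
  generic m.+1 [set: 'I_n] (fun r v => FracField.tofrac 'X_(gvar r v) : gfield).
Proof.
have dm i : derivation (mderiv i : {mpoly k[#|{: 'I_m.+1 * 'I_n}|]} -> _).
  by split=> p q; [apply: mderivD | apply: mderivM].
exists (fun r v => dfrac (mderiv (gvar r v))); split=> [r v _ _|r v r' v' rm rm' _ _].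
  exact: derivation_dfrac.
rewrite dfrac_tofrac // mderivX mnm1E.
have -> : (gvar r' v' == gvar r v) = (r == r') && (v == v').
  rewrite (inj_eq enum_rank_inj) xpair_eqE [v' == v]eq_sym; congr (_ && _).
  by rewrite -val_eqE /= !inordK // eq_sym.
case: eqP => [<-|_] /=; last by rewrite scale0r tofrac0.
case: eqP => [<-|_] /=; last by rewrite scale0r tofrac0.
rewrite scale1r -[RHS]tofrac1; congr FracField.tofrac.
by rewrite -mpolyX0; congr 'X_[_]; apply/mnmP => i; rewrite mnmBE subnn mnm0E.
Qed.

End GenericPoint.

Lemma digits_inj (B N : nat) (f g : nat -> nat) :
  (forall i, (i < N)%N -> (f i < B)%N) -> (forall i, (i < N)%N -> (g i < B)%N) ->
  (\sum_(i < N) f i * B ^ i = \sum_(i < N) g i * B ^ i)%N ->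
  forall i, (i < N)%N -> f i = g i.
Proof.
elim: N f g => [|N IH] f g hf hg //.
have step (h : nat -> nat) : (\sum_(i < N.+1) h i * B ^ i = h 0 + \sum_(i < N) h i.+1 * B ^ i * B)%N.
  rewrite big_ord_recl expn0 muln1; congr addn.
  by apply: eq_bigr => i _; rewrite -mulnA -expnSr.
rewrite !step -!big_distrl /= => e.
have B0 : (0 < B)%N by apply: leq_ltn_trans (hf 0%N isT).
have e0 : f 0%N = g 0%N.
  have := congr1 (modn^~ B) e; rewrite ![(_ + _ * B)%N]addnC !modnMDl.
  by rewrite !modn_small ?hf ?hg.
have e1 : (\sum_(i < N) f i.+1 * B ^ i = \sum_(i < N) g i.+1 * B ^ i)%N.
  move: e; rewrite e0 => /addnI /eqP; rewrite eqn_pmul2r // => /eqP.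
  by [].
by case=> [|i] // iN; apply: (IH (fun i => f i.+1) (fun i => g i.+1)) => // j jN; [apply: hf|apply: hg].
Qed.

(* Kronecker substitution [x_i := c ^ (B ^ i)] keeps the monomials apart. *)
Lemma mpoly_nonroot (F : numFieldType) N (p : {mpoly F[N]}) : p != 0 ->
  exists x : 'I_N -> F, p.@[x] != 0.
Proof.
move=> p0; pose B := msize p; pose w (m : 'X_{1..N}) := (\sum_(i < N) m i * B ^ i)%N.
have small m (i : 'I_N) : m \in msupp p -> (m i < B)%N.
  move=> mp; apply: leq_ltn_trans (msize_mdeg_lt mp).
  by rewrite mdegE (bigD1 i) //= leq_addr.
have w_inj m m' : m \in msupp p -> m' \in msupp p -> w m = w m' -> m = m'.
  move=> mp mp' e; apply/mnmP => i.
  pose f (m : 'X_{1..N}) (k : nat) := m (insubd i k).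
  have fi m1 (k : 'I_N) : f m1 k = m1 k by rewrite /f; congr (_ _); apply: val_inj; rewrite val_insubd ltn_ord.
  rewrite -!fi; apply: (@digits_inj B N (f m) (f m')) => // [k _|k _|]; try exact: small.
  by under eq_bigr do rewrite fi; rewrite -/(w m) e; apply: eq_bigr => k _; rewrite fi.
pose P : {poly F} := \sum_(m <- msupp p) p@_m *: 'X^(w m).
have PE c : p.@[fun i => c ^+ (B ^ i)] = P.[c].
  rewrite mevalE /P horner_sum; apply: eq_bigr => m _; rewrite hornerZ hornerXn; congr (_ * _).
  by rewrite /w expr_sum; apply: eq_bigr => i _; rewrite -exprM mulnC.
have P0 : P != 0.
  apply/eqP => /polyP /(_ (w (mlead p)))/eqP; rewrite coef0; apply/negP.
  rewrite /P coef_sum (big_rem (mlead p)) ?mlead_supp //= coefZ coefXn eqxx mulr1.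
  rewrite big1_seq ?addr0 ?mleadc_eq0 // => m /=; rewrite mem_rem_uniq ?msupp_uniq // inE.
  move=> /andP[ne mp]; rewrite coefZ coefXn; case: eqP => [e|_]; last by rewrite mulr0.
  by rewrite (w_inj _ _ _ mp e) ?eqxx ?mlead_supp // in ne.
suff [k k0] : exists k : nat, P.[k%:R] != 0 by exists (fun i => k%:R ^+ (B ^ i)); rewrite PE.
apply: contrapT => nex; have all0 k : P.[k%:R] = 0.
  by apply: contrapT => h; apply: nex; exists k; apply/eqP.
have := @max_poly_roots _ P [seq k%:R | k <- iota 0 (size P)] P0.
rewrite size_map size_iota ltnn => H; suff : false by []; apply: H.
  by apply/allP => x /mapP[k _ ->]; apply/rootP/all0.
by rewrite map_inj_uniq ?iota_uniq //; apply: mulrIn; apply: oner_neq0.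
Qed.


(** * Matrices of multiplication by powers of the Lefschetz form *)

Section Degree.
Variables (n D : nat) (s : seq ({set 'I_n} * {set 'I_n})) (v0 : 'I_n).
Local Notation c00 := (c00 n).

(* The restriction sets of size [i] index a basis of the degree-[i] part. *)
Definition piece (i : nat) := [set j : 'I_(size s) | #|(nth c00 s j).2| == i].

Definition gb (K : comNzRingType) i (r : 'I_#|piece i|) := xs K (nth c00 s (enum_val r)).2.

Lemma gb_homog (K : comNzRingType) i (r : 'I_#|piece i|) : gb K r \is i.-homog.
Proof. by have := enum_valP r; rewrite inE => /eqP {2}<-; apply: xs_homog. Qed.

Lemma big_piece (K : comNzRingType) i (e : nat -> K) :
  \sum_(j < size s | #|(nth c00 s j).2| == i) e j *: xs K (nth c00 s j).2 =
  \sum_(r < #|piece i|) e (enum_val r) *: gb K r.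
Proof.
rewrite -(big_enum_val (fun j : 'I_(size s) => e j *: xs K (nth c00 s j).2)).
by apply: eq_bigl => j; rewrite inE.
Qed.

(** Multiplication by [lf (a D) ^+ q], scaled by [detprod] to clear denominators. As a relation it
    makes sense over any ring and is transported by ring morphisms. *)
Definition lmx (K : comNzRingType) (a : nat -> 'I_n -> K) q i
    (M : 'M[K]_(#|piece i|, #|piece (q + i)%N|)) := forall r,
  inJ s D a (detprod v0 D a s *: (lf (a D) ^+ q * gb K r) - \sum_c M r c *: gb K c).

Hypotheses (sh : shell s) (sD : forall c, c \in s -> #|c.1| = D).

Lemma lmx_ex (K : comNzRingType) (a : nat -> 'I_n -> K) q i : exists M, @lmx K a q i M.
Proof.
have /choice[f hf] (r : 'I_#|piece i|) : exists e : nat -> K, inJ s D a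
    (detprod v0 D a s *: (lf (a D) ^+ q * gb K r) -
     \sum_(c < #|piece (q + i)%N|) e (enum_val c) *: gb K c).
  have [|e he] := spanning_homog v0 a sh sD (i := (q + i)%N) (p := lf (a D) ^+ q * gb K r).
    apply: dhomogM (gb_homog _ _); rewrite -[X in X.-homog]mul1n.
    exact/dhomogMn/lf_homog.
  by exists e; rewrite -big_piece.
by exists (\matrix_(r < #|piece i|, c < #|piece (q + i)%N|) f r (enum_val c)) => r; under eq_bigr do rewrite mxE.
Qed.

Section Map.
Variables (K L : comNzRingType) (h : {rmorphism K -> L}).

Lemma map_lf (b : 'I_n -> K) : map_mpoly h (lf b) = lf (fun v => h (b v)).
Proof. by rewrite /lf rmorph_sum /=; apply: eq_bigr => v _; rewrite map_mpolyZ map_mpolyX. Qed.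

Lemma inJ_map (a : nat -> 'I_n -> K) p :
  inJ s D a p -> inJ s D (fun r v => h (a r v)) (map_mpoly h p).
Proof.
move=> [q hq]; exists (fun r => map_mpoly h (q r)) => m hm.
rewrite -[RHS](rmorph0 h) -(hq m hm) -mcoeff_map_mpoly rmorphB rmorph_sum /=.
by congr (_ - _)@__; apply: eq_bigr => r _; rewrite rmorphM /= map_lf.
Qed.

Lemma detprod_map (a : nat -> 'I_n -> K) :
  h (detprod v0 D a s) = detprod v0 D (fun r v => h (a r v)) s.
Proof.
rewrite /detprod rmorph_prod; apply: eq_bigr => c _; rewrite -det_map_mx.
by congr (\det _); apply/matrixP => i j; rewrite !mxE.
Qed.

Lemma lmx_map (a : nat -> 'I_n -> K) q i M :
  @lmx K a q i M -> @lmx L (fun r v => h (a r v)) q i (map_mx h M).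
Proof.
move=> hM r; have gbm i' (c : 'I_#|piece i'|) : map_mpoly h (gb K c) = gb L c.
  exact: map_mpolyX.
have := inJ_map (hM r); rewrite rmorphB /= map_mpolyZ rmorphM rmorphXn /= map_lf gbm detprod_map.
rewrite rmorph_sum /=; congr (inJ _ _ _ (_ - _)); apply: eq_bigr => c _.
by rewrite map_mpolyZ gbm mxE.
Qed.
End Map.

Section Field.
Variables (K : fieldType) (a : nat -> 'I_n -> K).
Hypothesis sd : forall c, c \in s -> \det (Amx v0 D a c.1) != 0.

Lemma gb_indep i (u : 'I_#|piece i| -> K) :
  inJ s D a (\sum_r u r *: gb K r) -> forall r, u r = 0.
Proof.
pose e (j : nat) := \sum_(r < #|piece i| | (enum_val r : nat) == j) u r.
have ev (r : 'I_#|piece i|) : e (enum_val r) = u r.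
  by rewrite /e (big_pred1 r) // => r'; rewrite val_eqE (inj_eq enum_val_inj).
have -> : \sum_r u r *: gb K r = \sum_(j < size s) e j *: xs K (nth c00 s j).2.
  rewrite (bigID (fun j : 'I_(size s) => #|(nth c00 s j).2| == i)) /= big_piece.
  rewrite [X in _ + X]big1 ?addr0; first by apply: eq_bigr => r _; rewrite ev.
  move=> j ji; rewrite /e big1 ?scale0r // => r /eqP er; case/negP: ji.
  by have := enum_valP r; rewrite inE er.
move=> /(indep sh sD sd) h r; rewrite -ev; apply: h; exact: ltn_ord.
Qed.

Lemma gb_span i p : p \is i.-homog -> exists u : 'I_#|piece i| -> K,
  inJ s D a (p - \sum_r u r *: gb K r).
Proof.
move=> hp; have [e he] := spanning_homog v0 a sh sD hp.
exists (fun r : 'I_#|piece i| => (detprod v0 D a s)^-1 * e (enum_val r)).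
have := inJZ (detprod v0 D a s)^-1 he.
rewrite scalerBr scalerA mulVf ?(detprod_neq0 sd) // scale1r big_piece scaler_sumr.
by congr (inJ _ _ _ (_ - _)); apply: eq_bigr => r _; rewrite scalerA.
Qed.

Lemma lmx_comb q i M (u : 'rV_#|piece i|) : lmx a (q := q) M ->
  inJ s D a (detprod v0 D a s *: (lf (a D) ^+ q * \sum_r u 0 r *: gb K r) -
             \sum_c (u *m M) 0 c *: gb K c).
Proof.
move=> hM; rewrite mulr_sumr scaler_sumr.
have -> : \sum_c (u *m M) 0 c *: gb K c = \sum_r u 0 r *: \sum_c M r c *: gb K c.
  under eq_bigr do rewrite mxE scaler_suml.
  rewrite exchange_big; apply: eq_bigr => r _; rewrite scaler_sumr.
  by apply: eq_bigr => c _; rewrite scalerA.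
rewrite -sumrB; apply: inJ_sum => r _; have := inJZ (u 0 r) (hM r).
by rewrite scalerBr -scalerAr !scalerA mulrC.
Qed.

Definition inj_at q i := forall p : {mpoly K[n]}, p \is i.-homog ->
  inJ s D a (lf (a D) ^+ q * p) -> inJ s D a p.

Lemma lmx_free q i M : lmx a (q := q) (i := i) M -> inj_at q i <-> row_free M.
Proof.
move=> hM; split=> [inj|fM p hp hJ].
  rewrite -kermx_eq0; apply/rowV0P => u /sub_kermxP uM.
  have := lmx_comb u hM; rewrite uM [X in _ - X]big1 => [|c _]; last by rewrite mxE scale0r.
  rewrite subr0 => /(inJZ (detprod v0 D a s)^-1).
  rewrite scalerA mulVf ?(detprod_neq0 sd) // scale1r => /inj H.
  apply/rowP => r; rewrite mxE; apply: (gb_indep (u := fun r => u 0 r)); apply: H.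
  by apply: rpred_sum => r' _; apply/rpredZ/gb_homog.
have [u hu] := gb_span hp; pose v : 'rV_#|piece i| := \row_r u r.
have vE : \sum_r v 0 r *: gb K r = \sum_r u r *: gb K r.
  by apply: eq_bigr => r _; rewrite mxE.
have h1 : inJ s D a (lf (a D) ^+ q * \sum_r v 0 r *: gb K r).
  by have := inJB hJ (inJMl (lf (a D) ^+ q) hu); rewrite -mulrBr subKr vE.
have h2 := inJB (inJZ (detprod v0 D a s) h1) (lmx_comb v hM); rewrite subKr in h2.
have v0' : v = 0.
  apply/eqP; rewrite -(mulmx_free_eq0 _ fM); apply/eqP/rowP => c.
  by rewrite [RHS]mxE; apply: (gb_indep (u := fun c => (v *m M) 0 c)).
by move: hu; rewrite -vE v0' big1 ?subr0 // => r _; rewrite mxE scale0r.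
Qed.

End Field.
End Degree.

Lemma row_free_minor (K : fieldType) m n (M : 'M[K]_(m, n)) : row_free M ->
  exists f : 'I_m -> 'I_n, \det (colsub f M) != 0.
Proof.
move=> fM; have fT : row_full M^T by rewrite /row_full mxrank_tr.
exists (fullrankfun fT); rewrite -unitfE -unitmxE -unitmx_tr.
by rewrite trmx_mxsub -row_full_unit; apply: fullrowsub_full.
Qed.

Lemma minor_row_free (K : fieldType) m n (M : 'M[K]_(m, n)) f :
  \det (colsub f M) != 0 -> row_free M.
Proof.
rewrite -unitfE -unitmxE -row_free_unit => uM; rewrite -kermx_eq0; apply/rowV0P => u /sub_kermxP uM0.
apply/eqP; rewrite -(mulmx_free_eq0 _ uM); apply/eqP.
by rewrite mulmx_colsub uM0; apply/matrixP => i j; rewrite !mxE.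
Qed.

(* The minors certifying injectivity over the generic field of characteristic
   2 are integer polynomials in the coefficients, so they survive at some
   integral point. *)
Lemma lefschetz_point_char2 (k : idomainType) (F : numFieldType) n D
    (s : seq ({set 'I_n} * {set 'I_n})) (v0 : 'I_n) : (forall x : k, x + x = 0) ->
  shell s -> (forall c, c \in s -> #|c.1| = D) -> almostL D s ->
  exists2 a : nat -> 'I_n -> F, (forall c, c \in s -> \det (Amx v0 D a c.1) != 0) &
    forall i, ((2 * i).+1 < D)%N -> inj_at D s a (D.-1 - 2 * i)%N i.
Proof.
move=> k2 sh sD Ls; pose N := #|{: 'I_D.+1 * 'I_n}|; pose A := {mpoly int[N]}.
pose a (r : nat) (v : 'I_n) : A := 'X_(gvar D r v).
pose h0 : {rmorphism int -> k} := intr.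
pose h1 : {rmorphism A -> {mpoly k[N]}} := map_mpoly h0.
pose h : {rmorphism A -> gfield k n D} := (@FracField.tofrac _) \o h1.
have ha : (fun r v => h (a r v)) = (fun r v => FracField.tofrac 'X_(gvar D r v)).
  by apply/funext => r; apply/funext => v; rewrite /h /= /h1 /= map_mpolyX.
have gen : generic D.+1 [set: 'I_n] (fun r v => h (a r v)) by rewrite ha; apply: generic_gvar.
have sdK c : c \in s -> \det (Amx v0 D (fun r v => h (a r v)) c.1) != 0.
  move=> cs; apply: generic_det (subsetT _); last exact: sD.
  exact: generic_sub (leqnSn D) (subxx _) gen.
have /choice[dl hdl] (i : nat) : exists dl : A, ((2 * i).+1 < D)%N -> h dl != 0 /\
    forall g : {rmorphism A -> F},
      (forall c, c \in s -> \det (Amx v0 D (fun r v => g (a r v)) c.1) != 0) ->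
      g dl != 0 -> inj_at D s (fun r v => g (a r v)) (D.-1 - 2 * i)%N i.
  case: (ltnP (2 * i).+1 D) => [iD|_]; last by exists 0.
  have [M hM] := lmx_ex v0 sh sD a (D.-1 - 2 * i)%N i.
  have /row_free_minor[f hf] : row_free (map_mx h M).
    apply/(lmx_free sh sD sdK (lmx_map h hM)) => p hp.
    by apply: (Ls _ (gfield_char2 k2) _ _ gen) => // c _; apply: subsetT.
  exists (\det (colsub f M)) => _; rewrite -det_map_mx map_mxsub; split=> // g sdF.
  rewrite -det_map_mx map_mxsub => /minor_row_free.
  by move/(lmx_free sh sD sdF (lmx_map g hM)).
(* A point where [P] does not vanish has nonsingular facets and certifies injectivity in all the
   required degrees at once. *)
pose P := detprod v0 D a s * \prod_(i < D | ((2 * i).+1 < D)%N) dl i.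
(* The image of [P] in the field of characteristic 2 is nonzero, so [P] is nonzero over the
   integers, and it stays so over [F], which has characteristic 0. *)
have hP : map_mpoly (intr : int -> F) P != 0.
  have : h P != 0.
    rewrite /P rmorphM detprod_map; apply: mulf_neq0; first exact: detprod_neq0 sdK.
    by rewrite rmorph_prod; apply/prodf_neq0 => i iD; have [] := hdl i iD.
  apply: contraNneq => e; have -> : P = 0; last by rewrite rmorph0.
  apply/mpolyP => m; have := congr1 (mcoeff m) e; rewrite mcoeff_map_mpoly !mcoeff0.
  by move/eqP; rewrite intr_eq0 => /eqP.
have [x hx] := mpoly_nonroot hP.
pose g0 : {rmorphism int -> F} := intr.
pose g : {rmorphism A -> F} := meval x \o map_mpoly g0.
have gP : g P != 0 by [].
move: gP; rewrite /P rmorphM mulf_eq0 negb_or detprod_map rmorph_prod => /andP[gd gdl].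
have sdF c : c \in s -> \det (Amx v0 D (fun r v => g (a r v)) c.1) != 0.
  by move=> cs; move: gd; rewrite /detprod prodf_seq_neq0 => /allP/(_ c cs).
exists (fun r v => g (a r v)) => // i iD; apply: (hdl i iD).2 => //.
have i' : (i < D)%N by apply: leq_trans iD; rewrite ltnS; lia.
by move/prodf_neq0: gdl => /(_ (Ordinal i') iD).
Qed.

Theorem lefschetz_point (F : numFieldType) n D (s : seq ({set 'I_n} * {set 'I_n})) (v0 : 'I_n) :
  shell s -> (forall c, c \in s -> #|c.1| = D) -> almostL D s ->
  exists2 a : nat -> 'I_n -> F, (forall c, c \in s -> \det (Amx v0 D a c.1) != 0) &
    forall i, ((2 * i).+1 < D)%N -> inj_at D s a (D.-1 - 2 * i)%N i.
Proof.
apply: (@lefschetz_point_char2 'F_2) => x.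
have e2 : 2%:R = 0 :> 'F_2 by apply: val_inj.
by rewrite -mulr2n -mulr_natr e2 mulr0.
Qed.

(** * Ideals, h-vectors and g-vectors *)

Section Ideals.
Variables (n : nat) (K : comNzRingType) (G : {mpoly K[n]} -> Prop).
Implicit Types p q g : {mpoly K[n]}.

Lemma in_ideal_min (P : {mpoly K[n]} -> Prop) : P 0 ->
  (forall p q, P p -> P q -> P (p + q)) -> (forall g q, G g -> P (q * g)) ->
  forall p, in_ideal G p -> P p.
Proof.
move=> P0 PD PG p [s [sG ->]]; elim: s sG => [|x s IH] sG; first by rewrite big_nil.
rewrite big_cons; apply: PD; first by apply/PG/sG; rewrite mem_head.
by apply: IH => y ys; apply: sG; rewrite inE ys orbT.
Qed.

Lemma in_ideal0 : in_ideal G 0.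
Proof. by exists [::]; split=> //; rewrite big_nil. Qed.

Lemma in_idealD p q : in_ideal G p -> in_ideal G q -> in_ideal G (p + q).
Proof.
move=> [s [sG ->]] [t [tG ->]]; exists (s ++ t); rewrite big_cat; split=> // x.
by rewrite mem_cat => /orP[/sG|/tG].
Qed.

Lemma in_ideal_gen g q : G g -> in_ideal G (q * g).
Proof.
by move=> Gg; exists [:: (g, q)]; split=> [x|]; rewrite ?big_seq1 // inE => /eqP->.
Qed.

Lemma in_idealMl p q : in_ideal G p -> in_ideal G (q * p).
Proof.
move: p; apply: (in_ideal_min (P := fun p => in_ideal G (q * p))) => [|p1 p2|g r Gg]; first by rewrite mulr0; apply: in_ideal0.
  by rewrite mulrDr; apply: in_idealD.
by rewrite mulrA; apply: in_ideal_gen.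
Qed.

Lemma in_ideal_sum (I : Type) (r : seq I) (P : pred I) (F : I -> {mpoly K[n]}) :
  (forall i, P i -> in_ideal G (F i)) -> in_ideal G (\sum_(i <- r | P i) F i).
Proof. by move=> h; elim/big_rec: _ => [|i p Pi]; [apply: in_ideal0 | apply/in_idealD/h]. Qed.

End Ideals.

Section Translation.
Variables (n : nat) (K : comNzRingType) (Gamma : {set {set 'I_n}}).
Variable s : seq ({set 'I_n} * {set 'I_n}).
Hypothesis sG : forall T, inS s T = (T \in Gamma).
Variable a : nat -> 'I_n -> K.
Implicit Types p q : {mpoly K[n]}.

Lemma inJ_ideal (G : {mpoly K[n]} -> Prop) m p :
  (forall F : {set 'I_n}, F \notin Gamma -> G (\prod_(i in F) 'X_i)) ->
  (forall j, (j < m)%N -> G (lf (a j))) -> inJ s m a p -> in_ideal G p.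
Proof.
move=> GF GT [q hq]; rewrite -[p](subrK (\sum_(r < m) lf (a r) * q r)); apply: in_idealD.
  move: hq; move: (p - _) => u hu; rewrite [u]mpolyE big_seq; apply: in_ideal_sum => x xu.
  have nF : msup x \notin Gamma.
    by rewrite -sG; apply: contraTN xu => /hu u0; rewrite mcoeff_msupp u0 eqxx.
  have -> : x = ((x - mset (msup x)) + mset (msup x))%MM.
    rewrite submK //; apply/mnm_lepP => i; rewrite mnm_set inE; case: (x i) => //.
  by rewrite mpolyXD -/(xs K _) xs_prod scalerAl; apply/in_ideal_gen/GF.
by apply: in_ideal_sum => r _; rewrite mulrC; apply/in_ideal_gen/GT.
Qed.

Lemma SR_idealP m p :
  in_ideal (SR_Theta_gens Gamma (fun j : 'I_m => lf (a j))) p <-> inJ s m a p.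
Proof.
split; last first.
  apply: inJ_ideal => [F nF|j jm]; first by left; exists F.
  by right; exists (Ordinal jm).
move: p; apply: in_ideal_min => [|p1 p2|g q [[F [nF ->]]|[j ->]]]; [exact: inJ0|exact: inJD| |].
  by apply/inJMl/vanish_inJ; rewrite -xs_prod; apply: vanish_xs; rewrite sG.
by apply/inJMl/inJ_lf/ltn_ord.
Qed.

End Translation.

(** * Interval partitions, h-vectors and g-vectors *)

Lemma sum_interval (A : comNzRingType) n (R S : {set 'I_n}) (y : A) : R \subset S ->
  \sum_(F : {set 'I_n} | (R \subset F) && (F \subset S)) y ^+ (#|S| - #|F|) =
  (1 + y) ^+ (#|S| - #|R|).
Proof.
move=> RS; pose f i : A := (i \in S)%:R; pose g i : A := if i \in R then 0 else if i \in S then y else 1.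
transitivity (\prod_(i < n) (f i + g i)); last first.
  rewrite -cardsDS // -prodr_const [RHS]big_mkcond; apply: eq_bigr => i _; rewrite inE /f /g.
  case: (boolP (i \in R)) => [iR|_] /=; first by rewrite (subsetP RS) // addr0.
  by case: (i \in S); rewrite ?add0r.
rewrite bigA_distr big_mkcond; apply: eq_bigr => F _.
case: ifP => [/andP[RF FS]|/negbT].
  rewrite -cardsDS // -prodr_const big_mkcond; apply: eq_bigr => i _; rewrite !inE /f /g.
  case: (boolP (i \in F)) => [iF|nF] /=; first by rewrite (subsetP FS).
  by rewrite (negbTE (contraNN (subsetP RF i) nF)).
rewrite negb_and => /orP[]/subsetPn[i i1 i2]; apply/esym; rewrite (bigD1 i) //=.
  by rewrite (negbTE i2) /g i1 mul0r.
by rewrite i1 /f (negbTE i2) mul0r.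
Qed.

(** A shelling partitions the faces into the intervals from restriction to facet. With
    [sum_interval] at [y = 'X - 1], each interval contributes a single power of ['X] to the
    h-polynomial. *)
Lemma sum_shell (A : nmodType) n (s : seq ({set 'I_n} * {set 'I_n})) (f : {set 'I_n} -> A) :
  shell s -> \sum_(F | inS s F) f F =
  \sum_(c <- s) \sum_(F : {set 'I_n} | (c.2 \subset F) && (F \subset c.1)) f F.
Proof.
elim/last_ind: s => [|s c IH]; first by move=> _; rewrite big_nil big_pred0.
move=> /shell_rcons[sh cc hT]; rewrite big_rcons -IH //= (bigID (inS s)) /=.
congr (_ + _); apply: eq_bigl => F; rewrite inS_rcons; first by case: (inS s F); rewrite ?andbF.
case: (boolP (F \subset c.1)) => [/hT ->|]; last by rewrite orbF andbN andbF.
by case: (_ \subset _).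
Qed.

Section Gvector.
Variables (n D : nat) (Gamma : {set {set 'I_n}}) (s : seq ({set 'I_n} * {set 'I_n})).
Hypotheses (sG : forall T, inS s T = (T \in Gamma)) (s0 : s != [::]) (sh : shell s).
Hypothesis sD : forall c, c \in s -> #|c.1| = D.

Lemma card_face F : F \in Gamma -> (#|F| <= D)%N.
Proof. by rewrite -sG => /hasP[c cs Fc]; rewrite -(sD cs); apply: subset_leq_card. Qed.

Lemma sc_dE : sc_d Gamma = D.
Proof.
apply/eqP; rewrite eqn_leq; apply/andP; split; first by apply/bigmax_leqP => F; apply: card_face.
case: s s0 sG sD => // c t _ tG tD; rewrite -(tD c (mem_head _ _)).
by apply: (leq_bigmax_cond (F := fun F : {set 'I_n} => #|F|)); rewrite -tG /inS /= subxx.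
Qed.

Lemma hvecE i : (i <= D)%N -> hvec Gamma i = #|piece s i|%:R.
Proof.
move=> iD; rewrite /hvec sc_dE.
have -> : \sum_(j < D.+1) (fnum Gamma j)%:R *: ('X - 1) ^+ (D - j) =
    \sum_(F in Gamma) ('X - 1) ^+ (D - #|F|) :> {poly int}.
  rewrite [RHS](partition_big (fun F : {set 'I_n} => inord #|F| : 'I_D.+1) predT) //=.
  apply: eq_bigr => j _; rewrite scaler_nat -sumr_const /fnum.
  apply: congr_big => [//|F|F]; rewrite !inE.
    case: (boolP (F \in Gamma)) => //= FG.
    by rewrite -val_eqE /= inordK // ltnS card_face.
  by move=> /andP[_ /eqP->].
have -> : \sum_(F in Gamma) ('X - 1) ^+ (D - #|F|) =
    \sum_(j < size s) 'X ^+ (D - #|(nth (c00 n) s j).2|) :> {poly int}.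
  transitivity (\sum_(F | inS s F) ('X - 1) ^+ (D - #|F|) : {poly int}).
    by apply: eq_bigl => F; rewrite sG.
  rewrite (sum_shell _ sh) (big_nth (c00 n)) big_mkord; apply: eq_bigr => j _.
  have js : nth (c00 n) s j \in s by apply: mem_nth.
  rewrite -(sD js) sum_interval ?(shell_restr sh js) //.
  by rewrite addrC subrK.
rewrite coef_sum -sum1_card natr_sum big_mkcond [RHS]big_mkcond; apply: eq_bigr => j _ /=.
have js : nth (c00 n) s j \in s by apply: mem_nth.
have := subset_leq_card (shell_restr sh js); rewrite sD // => RD.
rewrite coefXn inE; move: #|_| RD => r RD.
have -> : (D - i == D - r)%N = (r == i) by apply/eqP/eqP; lia.
by case: eqP.
Qed.

Variables (K : fieldType) (v0 : 'I_n) (a : nat -> 'I_n -> K).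
Hypothesis sd : forall c, c \in s -> \det (Amx v0 D a c.1) != 0.
Hypothesis inj : forall i, ((2 * i).+1 < D)%N -> inj_at D s a (D.-1 - 2 * i)%N i.

Lemma inJ_top p : p \is D.+1.-homog -> inJ s D a p.
Proof.
move=> hp; have [u] := gb_span sh sD sd hp; rewrite big1 ?subr0 // => r _.
have := enum_valP r; rewrite inE => /eqP e.
have js : nth (c00 n) s (enum_val r) \in s by apply: mem_nth.
by have := subset_leq_card (shell_restr sh js); rewrite sD // e ltnn.
Qed.

Theorem lefschetz_ideal : almost_strong_lefschetz K Gamma.
Proof.
exists (fun j => lf (a j)), (lf (a D)); split; [by move=> j; apply: lf_homog| | exact: lf_homog |].
  by exists D.+1 => p hp; apply/(SR_idealP sG); rewrite sc_dE; apply: inJ_top.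
move=> i; rewrite {1}sc_dE => iD p hp /(SR_idealP sG); rewrite !sc_dE => hJ.
apply/(SR_idealP sG); apply: (inj _ hp hJ); lia.
Qed.

(** [iota 0 D.+1] includes the index [D] of the Lefschetz form. The last list cuts off all degrees
    above [D./2]; bounded multinomials make it a finite enumeration. *)
Definition ggens : seq {mpoly K[n]} :=
  [seq \prod_(i in F) 'X_i | F : {set 'I_n} <- enum (~: Gamma)] ++
  [seq lf (a r) | r <- iota 0 D.+1] ++
  [seq 'X_[m] | m : 'X_{1..n < D./2.+2} <- enum [pred m : 'X_{1..n < D./2.+2} | mdeg m == D./2.+1]].

Lemma ggensP g : g \in ggens -> [\/ exists2 F, F \notin Gamma & g = xs K F,
  exists2 r, (r < D)%N & g = lf (a r), g = lf (a D) |
  exists2 m, mdeg m = D./2.+1 & g = 'X_[m]].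
Proof.
rewrite !mem_cat => /or3P[/mapP[F]|/mapP[r]|/mapP[m]].
- by rewrite mem_enum inE => nF ->; constructor 1; exists F; rewrite ?xs_prod.
- rewrite mem_iota add0n leq0n ltnS leq_eqVlt => /orP[/eqP->|rD] ->; first by constructor 3.
  by constructor 2; exists r.
by rewrite mem_enum => /eqP hm ->; constructor 4; exists m.
Qed.

Lemma ggens_homog g : g \in ggens -> exists2 d, (0 < d)%N & g \is d.-homog.
Proof.
move=> /ggensP[[F nF]|[r _]| |[m hm]] ->; [|by exists 1%N => //; apply: lf_homog..|].
  exists #|F|; last exact: xs_homog.
  rewrite lt0n cards_eq0; apply: contraNneq nF => ->; rewrite -sG.
  by case: s s0 => // c t _; rewrite /inS /= sub0set.
by exists D./2.+1 => //; rewrite dhomogX /= hm.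
Qed.

Local Notation I := (in_ideal (fun g => g \in ggens)).

Lemma inJ_ggens p : inJ s D a p -> I p.
Proof.
apply: (inJ_ideal sG) => [F nF|j jD]; rewrite !mem_cat.
  by apply/orP; left; apply/mapP; exists F; rewrite // mem_enum inE.
by apply/or3P; constructor 2; apply/mapP; exists j => //; rewrite mem_iota leq0n add0n ltnS ltnW.
Qed.

Lemma omega_ggens p : I (lf (a D) * p).
Proof.
rewrite mulrC; apply: in_ideal_gen; rewrite !mem_cat; apply/or3P; constructor 2.
by apply/mapP; exists D => //; rewrite mem_iota leq0n add0n ltnS leqnn.
Qed.

Lemma high_ggens i p : (D./2 < i)%N -> p \is i.-homog -> I p.
Proof.
move=> iD hp; rewrite [p]mpolyE big_seq; apply: in_ideal_sum => m /(dhomog_mf hp) /= mi.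
rewrite -mul_mpolyC; apply: in_idealMl; rewrite -(subnKC iD) in mi.
elim: (i - _)%N m mi => [|j IH] m.
  rewrite addn0 => hm; rewrite -['X_[m]]mul1r; apply: in_ideal_gen.
  rewrite !mem_cat; apply/or3P; constructor 3; apply/mapP.
  have hm' : (mdeg m < D./2.+2)%N by rewrite hm.
  by exists (BMultinom hm') => //; rewrite mem_enum inE /= hm.
rewrite addnS => hm; have /existsP[v mv] : [exists v, m v != 0%N].
  apply: contraT => /existsPn m0; suff E : m = 0%MM by rewrite E mdeg0 in hm.
  by apply/mnmP => v; rewrite mnm0E; apply/eqP; have := m0 v; rewrite negbK.
have E : m = (U_(v) + (m - U_(v)))%MM by rewrite addmC submK // lep1mP.
rewrite E mpolyXD; apply/in_idealMl/IH; apply/succn_inj.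
by rewrite -hm {2}E mdegD mdeg1 add1n.
Qed.

(** Up to degree [D./2] the truncating monomials contribute nothing, so modulo [inJ] only multiples
    of the Lefschetz form remain. In degree 0 there is no room even for these. *)
Lemma low_ggens i p : (i <= D./2)%N -> p \is i.-homog -> I p ->
  exists2 w, inJ s D a (p - lf (a D) * w) & if i is i'.+1 then w \is i'.-homog else w = 0.
Proof.
move=> iD hp Ip.
suff [w hw] : exists w, inJ s D a (pihomog mdeg i (p - lf (a D) * w)).
  exists (if i is i'.+1 then pihomog mdeg i' w else 0).
    move: hw; rewrite pihomogB (pihomog_dE hp) pihomog_lfM.
    by case: (i) => [|i']; rewrite ?mulr0.
  by case: (i) => [|i'] //; apply: pihomogP.
move: p Ip {hp}; apply: in_ideal_min => [|p q [w hw] [w' hw']|g q].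
- by exists 0; rewrite mulr0 subr0 pihomog0; apply: inJ0.
- exists (w + w'); have := inJD hw hw'; rewrite -pihomogD.
  by congr (inJ _ _ _ (pihomog _ _ _)); ring.
move=> /ggensP[[F nF]|[r rD]| |[m hm]] ->.
- exists 0; rewrite mulr0 subr0; apply/inJ_pihomog/inJMl/vanish_inJ/vanish_xs.
  by rewrite sG.
- by exists 0; rewrite mulr0 subr0; apply/inJ_pihomog/inJMl/inJ_lf.
- by exists q; rewrite mulrC subrr pihomog0; apply: inJ0.
exists 0; rewrite mulr0 subr0; suff -> : pihomog mdeg i (q * 'X_[m]) = 0 by apply: inJ0.
apply/mpolyP => m'; rewrite mcoeff_pihomog mcoeff0; case: eqP => // hm'.
rewrite mcoeffM big1 // => -[l1 l2] /=; move: (bmnm l1) (bmnm l2) => k1 k2 /eqP e.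
rewrite mcoeffX; case: eqP => [e2|_].
  by move: iD; rewrite -hm' e mdegD -e2 hm => /(leq_trans (leq_addl _ _)); rewrite ltnn.
by rewrite mulr0.
Qed.

Lemma omega_free i M : ((2 * i).+1 < D)%N -> lmx (s := s) D v0 a (q := 1) (i := i) M -> row_free M.
Proof.
move=> iD hM; apply/(lmx_free sh sD sd hM) => p hp; rewrite expr1 => hJ; apply: (inj iD hp).
have -> : (D.-1 - 2 * i = (D.-1 - 2 * i).-1.+1)%N by lia.
by rewrite exprSr -mulrA; apply: inJMl.
Qed.

(** Modulo [inJ], the ideal in degree [i] is the image of the Lefschetz form from degree [i.-1],
    that is, the row space of [M]. A complement of it gives the basis, and injectivity gives the
    dimension. *)
Lemma piece_dim i : (0 < i <= D./2)%N ->
  graded_piece_dim (fun g => g \in ggens) i (#|piece s i| - #|piece s i.-1|).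
Proof.
(* The bound [D./2] is exactly what puts the preceding degree into the range of the Lefschetz
   property. *)
case: i => // i /= iD; have iD2 : ((2 * i).+1 < D)%N by lia.
have [M hM] := lmx_ex v0 sh sD a 1 i.
have fM := omega_free iD2 hM.
have rC : \rank M^C%MS = (#|piece s i.+1| - #|piece s i|)%N.
  by rewrite mxrank_compl; move/eqP: fM => ->.
rewrite -rC; pose B := row_base M^C%MS.
pose b (j : 'I_(\rank M^C%MS)) := \sum_c B j c *: gb K c.
have bE (u : 'rV_(\rank M^C%MS)) : \sum_j u 0 j *: b j = \sum_c (u *m B) 0 c *: gb K c.
  under [RHS]eq_bigr do rewrite mxE scaler_suml.
  rewrite exchange_big; apply: eq_bigr => j _; rewrite scaler_sumr.
  by apply: eq_bigr => c _; rewrite scalerA.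
have sumB (u v : 'rV[K]_#|piece s i.+1|) : \sum_c (u - v) 0 c *: gb K c =
    \sum_c u 0 c *: gb K c - \sum_c v 0 c *: gb K c.
  by rewrite -sumrB; apply: eq_bigr => c _; rewrite !mxE scalerBl.
have d0 := detprod_neq0 sd.
exists b; split.
- by move=> j; apply: rpred_sum => c _; apply/rpredZ/gb_homog.
- move=> u Iu; pose v : 'rV_(\rank M^C%MS) := \row_j u j.
  have vE : \sum_j u j *: b j = \sum_c (v *m B) 0 c *: gb K c.
    by rewrite -bE; apply: eq_bigr => j _; rewrite mxE.
  have [|w hw wi] := low_ggens iD _ Iu.
    by rewrite vE; apply: rpred_sum => c _; apply/rpredZ/gb_homog.
  have [y hy] := gb_span sh sD sd wi; pose z := \row_r y r.
  have zE : \sum_r y r *: gb K r = \sum_r z 0 r *: gb K r.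
    by apply: eq_bigr => r _; rewrite mxE.
  have h1 := inJZ (detprod v0 D a s) (inJD hw (inJMl (lf (a D)) hy)).
  have h2 := inJD h1 (lmx_comb z hM).
  have zv : detprod v0 D a s *: (v *m B) - z *m M = 0.
    apply/rowP => c; rewrite [RHS]mxE; move: c; apply: (gb_indep sh sD sd).
    rewrite sumB; move: h2; rewrite vE zE expr1; congr (inJ _ _ _ _).
    have -> : \sum_c (detprod v0 D a s *: (v *m B)) 0 c *: gb K c =
        detprod v0 D a s *: \sum_c (v *m B) 0 c *: gb K c.
      by rewrite scaler_sumr; apply: eq_bigr => c _; rewrite [in LHS]mxE scalerA.
    by rewrite mulrBr !scalerDr !scalerN; ring.
  have vB0 : v *m B = 0.
    have : (v *m B <= M :&: M^C)%MS.
      rewrite sub_capmx; apply/andP; split; last by rewrite -(eq_row_base M^C%MS) submxMl.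
      move/eqP: zv; rewrite subr_eq0 => /eqP zv.
      have -> : v *m B = ((detprod v0 D a s)^-1 *: z) *m M.
        by rewrite -scalemxAl -zv scalerA mulVf // scale1r.
      exact: submxMl.
    by rewrite capmx_compl submx0 => /eqP.
  have v0' : v = 0 by apply/eqP; rewrite -(mulmx_free_eq0 _ (row_base_free M^C%MS)) -/B vB0.
  by move=> j; have := congr1 (fun v : 'rV__ => v 0 j) v0'; rewrite !mxE.
move=> p hp; have [y hy] := gb_span sh sD sd hp; pose z := \row_r y r.
have zE : \sum_r y r *: gb K r = \sum_r z 0 r *: gb K r.
  by apply: eq_bigr => r _; rewrite mxE.
have /sub_addsmxP[[u1 u2] /= uE] : (z <= M + row_base M^C%MS)%MS.
  have := addsmx_compl_full M; rewrite -sub1mx => h.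
  apply: submx_trans (submx1 z) (submx_trans h _).
  by rewrite addsmxS // eq_row_base.
exists (fun j => u2 0 j); rewrite bE -/B.
have -> : p - \sum_c (u2 *m B) 0 c *: gb K c =
    (p - \sum_r y r *: gb K r) + \sum_c (u1 *m M) 0 c *: gb K c.
  have -> : u1 *m M = z - u2 *m B by rewrite uE addrK.
  by rewrite sumB zE addrA subrK.
apply: in_idealD; first exact: inJ_ggens.
rewrite -[X in I X](subrK (detprod v0 D a s *: (lf (a D) ^+ 1 * \sum_r u1 0 r *: gb K r))).
apply: in_idealD; first by apply: inJ_ggens; rewrite -opprB; apply/inJN/lmx_comb.
by rewrite expr1 -mul_mpolyC; apply/in_idealMl/omega_ggens.
Qed.

Theorem gvec_M_sequence : M_sequence (gvec Gamma).
Proof.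
exists K, n, ggens; split=> [|i]; first exact: ggens_homog.
case: (posnP i) => [->|i0].
  exists 1%N; split; last by rewrite /gvec nth_mkseq.
  exists (fun=> 1); split=> [j|u|p hp]; first exact: dhomog1.
    rewrite big_ord_recl big_ord0 addr0 => Iu j; rewrite ord1.
    (* All generators have positive degree, so no element of the ideal has a constant term. *)
    have := Iu; suff H p : I p -> p@_0 = 0.
      by move/H; rewrite mcoeffZ mcoeff1 eqxx mulr1.
    move: p; apply: in_ideal_min => [|p q hp hq|g q /ggens_homog[d d0 hg]].
    - by rewrite mcoeff0.
    - by rewrite mcoeffD hp hq addr0.
    rewrite (mcoeffM _ _ 0%MM) big1 // => -[l1 l2] /=; move: (bmnm l1) (bmnm l2) => k1 k2 /eqP.
    move=> /(congr1 mdeg); rewrite mdeg0 mdegD => /esym/eqP; rewrite addn_eq0 => /andP[_ /eqP k2'].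
    by rewrite (dhomog_nemf_coeff hg) ?mulr0 //= k2' eq_sym -lt0n.
  exists (fun=> p@_0); rewrite big_ord_recl big_ord0 addr0.
  suff -> : p - p@_0 *: 1 = 0 by apply: in_ideal0.
  apply/mpolyP => m; rewrite mcoeffB mcoeffZ mcoeff1 mcoeff0.
  case: eqP => [->|/eqP m0]; first by rewrite mulr1 subrr.
  by rewrite mulr0 subr0 (dhomog_nemf_coeff hp) //= mdeg_eq0.
case: (leqP i D./2) => iD; last first.
  exists 0%N; split; last by rewrite nth_default // size_mkseq sc_dE.
  exists (fun=> 0); split=> [[]//|u _ []//|p hp].
  by exists (fun=> 0); rewrite big_ord0 subr0; apply: high_ggens hp.
exists (#|piece s i| - #|piece s i.-1|)%N; split; first by apply: piece_dim; rewrite i0.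
rewrite /gvec nth_mkseq ?sc_dE // -[i == 0%N]negbK -lt0n i0 /=.
have iD' : (i <= D)%N by lia.
rewrite !hvecE //; last by lia.
have fM : (#|piece s i.-1| <= #|piece s i|)%N.
  case: i i0 iD iD' => // i _ iD iD' /=; have [M hM] := lmx_ex v0 sh sD a 1 i.
  have /eqP <- : row_free M by apply: omega_free hM; lia.
  exact: rank_leq_col.
by rewrite -natz natrB.
Qed.

End Gvector.

From mathcomp Require Import classical_sets cardinality reals lra.

(** * Polytopes *)

Section Polytopes.
Variables (R : realType) (t : nat).
Local Notation V := 'rV[R]_t.
Implicit Types (P F G H : set V) (x y : V).

Lemma dotvD (a x y : V) : dotv a (x + y) = dotv a x + dotv a y.
Proof. by rewrite /dotv -big_split; apply: eq_bigr => i _; rewrite mxE mulrDr. Qed.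

Lemma dotvZ (a x : V) c : dotv a (c *: x) = c * dotv a x.
Proof. by rewrite /dotv mulr_sumr; apply: eq_bigr => i _; rewrite mxE mulrCA. Qed.

Lemma dotv_sum (a : V) (I : Type) (r : seq I) (f : I -> V) :
  dotv a (\sum_(i <- r) f i) = \sum_(i <- r) dotv a (f i).
Proof.
elim: r => [|i r IH]; last by rewrite !big_cons dotvD IH.
by rewrite !big_nil /dotv big1 // => i _; rewrite mxE mulr0.
Qed.

Lemma dotvDl (a b x : V) : dotv (a + b) x = dotv a x + dotv b x.
Proof. by rewrite /dotv -big_split; apply: eq_bigr => i _; rewrite mxE mulrDl. Qed.

Lemma dotvZl (a x : V) c : dotv (c *: a) x = c * dotv a x.
Proof. by rewrite /dotv mulr_sumr; apply: eq_bigr => i _; rewrite mxE mulrA. Qed.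

Definition mid x y : V := 2^-1 *: (x + y).

Lemma polytope_mid P x y : polytope P -> P x -> P y -> P (mid x y).
Proof.
move=> [S ->] [w [w0 w1 ->]] [w' [w0' w1' ->]].
exists (fun i => 2^-1 * (w i + w' i)); split.
- by move=> i; rewrite mulr_ge0 ?invr_ge0 ?ler0n // addr_ge0.
- by rewrite -mulr_sumr big_split /= w1 w1' mulVf // pnatr_eq0.
rewrite /mid -big_split scaler_sumr; apply: eq_bigr => i _ /=.
by rewrite -scalerDl scalerA.
Qed.

Lemma face_mid G P x y : face G P -> P x -> P y -> G (mid x y) -> G x /\ G y.
Proof.
move=> [a [b [hle ->]]] Px Py [_]; rewrite /mid dotvZ dotvD => e.
have hx := hle _ Px; have hy := hle _ Py.
have e' : dotv a x + dotv a y = b + b.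
  by have := congr1 (fun z => 2 * z) e; rewrite mulrA mulfV ?pnatr_eq0 // mul1r mulr_natl.
by split; split=> //; lra.
Qed.

(* The midpoint of a point avoiding some faces and a point avoiding another one
   avoids them all. *)
Lemma polytope_cover H (M : nat -> set V) r : polytope H -> (exists x, H x) ->
  (forall l, (l < r)%N -> face (setI H (M l)) H) ->
  (forall x, H x -> exists2 l, (l < r)%N & M l x) ->
  exists2 l, (l < r)%N & subset H (M l).
Proof.
move=> pH [x0 Hx0] hf hc; apply: contrapT => hn.
have av l : (l < r)%N -> exists2 x, H x & ~ M l x.
  move=> lr; apply: contrapT => h; apply: hn; exists l => // x Hx.
  by apply: contrapT => nM; apply: h; exists x.
suff [x Hx nx] : exists2 x, H x & forall l, (l < r)%N -> ~ M l x.
  by have [l lr Mx] := hc _ Hx; case: (nx l lr).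
elim: r hf {hc hn} av => [|r IH] hf av; first by exists x0.
have [x Hx nx] := IH (fun l lr => hf l (ltnW lr)) (fun l lr => av l (ltnW lr)).
have [y Hy ny] := av r (ltnSn r).
exists (mid x y); first exact: polytope_mid.
move=> l lr Ml.
have Hm : setI H (M l) (mid x y) by split=> //; apply: polytope_mid.
have [Hx' Hy'] := face_mid (hf l lr) Hx Hy Hm.
have [e|ne] := eqVneq l r; first by apply: ny; rewrite -e; case: Hy'.
by apply: (nx l); [rewrite ltn_neqAle ne | case: Hx'].
Qed.

Lemma conv_in (S : seq V) i : (i < size S)%N -> conv S S`_i.
Proof.
move=> iS; exists (fun j => (j == Ordinal iS)%:R); split.
- by move=> j; rewrite ler0n.
- by rewrite (bigD1 (Ordinal iS)) //= eqxx big1 ?addr0 // => j /negbTE ->.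
rewrite (bigD1 (Ordinal iS)) //= eqxx scale1r big1 ?addr0 // => j /negbTE ->.
by rewrite scale0r.
Qed.

(** Reduces the sign of an affine function on a convex hull to its signs at the generators. *)
Lemma conv_aff (S : seq V) x (a : V) b : conv S x ->
  exists2 w : 'I_(size S) -> R, (forall i, 0 <= w i) &
    b - dotv a x = \sum_i w i * (b - dotv a S`_i).
Proof.
move=> [w [w0 w1 ->]]; exists w => //; rewrite dotv_sum.
have eb : b = \sum_i w i * b by rewrite -mulr_suml w1 mul1r.
by rewrite {1}eb -sumrB; apply: eq_bigr => i _; rewrite mulrBr dotvZ.
Qed.

Lemma face_ge0 G P : face G P -> exists a b,
  (forall x, P x -> 0 <= b - dotv a x) /\
  (forall x, G x <-> P x /\ b - dotv a x = 0).
Proof.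
move=> [a [b [hle ->]]]; exists a, b; split=> [x Px|x]; first by rewrite subr_ge0 hle.
by split=> -[Px e]; split=> //; [rewrite e subrr | apply/esym/eqP; rewrite -subr_eq0 e].
Qed.

Lemma face_sub G P : face G P -> subset G P.
Proof. by move=> [a [b [_ ->]]] x []. Qed.

Definition aff_free (k : nat) (h : nat -> V) := forall u : nat -> R,
  \sum_(i < k) u i = 0 -> \sum_(i < k) u i *: h i = 0 -> forall i, (i < k)%N -> u i = 0.

Lemma has_dim_free P k : has_dim P k ->
  exists2 h : nat -> V, (forall i, (i < k.+1)%N -> P (h i)) & aff_free k.+1 h.
Proof.
move=> [[p [Pp ind]] _]; exists (fun i => p (inord i)) => [i _ //|u s0 s1].
have e1 : \sum_(i < k) u i.+1 *: (p (lift ord0 i) - p ord0) = 0.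
  under eq_bigr do rewrite scalerBr.
  rewrite sumrB -scaler_suml; move: s0 s1; rewrite !big_ord_recl /=.
  have -> : \sum_(i < k) u (bump 0 i) = \sum_(i < k) u i.+1 by [].
  move=> /eqP; rewrite addr_eq0 => /eqP e; rewrite (_ : inord 0 = ord0); last first.
    by apply: val_inj; rewrite /= inordK.
  have -> : \sum_(i < k) u (bump 0 i) *: p (inord (bump 0 i)) =
      \sum_(i < k) u i.+1 *: p (lift ord0 i).
    apply: eq_bigr => i _; congr (_ *: p _); apply: val_inj.
    by rewrite /= inordK // ltnS ltn_ord.
  by rewrite e scaleNr addrC.
have u0 : \row_(i < k) u i.+1 = 0.
  have : (\row_(i < k) u i.+1) *m (\matrix_(i < k) (p (lift ord0 i) - p ord0)) = 0.
    rewrite mulmx_sum_row -[RHS]e1; apply: eq_bigr => i _; by rewrite mxE rowK.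
  by move/eqP; rewrite mulmx_free_eq0 // => /eqP.
have us i : (i < k)%N -> u i.+1 = 0.
  by move=> ik; have /rowP/(_ (Ordinal ik)) := u0; rewrite !mxE.
move=> [_|i ik]; last exact: us.
move: s0; rewrite big_ord_recl big1 ?addr0 // => i _; exact: us.
Qed.

Lemma has_dim_dep P k (h : nat -> V) : has_dim P k ->
  (forall i, (i < k.+2)%N -> P (h i)) ->
  exists2 u : nat -> R, (exists2 i, (i < k.+2)%N & u i != 0) &
    \sum_(i < k.+2) u i = 0 /\ \sum_(i < k.+2) u i *: h i = 0.
Proof.
move=> [_ dep] Ph; have := dep (fun i : 'I_k.+2 => h i) (fun i => Ph i (ltn_ord i)).
rewrite /aff_indep => /negP; rewrite -kermx_eq0 => /rowV0Pn[w /sub_kermxP wM w0].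
have /existsP[j wj] : [exists j, w 0 j != 0].
  apply: contraNT w0 => /existsPn hw; apply/eqP/rowP => j.
  by rewrite mxE; apply/eqP/negPn/hw.
pose wn (i : nat) := \sum_(j < k.+1 | j == i :> nat) w 0 j.
have wnE (j' : 'I_k.+1) : wn j' = w 0 j' by rewrite /wn (big_pred1 j').
exists (fun i => if i is i'.+1 then wn i' else - \sum_j w 0 j).
  by exists j.+1; [rewrite ltnS ltn_ord | rewrite /= wnE].
have sw : \sum_(i < k.+1) wn (i : nat) = \sum_j w 0 j by apply: eq_bigr => i _; rewrite wnE.
split; rewrite big_ord_recl /=.
  by have -> : \sum_(i < k.+1) wn i = \sum_j w 0 j by []; rewrite addNr.
move: wM; rewrite mulmx_sum_row => wM.
rewrite scaleNr scaler_suml addrC -sumrB -[RHS]wM; apply: eq_bigr => i _.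
by rewrite rowK /= wnE -scalerBr.
Qed.

(** * The diamond property of the face lattice *)

Section Diamond.
Variables (k : nat) (F G0 H : set V) (h : nat -> V).
Hypotheses (pF : polytope F) (dF : has_dim F k.+1).
Hypothesis facets_of_F : forall G, boundary F G -> (exists x, G x) ->
  exists2 G', facet (boundary F) G' & subset G G'.
Hypotheses (fG0 : facet (boundary F) G0) (HF : face H F).
Hypotheses (HG0 : subset H G0) (HnG0 : H <> G0).
Hypotheses (hH : forall i, (i < k)%N -> H (h i)) (hfree : aff_free k h).

Let G0F : subset G0 F. Proof. by case: fG0 => -[/face_sub]. Qed.

Lemma not_sub_ex (A B : set V) : subset A B -> A <> B -> exists2 x, B x & ~ A x.
Proof.
move=> AB ne; apply: contrapT => hn; apply: ne; apply/seteqP; split=> // x Bx.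
by apply: contrapT => nA; apply: hn; exists x.
Qed.

Lemma diamond_coord : exists q1 q2, [/\ G0 q1, ~ H q1, F q2, ~ G0 q2 &
  forall x, F x -> exists al be, forall a b,
    (forall z, H z -> b - dotv a z = 0) ->
    b - dotv a x = al * (b - dotv a q1) + be * (b - dotv a q2)].
Proof.
have [q1 Gq1 nHq1] := not_sub_ex HG0 HnG0.
have [q2 Fq2 nGq2] : exists2 x, F x & ~ G0 x.
  by apply: not_sub_ex => //; case: fG0 => -[].
exists q1, q2; split=> // x Fx.
pose pts i := if (i < k)%N then h i else if i == k then q1 else if i == k.+1 then q2 else x.
have Fpts i : (i < k.+3)%N -> F (pts i).
  move=> ik; rewrite /pts; case: ifP => [ik'|_]; first exact/G0F/HG0/hH.
  case: ifP => _; first exact: G0F.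
  by case: ifP.
have [u [i0 i0k ui0] [su sp]] := has_dim_dep dF Fpts.
move: su sp; rewrite !big_ord_recr /=.
have pk : pts k = q1 by rewrite /pts ltnn eqxx.
have pk1 : pts k.+1 = q2 by rewrite /pts ltnNge leqnSn /= eqxx gtn_eqF.
have pk2 : pts k.+2 = x.
  by rewrite /pts ltnNge (leqW (leqnSn k)) /= !gtn_eqF.
rewrite pk pk1 pk2.
have -> : \sum_(i < k) u i *: pts i = \sum_(i < k) u i *: h i.
  by apply: eq_bigr => i _; rewrite /pts ltn_ord.
move=> su sp.
have app a b : (forall z, H z -> b - dotv a z = 0) ->
   u k * (b - dotv a q1) + u k.+1 * (b - dotv a q2) + u k.+2 * (b - dotv a x) = 0.
  move=> hz; have := congr1 (dotv a) sp; rewrite !dotvD !dotvZ dotv_sum.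
  have -> : dotv a 0 = 0 by rewrite -(scale0r 0) dotvZ mul0r.
  under eq_bigr => i _ do rewrite dotvZ.
  have -> : \sum_(i < k) u i * dotv a (h i) = (\sum_(i < k) u i) * b.
    rewrite mulr_suml; apply: eq_bigr => i _; congr (_ * _).
    by apply/esym/eqP; rewrite -subr_eq0 hz //; apply: hH.
  move: su; set s := \sum_(i < k) u i => su e.
  have es : s = - (u k + u k.+1 + u k.+2).
    by apply/eqP; rewrite -subr_eq0 opprK !addrA su.
  by rewrite es in e; apply/eqP; rewrite -oppr_eq0 -[X in _ == X]e; apply/eqP; ring.
have [u2|u2] := eqVneq (u k.+2) 0; last first.
  exists (- (u k / u k.+2)), (- (u k.+1 / u k.+2)) => a b hz.
  have e := app a b hz; apply: (mulfI u2); apply/eqP; rewrite -subr_eq0 -[X in _ == X]e.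
  by apply/eqP; field.
(* If [x] had coefficient 0, the function exposing [G0] would kill the coefficient of [q2], the one
   exposing [H] that of [q1], and the independence of the [h i] all the others. *)
exfalso.
have [a [b [ge0 zeq]]] : exists a b, (forall z, F z -> 0 <= b - dotv a z) /\
    (forall z, G0 z <-> F z /\ b - dotv a z = 0).
  by apply: face_ge0; case: fG0 => -[].
have hz z : H z -> b - dotv a z = 0 by move=> /HG0 /zeq[].
have [_ z1] := (zeq q1).1 Gq1.
have n2 : b - dotv a q2 != 0 by apply/eqP => z2; apply: nGq2; apply/zeq.
have u1 : u k.+1 = 0.
  have := app a b hz; rewrite z1 u2 mulr0 mul0r add0r addr0 => /eqP.
  by rewrite mulf_eq0 (negbTE n2) orbF => /eqP.
have [a' [b' [ge0' zeq']]] := face_ge0 HF.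
have n1 : b' - dotv a' q1 != 0.
  by apply/eqP => z1'; apply: nHq1; apply/zeq'; split=> //; apply: G0F.
have uk : u k = 0.
  have := app a' b' (fun z Hz => ((zeq' z).1 Hz).2).
  rewrite u1 u2 !mul0r !addr0 => /eqP.
  by rewrite mulf_eq0 (negbTE n1) orbF => /eqP.
have hu : forall i, (i < k)%N -> u i = 0.
  apply: hfree.
    by move: su; rewrite uk u1 u2 !addr0.
  by move: sp; rewrite uk u1 u2 !scale0r !addr0.
case/eqP: ui0; have : (i0 < k)%N \/ [\/ i0 = k, i0 = k.+1 | i0 = k.+2].
  have [|] := ltnP i0 k; [by left | right].
  have [->|n1'] := eqVneq i0 k; first by constructor 1.
  have [->|n2'] := eqVneq i0 k.+1; first by constructor 2.
  by constructor 3; lia.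
by move=> [/hu|[]->].
Qed.

(** The supporting hyperplane of [H] is tilted about its intersection with that of [G0], as far as
    the generators of [F] outside [G0] allow. The generator with the smallest ratio stops the motion
    and lies in a new face through [H]; a facet containing that face is different from [G0]. *)
Lemma diamond_ex : exists G1, [/\ facet (boundary F) G1, G1 <> G0 & subset H G1].
Proof.
have [S eF] := pF.
have [a [b [ge0 zeq]]] : exists a b, (forall z, F z -> 0 <= b - dotv a z) /\
    (forall z, G0 z <-> F z /\ b - dotv a z = 0).
  by apply: face_ge0; case: fG0 => -[].
have [a' [b' [ge0' zeq']]] := face_ge0 HF.
have [q2 Fq2 nGq2] : exists2 x, F x & ~ G0 x.
  by apply: not_sub_ex => //; case: fG0 => -[].
have [q1 Gq1 nHq1] := not_sub_ex HG0 HnG0.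
have SF (i : 'I_(size S)) : F S`_i by rewrite eF; apply: conv_in.
pose p0 (i : 'I_(size S)) := 0 < b - dotv a S`_i.
have [i1 pi1] : exists i, p0 i.
  apply: contrapT => hn; apply: nGq2; apply/zeq; split=> //.
  rewrite eF in Fq2; have [w w0 ->] := conv_aff a b Fq2.
  rewrite big1 // => i _.
  have := ge0 _ (SF i); rewrite le_eqVlt => /orP[/eqP<-|hlt]; first by rewrite mulr0.
  by case: hn; exists i.
pose ratio (i : 'I_(size S)) := (b' - dotv a' S`_i) / (b - dotv a S`_i).
have [i2 pi2 mini] : exists2 i, p0 i & forall j, p0 j -> ratio i <= ratio j.
  by case: (arg_minP ratio pi1) => i pi mi; exists i.
pose mu := ratio i2.
have chi z : b' - mu * b - dotv (a' - mu *: a) z =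
    (b' - dotv a' z) - mu * (b - dotv a z).
  by rewrite dotvDl -scaleNr dotvZl; ring.
have chi_ge z : F z -> 0 <= b' - mu * b - dotv (a' - mu *: a) z.
  rewrite eF => /(conv_aff (a' - mu *: a) (b' - mu * b))[w w0 ->].
  apply: sumr_ge0 => i _; apply: mulr_ge0 => //; rewrite chi subr_ge0.
  have := ge0 _ (SF i); rewrite le_eqVlt => /orP[/eqP<-|hi].
    by rewrite mulr0; apply: ge0'.
  by rewrite -ler_pdivlMr //; apply: mini.
pose G' := [set z | F z /\ dotv (a' - mu *: a) z = b' - mu * b]%classic.
have bG' : boundary F G'.
  split; first by exists (a' - mu *: a), (b' - mu * b); split=> // z /chi_ge; rewrite subr_ge0.
  move=> e; have : G' q1 by rewrite e; apply: G0F.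
  move=> [_ /esym/eqP]; rewrite -subr_eq0 chi.
  have [_ ->] := (zeq q1).1 Gq1; rewrite mulr0 subr0 => /eqP z1.
  by apply: nHq1; apply/zeq'; split=> //; apply: G0F.
have Gi2 : G' S`_i2.
  split=> //; apply/esym/eqP; rewrite -subr_eq0 chi /mu /ratio divfK ?subrr //.
  by rewrite gt_eqF.
have [G1 fG1 sG] := facets_of_F bG' (ex_intro _ _ Gi2).
exists G1; split=> // [e|z Hz].
  have := sG _ Gi2; rewrite e => /zeq[_ z0].
  by move: pi2; rewrite /p0 z0 ltxx.
apply: sG; split; first exact/G0F/HG0.
apply/esym/eqP; rewrite -subr_eq0 chi.
have [_ ->] := (zeq' z).1 Hz; have [_ ->] := (zeq z).1 (HG0 Hz).
by rewrite mulr0 subrr.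
Qed.

(** By [diamond_coord] the functions exposing [G0], [G1], [G2] satisfy a linear relation on [F],
    where those of [G1] and [G2] enter with positive factors. The sign of the coefficient [c] at
    [G0] gives one of the inclusions between [G1] and [G2], and facets are maximal. *)
Lemma diamond_uniq G1 G2 : facet (boundary F) G1 -> facet (boundary F) G2 ->
  G1 <> G0 -> G2 <> G0 -> subset H G1 -> subset H G2 -> G1 = G2.
Proof.
have [q1 [q2 [Gq1 nHq1 Fq2 nGq2 coord]]] := diamond_coord.
have [a [b [ge0 zeq]]] : exists a b, (forall z, F z -> 0 <= b - dotv a z) /\
    (forall z, G0 z <-> F z /\ b - dotv a z = 0).
  by apply: face_ge0; case: fG0 => -[].
have [_ z1] := (zeq q1).1 Gq1.
have n2 : b - dotv a q2 != 0 by apply/eqP => z2; apply: nGq2; apply/zeq.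
have hz z : H z -> b - dotv a z = 0 by move=> /HG0 /zeq[].
have expose G : facet (boundary F) G -> G <> G0 -> subset H G -> exists a' b',
    [/\ forall z, F z -> 0 <= b' - dotv a' z, forall z, G z <-> F z /\ b' - dotv a' z = 0 &
        0 < b' - dotv a' q1].
  move=> fG ne HG.
  have [a' [b' [ge0' zeq']]] : exists a b, (forall z, F z -> 0 <= b - dotv a z) /\
      (forall z, G z <-> F z /\ b - dotv a z = 0).
    by apply: face_ge0; case: fG => -[].
  exists a', b'; split=> //.
  have := ge0' _ (G0F Gq1); rewrite le_eqVlt => /orP[/eqP z1'|//].
  case: ne; apply: fG0.2; first by case: fG.
  move=> z Gz; have [Fz z0] := (zeq z).1 Gz.
  have [al [be cz]] := coord z Fz; apply/zeq'; split=> //.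
  rewrite (cz a' b' (fun z Hz => ((zeq' z).1 (HG z Hz)).2)) -z1' mulr0 add0r.
  have := cz a b hz; rewrite z0 z1 mulr0 add0r => /esym/eqP.
  by rewrite mulf_eq0 (negbTE n2) orbF => /eqP ->; rewrite mul0r.
move=> f1 f2 ne1 ne2 H1 H2.
have [a1 [b1 [ge1 zeq1 p1]]] := expose _ f1 ne1 H1.
have [a2 [b2 [ge2 zeq2 p2]]] := expose _ f2 ne2 H2.
have hz1 z : H z -> b1 - dotv a1 z = 0 by move=> /H1 /zeq1[].
have hz2 z : H z -> b2 - dotv a2 z = 0 by move=> /H2 /zeq2[].
set x1 := b1 - dotv a1 q1 in p1; set x2 := b2 - dotv a2 q1 in p2.
set w1 := b1 - dotv a1 q2; set w2 := b2 - dotv a2 q2; set w := b - dotv a q2 in n2.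
have w0 : 0 < w by rewrite lt_neqAle eq_sym n2 ge0.
have [c rel] : exists c, forall z, F z ->
    x2 * (b1 - dotv a1 z) = x1 * (b2 - dotv a2 z) + c * (b - dotv a z).
  exists ((x2 * w1 - x1 * w2) / w) => z /coord[al [be cz]].
  rewrite (cz _ _ hz1) (cz _ _ hz2) (cz _ _ hz) z1 -/x1 -/x2 -/w1 -/w2 -/w; field.
  exact: n2.
have [c0|c0] := leP 0 c.
  apply/esym; apply: f1.2; first by case: f2.
  move=> z Gz; have [Fz zz1] := (zeq1 z).1 Gz; apply/zeq2; split=> //.
  have := rel z Fz; rewrite zz1 mulr0 => /esym/eqP.
  rewrite paddr_eq0 ?mulr_ge0 ?ge2 ?ge0 ?(ltW p1) // => /andP[].
  by rewrite mulf_eq0 (gt_eqF p1) => /eqP.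
apply: f2.2; first by case: f1.
move=> z Gz; have [Fz zz2] := (zeq2 z).1 Gz; apply/zeq1; split=> //.
have := rel z Fz; rewrite zz2 mulr0 add0r => /eqP; rewrite -subr_eq0 -mulNr.
rewrite paddr_eq0 ?mulr_ge0 ?ge1 ?ge0 ?(ltW p2) // ?oppr_ge0 ?ltW // => /andP[].
by rewrite mulf_eq0 (gt_eqF p2) => /eqP.
Qed.

End Diamond.
End Polytopes.

(** * Chains of faces in a polytopal complex *)

Section Complex.
Variables (R : realType) (t : nat) (Delta : set (set 'rV[R]_t)) (n : nat).
Variable e : 'I_n -> set 'rV[R]_t.
Local Notation V := 'rV[R]_t.
Local Notation cell := ({set 'I_n} * {set 'I_n})%type.
Local Notation c00 := (c00 n).
Hypotheses (hD : polytopal_complex Delta) (he : labels_nonempty_faces Delta e).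
Implicit Types (P F G H : set V) (C : set (set V)) (T : {set 'I_n}) (i j g h : 'I_n).

Lemma D_polytope P : Delta P -> polytope P. Proof. by case: hD => _ _ h _ _; apply: h. Qed.

Lemma D_face P G : Delta P -> face G P -> Delta G.
Proof. by case: hD => _ _ _ h _; apply: h. Qed.

Lemma D_faceI P Q : Delta P -> Delta Q -> face (setI P Q) P.
Proof. by case: hD => _ _ _ _ h hP hQ; case: (h P Q). Qed.

Lemma D_sub P G : Delta P -> Delta G -> subset G P -> face G P.
Proof. by move=> hP hG /setIidPr <-; apply: D_faceI. Qed.

Lemma e_inj : injective e. Proof. by case: he. Qed.

Lemma eD i : Delta (e i).
Proof. by have [] := (he.2 (e i)).2 (ex_intro _ i erefl). Qed.

Lemma e_ex i : exists x, e i x.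
Proof. by have [_ [x ?]] := (he.2 (e i)).2 (ex_intro _ i erefl); exists x. Qed.

Lemma label P : Delta P -> (exists x, P x) -> exists i, P = e i.
Proof.
move=> hP [x Px]; have [i <-] := (he.2 P).1 (conj hP (ex_intro _ x Px)).
by exists i.
Qed.

Lemma bdE F G : Delta F -> boundary F G <-> [/\ Delta G, subset G F & G <> F].
Proof.
move=> hF; split=> [[fG ne]|[hG sG ne]]; last by split=> //; apply: D_sub.
by split=> //; [apply: D_face fG | apply: face_sub].
Qed.

Definition dcl C := (forall P, C P -> Delta P) /\
  (forall P G, C P -> Delta G -> subset G P -> C G).

Lemma dcl_bd F : Delta F -> dcl (boundary F).
Proof.
move=> hF; split=> [P /(bdE _ hF)[]//|P G /(bdE _ hF)[hP sP ne] hG sG].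
apply/(bdE _ hF); split=> //; first by move=> x /sG /sP.
by move=> eG; apply: ne; apply/seteqP; split=> // x; rewrite -eG => /sG.
Qed.

Lemma dcl_Delta : dcl Delta. Proof. by []. Qed.

Definition le i j := `[< subset (e i) (e j) >].

Lemma leP' i j : reflect (subset (e i) (e j)) (le i j). Proof. exact: asboolP. Qed.
Lemma le_refl i : le i i. Proof. by apply/leP' => x. Qed.
Lemma le_tr i j k : le i j -> le j k -> le i k.
Proof. by move=> /leP' h1 /leP' h2; apply/leP' => x /h1 /h2. Qed.
Lemma le_anti i j : le i j -> le j i -> i = j.
Proof. by move=> /leP' h1 /leP' h2; apply: e_inj; apply/seteqP. Qed.

(** The size of the down-set serves as a rank: it is strictly increasing, so facets and tops of
    chains are found by maximising it. *)
Definition down i := [set k | le k i]%SET.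

Lemma down_max i j : le i j -> (#|down j| <= #|down i|)%N -> i = j.
Proof.
move=> ij h; have : down i == down j.
  by rewrite finset.eqEcard h andbT; apply/fintype.subsetP => k; rewrite !finset.in_set => ki; apply: le_tr ki ij.
move/eqP/setP/(_ j); rewrite !finset.in_set le_refl => ji.
exact: le_anti.
Qed.

Lemma facet_ex C G : (forall P, C P -> Delta P) -> C G -> (exists x, G x) ->
  exists2 g, facet C (e g) & subset G (e g).
Proof.
move=> CD CG exG; have [i ei] := label (CD _ CG) exG.
pose P j := `[< C (e j) /\ le i j >].
have Pi : P i by apply/asboolP; rewrite -ei; split=> //; apply: le_refl.
have [j /asboolP[Cj ij] mj] := arg_maxnP (fun j => #|down j|) Pi.
exists j; last by rewrite ei; apply/leP'.
split=> // G' CG' sG'.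
have [l el] : exists l, G' = e l.
  by apply: label; [apply: CD | have [x jx] := e_ex j; exists x; apply: sG'].
rewrite el; congr e; apply/esym; apply: down_max; first by apply/leP'; rewrite -el.
by apply: mj; apply/asboolP; rewrite -el; split=> //; apply: le_tr ij _; apply/leP'; rewrite -el.
Qed.

Lemma facet_label C k G : (forall P, C P -> Delta P) -> pure_dim C k -> facet C G ->
  exists g, G = e g.
Proof.
move=> CD pk fG; have [h hP _] := has_dim_free (pk _ fG).
by apply: label; [apply: CD; case: fG | exists (h 0%N); apply: hP].
Qed.

Definition chain T := [forall i in T, forall j in T, le i j || le j i].

Lemma chainP T : reflect (forall i j, i \in T -> j \in T -> le i j || le j i) (chain T).
Proof.
apply: (iffP forall_inP) => [h i j iT jT|h i iT]; last by apply/forall_inP => j; apply: h.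
exact: (forall_inP (h i iT)).
Qed.

Lemma chain_sub T T' : T' \subset T -> chain T -> chain T'.
Proof. by move=> /fintype.subsetP sT /chainP h; apply/chainP => i j /sT iT /sT; apply: h. Qed.

Lemma chainU1 g T : chain T -> (forall i, i \in T -> le i g) -> chain (g |: T).
Proof.
move=> /chainP cT hg; apply/chainP => i j; rewrite !inE.
move=> /orP[/eqP->|iT] /orP[/eqP->|jT]; rewrite ?le_refl ?hg ?orbT //.
exact: cT.
Qed.

Lemma chain_top T : chain T -> T != finset.set0 -> exists2 h, h \in T & forall i, i \in T -> le i h.
Proof.
move=> /chainP cT /finset.set0Pn[i0 i0T].
have [h hT mh] := arg_maxnP (fun j => #|down j|) i0T.
exists h => // i iT; have /orP[//|hi] := cT i h iT hT.
by rewrite (down_max hi) ?le_refl //; apply: mh.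
Qed.

Lemma dim0_point G x y : has_dim G 0 -> G x -> G y -> x = y.
Proof.
move=> dG Gx Gy; pose h (i : nat) := if i is 0%N then x else y.
have [u [i i2 ui] [s0 s1]] : exists2 u : nat -> R, (exists2 i : nat, (i < 2)%N & u i != 0) &
    \sum_(i < 2) u i = 0 /\ \sum_(i < 2) u i *: h i = 0.
  by apply: has_dim_dep dG _ => -[|i] _.
move: s0 s1; rewrite !big_ord_recl !big_ord0 /= !addr0 => /eqP.
rewrite addr_eq0 => /eqP e0; rewrite e0 scaleNr addrC => /eqP; rewrite subr_eq0 => /eqP e1.
have u1 : u 1%N != 0.
  apply: contraNneq ui => u1; case: i i2 => [|[|//]] _; last by rewrite u1.
  by rewrite e0 u1 oppr0.
by have := congr1 (fun v => (u 1%N)^-1 *: v) e1; rewrite !scalerA mulVf // !scale1r => ->.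
Qed.

Lemma shelling_pure k C L : shelling k C L -> pure_dim C k.
Proof. by case: k => [|k] []. Qed.

Lemma shelling_facets k C L : shelling k C L -> lists_facets C L.
Proof. by case: k => [|k] []. Qed.

Lemma shelling_bd k C L G : shelling k.+1 C L -> facet C G ->
  exists M, shelling k (boundary G) M.
Proof.
move=> [_ [_ lf] [h0 hj]] /lf[[|j] jL ->] //.
by have [_ [M [r [hM _ _]]]] := hj j.+1 jL; exists M.
Qed.

(** Removing a facet [g] above the chain leaves a chain in the boundary of [g], which is shelled one
    dimension lower. The purity built into shellings thus does the work of comparing the dimensions
    of faces; at the bottom, a face of dimension 0 is a point. *)
Lemma chain_bound k C L T : dcl C -> shelling k C L -> chain T ->
  (forall i, i \in T -> C (e i)) -> (#|T| <= k.+1)%N.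
Proof.
elim: k C L T => [|k IH] C L T dC sC cT CT.
  all: have [->|T0] := eqVneq T finset.set0; first by rewrite cards0.
  all: have [h hT th] := chain_top cT T0.
  all: have [g fg hg] := facet_ex dC.1 (CT h hT) (e_ex h).
  have dg : has_dim (e g) 0 by apply: (shelling_pure sC).
  rewrite -(cards1 g); apply/subset_leq_card/fintype.subsetP => i iT; rewrite inE; apply/eqP.
  have ig : subset (e i) (e g) by move=> x ix; apply: hg; have /leP' := th i iT; apply.
  apply: e_inj; apply/seteqP; split=> // x gx.
  by have [y iy] := e_ex i; rewrite (dim0_point dg gx (ig _ iy)).
have [M sM] := shelling_bd sC fg.
have := IH _ _ (T :\ g) (dcl_bd (eD g)) sM (chain_sub (finset.subD1set _ _) cT).
rewrite (cardsD1 g T) => H; case: (g \in T); rewrite ?add1n ?ltnS ?add0n; last apply: leqW; apply: H.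
all: move=> i; rewrite !inE => /andP[ig iT]; apply/(bdE _ (eD g)); split; first exact: eD.
all: try by move=> x ix; apply: hg; have /leP' := th i iT; apply.
all: by move=> /e_inj E; rewrite E eqxx in ig.
Qed.

(** A facet above [h] and different from it would extend the chain beyond [chain_bound]. *)
Lemma top_facet k C L T h : dcl C -> shelling k C L -> chain T ->
  (forall i, i \in T -> C (e i)) -> #|T| = k.+1 -> h \in T ->
  (forall i, i \in T -> le i h) -> facet C (e h).
Proof.
move=> dC sC cT CT Tk hT th.
have [g fg hg] := facet_ex dC.1 (CT h hT) (e_ex h).
have [<- //|gh] := eqVneq g h.
have gT : g \notin T.
  by apply: contraNN gh => gT; apply/eqP/le_anti; [apply: th | apply/leP'].
have := @chain_bound k C L (g |: T) dC sC; rewrite cardsU1 gT Tk ltnn => H.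
suff : false by []; apply: H.
  by apply: chainU1 => // i iT; apply: le_tr (th i iT) _; apply/leP'.
by move=> i; rewrite !inE => /orP[/eqP->|/CT//]; case: fg.
Qed.

(** The facets of the barycentric subdivision of the boundary of [F], when that boundary has
    dimension [k]. *)
Definition fl F k := [set S : {set 'I_n} | [&& chain S, #|S| == k.+1 &
  [forall i in S, `[< boundary F (e i) >]]]]%SET.

Lemma flP F k (S : {set 'I_n}) : reflect [/\ chain S, #|S| = k.+1 &
  forall i, i \in S -> boundary F (e i)] (S \in fl F k).
Proof.
rewrite finset.in_set; apply: (iffP and3P) => -[h1 h2 h3]; split=> //; try exact/eqP.
  by move=> i iS; apply/asboolP; apply: (forall_inP h3).
by apply/forall_inP => i iS; apply/asboolP/h3.
Qed.


Lemma boundary_facets F G : Delta F -> boundary F G -> (exists x, G x) ->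
  exists2 G', facet (boundary F) G' & subset G G'.
Proof.
move=> hF bG exG; have [g fg sg] := facet_ex (dcl_bd hF).1 bG exG.
by exists (e g).
Qed.

(* The facets through a ridge chain [T] with no member of maximal dimension
   correspond to the two facets of [F] through the largest member [H] of [T]. *)
Lemma two_facets k F L T g0 H (h : nat -> V) : Delta F -> has_dim F k.+1 ->
  shelling k (boundary F) L -> #|T| = k -> chain T ->
  (forall i, i \in T -> ~ facet (boundary F) (e i)) ->
  facet (boundary F) (e g0) -> face H F -> subset H (e g0) -> H <> e g0 ->
  (forall i : nat, (i < k)%N -> H (h i)) -> aff_free k h ->
  (forall g, (forall i, i \in T -> le i g) <-> subset H (e g)) ->
  #|[set S in fl F k | T \subset S]%SET| = 2.
Proof.
move=> hF dF sF Tk cT nfT fg0 fH sH nH hH hfree HT.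
have dB := dcl_bd hF; have bF G := @boundary_facets F G hF.
have [G1 [fG1 nG1 sG1]] := diamond_ex (D_polytope hF) bF fg0 fH sH nH.
have [g1 eg1] := facet_label dB.1 (shelling_pure sF) fG1.
rewrite {}eg1 in fG1 nG1 sG1.
have g01 : g0 != g1 by apply: contra_notN nG1 => /eqP ->.
have gT g : facet (boundary F) (e g) -> g \notin T.
  by move=> fg; apply/negP => /nfT.
have inF g : facet (boundary F) (e g) -> subset H (e g) -> g |: T \in fl F k.
  move=> fg sg; have tg := (HT g).2 sg; apply/flP; split.
  - exact: chainU1.
  - by rewrite cardsU1 gT // Tk.
  move=> i; rewrite finset.in_setU1 => /orP[/eqP->|iT]; first by case: fg.
  by apply: dB.2 (eD i) _; [case: fg => bg _; exact: bg | apply/leP'/tg].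
suff -> : [set S in fl F k | T \subset S]%SET = [set g0 |: T; g1 |: T]%SET.
  rewrite finset.cards2 (_ : _ != _) //; apply: contraNneq g01 => /setP/(_ g0).
  by rewrite !finset.in_setU1 eqxx (negbTE (gT _ fg0)) !orbF => <-.
apply/setP => S; rewrite finset.in_set finset.in_set2.
apply/andP/orP => [[SF TS]|[]/eqP->]; first last.
- by split; [apply: inF | apply: finset.subsetUr].
- by split; [apply: inF | apply: finset.subsetUr].
have [cS Sk bS] := flP _ _ _ SF.
have Sn : S != finset.set0 by rewrite -card_gt0 Sk.
have [g gS tg] := chain_top cS Sn.
have fg := top_facet dB sF cS bS Sk gS tg.
have eS : S = g |: T.
  apply/esym/eqP; rewrite finset.eqEcard finset.subUset finset.sub1set gS TS cardsU1 gT // Tk Sk.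
  by rewrite add1n leqnn.
have sg : subset H (e g) by apply/HT => i iT; apply: tg; apply: (fintype.subsetP TS).
have [e0|n0] := eqVneq g g0; first by left; rewrite eS e0.
right; rewrite eS; apply/eqP; congr (_ |: _); apply: e_inj.
apply: (diamond_uniq dF fg0 fH sH nH hH hfree fg fG1 _ nG1 sg sG1).
by move=> /e_inj E; rewrite E eqxx in n0.
Qed.

(** If [T] contains a facet [g] of [F], dropping it reduces the claim to the boundary of [g].
    Otherwise, if [T] extends to a full chain, it lacks just the top member, and the diamond
    property at the largest member of [T] leaves two choices. *)
Lemma pseudomanifold k F L T : Delta F -> has_dim F k.+1 ->
  shelling k (boundary F) L -> #|T| = k ->
  #|[set S in fl F k | T \subset S]%SET| \in [:: 0%N; 2].
Proof.
elim: k F L T => [|k IH] F L T hF dF sF Tk.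
  have [->|/finset.set0Pn[S0]] := eqVneq [set S in fl F 0 | T \subset S]%SET finset.set0.
    by rewrite cards0.
  rewrite finset.in_set => /andP[/flP[cS0 S0k bS0] TS0].
  have S0n : S0 != finset.set0 by rewrite -card_gt0 S0k.
  have [g0 g0S tg0] := chain_top cS0 S0n.
  have fg0 := top_facet (dcl_bd hF) sF cS0 bS0 S0k g0S tg0.
  have T0 : T = finset.set0 by apply: cards0_eq.
  (* For [k = 0] the diamond is taken at the empty face: [F] has dimension 1, and the two facets are
     its end points. *)
  have D0 : face set0 F.
    exists 0, 1; split=> [x _|]; first by rewrite -(scale0r 0) dotvZl mul0r ler01.
    apply/seteqP; split=> x //= -[_]; rewrite -(scale0r 0) dotvZl mul0r => /eqP.
    by rewrite eq_sym oner_eq0.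
  rewrite (@two_facets 0%N F L T g0 set0 (fun=> 0)) //.
  - by rewrite T0; apply/chainP => i j; rewrite finset.in_set0.
  - by move=> i; rewrite T0 finset.in_set0.
  - by move=> E; have [x] := e_ex g0; rewrite -E.
  - by move=> g; split=> [_ x []|_ i]; rewrite T0 finset.in_set0.
have [->|/finset.set0Pn[S0]] := eqVneq [set S in fl F k.+1 | T \subset S]%SET finset.set0.
  by rewrite cards0.
rewrite finset.in_set => /andP[/flP[cS0 S0k bS0] TS0].
have dB := dcl_bd hF.
have S0n : S0 != finset.set0 by rewrite -card_gt0 S0k.
have [g0 g0S tg0] := chain_top cS0 S0n.
have fg0 := top_facet dB sF cS0 bS0 S0k g0S tg0.
have cT := chain_sub TS0 cS0.
have [[g [gT fg]]|nf] := pselect (exists g, g \in T /\ facet (boundary F) (e g)).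
  have [M sM] := shelling_bd sF fg.
  have Tg : #|T :\ g| = k by have := cardsD1 g T; rewrite gT Tk add1n => -[].
  suff -> : #|[set S in fl F k.+1 | T \subset S]%SET| =
      #|[set S in fl (e g) k | T :\ g \subset S]%SET|.
    exact: (IH (e g) M (T :\ g) (eD g) ((shelling_pure sF) _ fg) sM Tg).
  have inj : {in [set S in fl (e g) k | T :\ g \subset S]%SET &,
      injective (fun S => g |: S)}.
    have gN S : S \in fl (e g) k -> g \notin S.
      by move=> /flP[_ _ bS]; apply/negP => /bS[].
    move=> S S'; rewrite finset.in_set => /andP[/gN gS _].
    rewrite finset.in_set => /andP[/gN gS' _] E.
    by rewrite -(finset.setU1K gS) E finset.setU1K.
  rewrite -(card_in_imset inj); apply: eq_card => S.
  rewrite finset.in_set; apply/andP/finset.imsetP => [[/flP[cS Sk bS] TS]|[S']].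
    have gS : g \in S := fintype.subsetP TS _ gT.
    exists (S :\ g); last by rewrite finset.setD1K.
    rewrite finset.in_set finset.setSD // andbT; apply/flP; split.
    - by apply: chain_sub cS; apply: finset.subD1set.
    - by have := cardsD1 g S; rewrite gS Sk add1n => -[].
    move=> i; rewrite finset.in_setD1 => /andP[ig iS]; apply/(bdE _ (eD g)); split.
    - exact: eD.
    - have /orP[/leP'//|/leP' gi] := chainP _ cS i g iS gS.
      by rewrite (fg.2 _ (bS i iS) gi).
    by move=> /e_inj E; rewrite E eqxx in ig.
  rewrite finset.in_set => /andP[/flP[cS Sk bS] TS] ->; split.
    have gS : g \notin S' by apply/negP => /bS[].
    apply/flP; split.
    - apply: chainU1 => // i /bS /(bdE _ (eD g))[_ ? _]; exact/leP'.
    - by rewrite cardsU1 gS Sk.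
    move=> i; rewrite finset.in_setU1 => /orP[/eqP->|/bS /(bdE _ (eD g))[h1 h2 _]].
      by case: fg.
    by apply: dB.2 h1 h2; case: fg.
  by rewrite -(finset.setD1K gT) finset.setUS.
have nfT i : i \in T -> ~ facet (boundary F) (e i).
  by move=> iT fi; apply: nf; exists i.
have Tn : T != finset.set0 by rewrite -card_gt0 Tk.
have [h hT th] := chain_top cT Tn.
have [M sM] := shelling_bd sF fg0.
have bT i : i \in T -> boundary (e g0) (e i).
  move=> iT; apply/(bdE _ (eD g0)); split; first exact: eD.
    by apply/leP'/tg0; apply: (fintype.subsetP TS0).
  by move=> E; apply: (nfT i iT); rewrite E.
have fh := top_facet (dcl_bd (eD g0)) sM cT bT Tk hT th.
have [hp hpP hpf] := has_dim_free ((shelling_pure sM) _ fh).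
have hg0 := bT h hT.
rewrite (@two_facets k.+1 F L T g0 (e h) hp) //.
- by apply: D_sub => //; [apply: eD | move/(bdE _ hF): (bS0 h (fintype.subsetP TS0 _ hT)) => -[]].
- by move/(bdE _ (eD g0)): hg0 => -[].
- by case: hg0.
move=> g; split=> [tg|/leP' hg i iT]; first exact/leP'/tg.
exact: le_tr (th i iT) hg.
Qed.

End Complex.

(** * Subdividing a shelling *)

Section ListFacts.
Variable n : nat.
Local Notation cell := ({set 'I_n} * {set 'I_n})%type.
Implicit Types (s : seq cell) (T : {set 'I_n}).

Lemma inS_flatten (ss : seq (seq cell)) T :
  inS (flatten ss) T <-> exists2 j, (j < size ss)%N & inS (nth [::] ss j) T.
Proof.
elim: ss => [|s ss IH] /=; first by split=> // -[].
rewrite inS_cat; split=> [/orP[h|/IH[j js h]]|[[|j] js h]]; first by exists 0%N.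
- by exists j.+1.
- by rewrite h.
by apply/orP; right; apply/IH; exists j.
Qed.

Lemma shell_uniq s : shell s -> uniq (map fst s).
Proof.
elim/last_ind: s => [|s c IH] // /shell_rcons[sh cc hT].
rewrite map_rcons rcons_uniq IH // andbT; apply/negP => /mapP[c' cs E].
have := hT c.1 (subxx _); rewrite cc => /negbT/negP; apply.
by apply/hasP; exists c' => //; rewrite E.
Qed.

End ListFacts.

Section Induction.
Variables (R : realType) (t : nat) (Delta : set (set 'rV[R]_t)) (n : nat).
Variable e : 'I_n -> set 'rV[R]_t.
Local Notation V := 'rV[R]_t.
Local Notation cell := ({set 'I_n} * {set 'I_n})%type.
Local Notation c00 := (c00 n).
Local Notation chain := (chain e).
Local Notation le := (le e).
Local Notation dcl := (dcl Delta).
Hypotheses (hD : polytopal_complex Delta) (he : labels_nonempty_faces Delta e).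
Implicit Types (P F G H : set V) (C : set (set V)) (T : {set 'I_n}) (i g h : 'I_n).

(** Two points of [F] differ in some coordinate; the points of [F] where it is maximal form a proper
    nonempty face. *)
Lemma boundary_ex k F : Delta F -> has_dim F k.+1 ->
  exists2 G, boundary F G & exists x, G x.
Proof.
move=> hF dF; have [h hP hf] := has_dim_free dF.
have ne : h 0%N != h 1%N.
  apply/eqP => E; pose u (i : nat) : R := if i is 0%N then 1 else if i is 1%N then -1 else 0.
  have := hf u; rewrite !big_ord_recl /= E scale1r scaleN1r.
  rewrite !big1; [|by move=> i _; rewrite scale0r|by []].
  rewrite !addr0 !subrr => /(_ erefl erefl 0%N isT)/eqP.
  by rewrite oner_eq0.
have [S eF] := D_polytope hD hF.
have [c nc] : exists c, h 0%N 0 c != h 1%N 0 c.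
  apply/existsP; apply: contraNT ne => /existsPn E; apply/eqP/rowP => c.
  by apply/eqP/negPn/E.
have dc x : dotv (delta_mx 0 c : V) x = x 0 c.
  rewrite /dotv (bigD1 c) //= mxE !eqxx mul1r big1 ?addr0 // => i ic.
  by rewrite mxE (negbTE ic) mul0r.
have S0 : (0 < size S)%N.
  have := hP 0%N isT; rewrite eF => -[w [_ w1 _]].
  by case: (S) w w1 => // w; rewrite big_ord0 => /eqP; rewrite eq_sym oner_eq0.
have [im _ mi] := arg_maxP (fun i : 'I_(size S) => S`_i 0 c) (isT : predT (Ordinal S0)).
pose a : V := delta_mx 0 c; pose b := S`_im 0 c.
have le_b x : F x -> dotv a x <= b.
  rewrite eF => /(conv_aff a b)[w w0 E]; rewrite -subr_ge0 E.
  by apply: sumr_ge0 => i _; rewrite mulr_ge0 // subr_ge0 dc; apply: mi.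
exists [set x | F x /\ dotv a x = b]%classic; last first.
  by exists S`_im; split; [rewrite eF; apply: conv_in | rewrite dc].
split; first by exists a, b.
move=> E; case/eqP: nc; rewrite -!dc.
have : [set x | F x /\ dotv a x = b]%classic (h 0%N) by rewrite E; apply: hP.
have : [set x | F x /\ dotv a x = b]%classic (h 1%N) by rewrite E; apply: hP.
by move=> [_ ->] [_ ->].
Qed.

Lemma has_dim_uniq F k k' : has_dim F k -> has_dim F k' -> k = k'.
Proof.
wlog lt : k k' / (k < k')%N => [H d d'|d d'].
  by case: (ltngtP k k') => // h; [apply: H | apply/esym; apply: H].
have [h hP hf] := has_dim_free d'.
have [|u [i ik ui] [s0 s1]] := @has_dim_dep _ _ _ _ h d.
  by move=> i ik; apply: hP; apply: leq_trans ik _.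
pose v (i : nat) := if (i < k.+2)%N then u i else 0.
have ext (W : lmodType R) (x : nat -> W) :
    \sum_(i < k'.+1) (if (i < k.+2)%N then x i else 0) = \sum_(i < k.+2) x i.
  by rewrite -big_mkcond /= -(big_ord_widen k'.+1 x (lt : (k.+2 <= k'.+1)%N)).
have v0 : \sum_(i < k'.+1) v i = 0 by rewrite (ext R^o u).
have v1 : \sum_(i < k'.+1) v i *: h i = 0.
  rewrite -[RHS]s1 -(ext _ (fun i : nat => u i *: h i)); apply: eq_bigr => j _.
  by rewrite /v; case: ifP => // _; rewrite scale0r.
by have := hf v v0 v1 i (leq_trans ik (lt : (k.+2 <= k'.+1)%N)); rewrite /v ik => E; rewrite E eqxx in ui.
Qed.

Lemma sphere_of k F L s : Delta F -> has_dim F k.+1 -> shelling k (boundary F) L ->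
  shell s -> (forall c, c \in s -> #|c.1| = k.+1) ->
  (forall T, inS s T <-> chain T /\ forall i, i \in T -> boundary F (e i)) ->
  sphere k.+1 s.
Proof.
move=> hF dF sF sh sk cov; split=> // T [Tk].
suff -> : count (fun c : cell => T \subset c.1) s =
    #|[set S in fl e F k | T \subset S]%SET|.
  exact: (pseudomanifold hD he hF dF sF Tk).
rewrite -(count_map fst (fun S : {set 'I_n} => T \subset S)) -size_filter.
have uf : uniq [seq S : {set 'I_n} <- map fst s | T \subset S].
  by rewrite filter_uniq // shell_uniq.
rewrite -(card_uniqP uf); apply: eq_card => S.
rewrite finset.in_set mem_filter andbC; congr (_ && _).
apply/idP/idP => [/mapP[c cs ->]|/flP[cS Sk bS]].
  have [h1 h2] : chain c.1 /\ forall i, i \in c.1 -> boundary F (e i).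
    by apply/cov/hasP; exists c.
  by apply/flP; split=> //; apply: sk.
have /hasP[c cs Sc] : inS s S by apply/cov.
apply/mapP; exists c => //; apply/eqP; rewrite finset.eqEcard Sc Sk.
by have /= -> := sk c cs.
Qed.

(* The cells of [nth [::] ss j] subdivide the [j]-th facet. *)
Definition subdivided k (L : seq (set V)) (ss : seq (seq cell)) :=
  [/\ size ss = size L,
      forall c, c \in flatten ss -> #|c.1| = k.+1,
      forall j, (j < size L)%N -> forall T, inS (nth [::] ss j) T <->
        chain T /\ forall i, i \in T -> subset (e i) (nth set0 L j),
      shell (flatten ss) &
      forall j, (j <= size L)%N -> almostL k.+1 (flatten (take j ss))].

(** The subdivided boundary of the [j]-th facet, with [sG] the initial part of its shelling that is
    shared with the earlier facets: the data needed by [shell_join] and [almostL_join]. *)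
Definition child k (L : seq (set V)) (j : nat) (sG sN : seq cell) :=
  [/\ sphere k (sG ++ sN),
      forall T, inS (sG ++ sN) T <->
        chain T /\ forall i, i \in T -> boundary (nth set0 L j) (e i),
      forall T, inS sG T <-> [/\ chain T,
        forall i, i \in T -> boundary (nth set0 L j) (e i) &
        exists2 j0, (j0 < j)%N & forall i, i \in T -> subset (e i) (nth set0 L j0)] &
      almostL k sG].

Lemma subdivide k C L : dcl C -> pure_dim C k -> lists_facets C L ->
  (forall j, (j < size L)%N -> exists sG sN, child k L j sG sN) ->
  exists ss, subdivided k L ss.
Proof.
move=> dC pC [Linj Lf] ch.
suff H m : (m <= size L)%N -> exists ss, subdivided k (take m L) ss.
  by have [//|ss] := H (size L); rewrite take_size => hss; exists ss.
elim: m => [|m IH] mL.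
  exists [::]; rewrite take0; split=> //; try by move=> [].
  by move=> [|?] //= _; apply: almostL_nil.
have [ss [hs h1 h2 h3 h4]] := IH (ltnW mL).
have [sG [sN [sph cov pre LG]]] := ch m mL.
have fm : facet C (nth set0 L m) by apply/Lf; exists m.
have [f ef] := facet_label he dC.1 pC fm.
have hF : Delta (nth set0 L m) by apply: dC.1; case: fm.
have szt : size (take m L) = m by rewrite size_takel // ltnW.
have ntt j : (j < m)%N -> nth set0 (take m L) j = nth set0 L j by move=> jm; rewrite nth_take.
rewrite szt in hs h2 h4.
pose s1 := flatten ss; pose x := coneR f sG ++ cone f sN.
have cov1 T : inS s1 T <-> exists2 j, (j < m)%N &
    chain T /\ forall i, i \in T -> subset (e i) (nth set0 L j).
  rewrite inS_flatten hs; split=> [[j jm /(h2 j jm)]|[j jm h]].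
    by rewrite ntt // => h; exists j.
  exists j => //.
  by apply/(h2 j jm); rewrite ntt.
have avc : avoids f (sG ++ sN).
  move=> c cs; apply/negP => fc.
  have [_ h] : chain c.1 /\ forall i, i \in c.1 -> boundary (nth set0 L m) (e i).
    by apply/cov/hasP; exists c.
  by case: (h f fc) => _; rewrite ef.
(* The apex is a new vertex: a facet contained in an earlier one would be equal to it. *)
have av1 : avoids f s1.
  move=> c cs; apply/negP => fc.
  have /cov1[j jm [_ h]] : inS s1 c.1 by apply/hasP; exists c.
  have fj : facet C (nth set0 L j) by apply/Lf; exists j => //; apply: ltn_trans mL.
  have E : nth set0 L j = nth set0 L m.
    by apply: fm.2; [case: fj | rewrite ef; apply: h].
  have := Linj j m (ltn_trans jm mL) mL E => jm'.
  by rewrite jm' ltnn in jm.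
have [shc ck _] := sph.
have shj : shell (s1 ++ x).
  apply: shell_join => // T fT /cov[cT bT].
  apply/idP/idP => [/cov1[j jm [_ h]]|/pre[_ _ [j jm h]]].
    by apply/pre; split=> //; exists j.
  by apply/cov1; exists j.
have s1k c : c \in s1 -> #|c.1| = k.+1 by apply: h1.
exists (rcons ss x); rewrite (take_nth set0 mL).
have fl1 : flatten (rcons ss x) = s1 ++ x by rewrite -cats1 flatten_cat /= cats0.
have [avG avN] := (avoids_cat f sG sN).1 avc.
split.
- by rewrite !size_rcons hs szt.
- move=> c; rewrite fl1 mem_cat => /orP[/s1k//|]; rewrite mem_cat => /orP[]/mapP[c' cs ->] /=.
    by rewrite cardsU1 avG // ck // mem_cat cs.
  by rewrite cardsU1 avN // ck // mem_cat cs orbT.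
- move=> j; rewrite size_rcons szt ltnS leq_eqVlt => /orP[/eqP->|jm] T.
    rewrite !nth_rcons hs szt ltnn eqxx.
    rewrite inS_cat inS_coneR inS_cone -inS_cat; split=> [/cov[cT bT]|[cT sT]].
      have sT i : i \in T -> subset (e i) (nth set0 L m).
        move=> iT; have [->|ne] := eqVneq i f; first by rewrite ef.
        by have /(bdE hD _ hF)[] := bT i (ltac:(by rewrite finset.in_setD1 ne)).
      split=> //; case: (boolP (f \in T)) => fT; last by rewrite -(setD1_id fT).
      rewrite -(finset.setD1K fT); apply: chainU1 => // i /bT /(bdE hD _ hF)[_ h _].
      by apply/leP'; rewrite -ef.
    apply/cov; split; first by apply: chain_sub cT; apply: finset.subD1set.
    move=> i; rewrite finset.in_setD1 => /andP[ne iT]; apply/(bdE hD _ hF); split.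
    - exact: (eD he).
    - exact: sT.
    by rewrite ef => /(e_inj he) E; rewrite E eqxx in ne.
  by rewrite !nth_rcons hs szt jm; apply: h2.
- by rewrite fl1.
move=> j; rewrite size_rcons szt leq_eqVlt => /orP[/eqP->|jm].
  rewrite -hs take_oversize ?size_rcons // fl1.
  apply: (almostL_join f s1k shj avc sph LG).
  by have := h4 m (leqnn m); rewrite -hs take_size.
by rewrite -cats1 takel_cat ?hs //; apply: h4.
Qed.

Lemma child0 C L j : dcl C -> pure_dim C 0 -> lists_facets C L -> (j < size L)%N ->
  exists sG sN, child 0 L j sG sN.
Proof.
move=> dC pC [Linj Lf] jL.
have fj : facet C (nth set0 L j) by apply/Lf; exists j.
have hF : Delta (nth set0 L j) by apply: dC.1; case: fj.
have dF := pC _ fj.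
have nb T : (forall i, i \in T -> boundary (nth set0 L j) (e i)) -> T = finset.set0.
  move=> bT; apply/eqP; apply: contraT => /finset.set0Pn[i iT].
  have /(bdE hD _ hF)[_ sI []] := bT i iT.
  apply/seteqP; split=> // x Fx; have [y iy] := e_ex he i.
  by rewrite (dim0_point dF Fx (sI _ iy)).
have c0 : chain finset.set0 by apply/chainP => i i'; rewrite finset.in_set0.
have cov T : inS [:: c00] T <->
    chain T /\ forall i, i \in T -> boundary (nth set0 L j) (e i).
  rewrite /inS /= orbF finset.subset0; split=> [/eqP->|[_ /nb ->]] //.
  by split=> // i; rewrite finset.in_set0.
have sh0 : shell [:: c00].
  move=> [|c1 [|? ?]] c s2 // [<- _]; split=> [|T]; first exact: finset.sub0set.
  by rewrite /= finset.sub0set.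
have sph : sphere 0 [:: c00].
  by split=> // c; rewrite inE => /eqP ->; rewrite cards0.
(* The boundary of a point consists of the empty face, which is already present unless the point is
   the first facet. *)
exists (if (0 < j)%N then [:: c00] else [::]), (if (0 < j)%N then [::] else [:: c00]).
rewrite /child; have -> : (if (0 < j)%N then [:: c00] else [::]) ++ (if (0 < j)%N then [::] else [:: c00]) =
   [:: c00] by case: ifP.
split=> //.
  move=> T; split=> [|[cT bT [j0 j0j _]]].
    case: ifP => // j0 /cov[cT bT]; split=> //; exists 0%N => // i.
    by rewrite (nb T bT) finset.in_set0.
  by rewrite (leq_ltn_trans (leq0n _) j0j); apply/cov.
Qed.

(** The definition of a shelling gives the intersection with the earlier facets as a union of sets.
    [polytope_cover], applied in both directions, converts this into a statement about faces: a face
    inside either union lies in a single member. *)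
Lemma childS k C L j : dcl C -> shelling k.+1 C L -> (j < size L)%N ->
  (forall C L, dcl C -> shelling k C L -> exists ss, subdivided k L ss) ->
  exists sG sN, child k.+1 L j sG sN.
Proof.
move=> dC sC jL IH; have [pC [Linj Lf] [h0 hj]] := sC.
have fj : facet C (nth set0 L j) by apply/Lf; exists j.
have hF : Delta (nth set0 L j) by apply: dC.1; case: fj.
have dF := pC _ fj; set F := nth set0 L j in fj hF dF *.
have Lj (i0 : nat) : (i0 < size L)%N -> Delta (nth set0 L i0).
  by move=> h; apply: dC.1; have [] := (Lf (nth set0 L i0)).2 (ex_intro2 _ _ i0 h erefl).
have [M [r [sM rM U]]] : exists M r, [/\ shelling k (boundary F) M, (r <= size M)%N &
    ((0 < j)%N -> (0 < r)%N) /\ forall x,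
    (exists2 l : nat, (l < r)%N & nth set0 M l x) <->
    (F x /\ exists2 i0 : nat, (i0 < j)%N & nth set0 L i0 x)].
  (* Nothing precedes the first facet, so its initial part is empty and [r = 0]. *)
  case: (posnP j) => [j0|jp].
    have [M sM] := h0; exists M, 0%N; rewrite /F j0; split=> //; split=> // x.
    by split=> -[] // _ [].
  have [_ [M [r [sM /andP[r1 rM] U]]]] := hj j (ltac:(by rewrite jp jL)).
  exists M, r; split=> //; split=> // x; have := congr1 (fun A : set V => A x) U.
  move=> E; split=> [[l lr Mx]|[Fx [i0 i0j Lx]]].
    have : (\bigcup_(l in [set l | (l < r)%N]) nth set0 M l)%classic x by exists l.
    by rewrite -E => -[Fx [i0 i0j Lx]]; split=> //; exists i0.
  have : (F `&` \bigcup_(i in [set i | (i < j)%N]) nth set0 L i)%classic x.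
    by split=> //; exists i0.
  by rewrite E => -[l lr Mx]; exists l.
have [U0 U1] := U.
have dB := dcl_bd hD hF.
have [ss [hs h1 h2 h3 h4]] := IH _ _ dB sM.
have [Minj Mf] := shelling_facets sM.
have M0 : (0 < size M)%N.
  have [G bG exG] := boundary_ex hF dF.
  have [g /Mf[l lM _] _] := facet_ex he dB.1 bG exG.
  exact: leq_ltn_trans lM.
(* [almostL] for this initial segment is available because [subdivided] asserts it for every initial
   segment, not only for the whole list. *)
exists (flatten (take r ss)), (flatten (drop r ss)).
have efl : flatten (take r ss) ++ flatten (drop r ss) = flatten ss.
  by rewrite -flatten_cat cat_take_drop.
have Mb l : (l < size M)%N -> boundary F (nth set0 M l).
  by move=> lM; have [] := (Mf (nth set0 M l)).2 (ex_intro2 _ _ l lM erefl).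
have MD l : (l < size M)%N -> Delta (nth set0 M l) by move=> /Mb /dB.1.
have cov T : inS (flatten ss) T <->
    chain T /\ forall i, i \in T -> boundary F (e i).
  rewrite inS_flatten hs; split=> [[l lM /(h2 l lM)[cT sT]]|[cT bT]].
    by split=> // i iT; apply: dB.2 (Mb l lM) (eD he i) (sT i iT).
  have [T0|Tn] := eqVneq T finset.set0.
    by exists 0%N => //; apply/(h2 _ M0); split=> // i; rewrite T0 finset.in_set0.
  have [h hT th] := chain_top he cT Tn.
  have [g /Mf[l lM eg] sg] := facet_ex he dB.1 (bT h hT) (e_ex he h).
  exists l => //; apply/(h2 l lM); split=> // i iT x ix.
  by rewrite -eg; apply: sg; have /leP' := th i iT; apply.
rewrite /child efl; split=> //.
- exact: (sphere_of hF dF sM h3 h1 cov).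
- move=> T; rewrite inS_flatten size_takel ?hs //.
  split=> [[l lr]|[cT bT [i0 i0j sT]]].
    have lM := leq_trans lr rM; rewrite nth_take // => /(h2 l lM)[cT sT]; split=> //.
      by move=> i iT; apply: dB.2 (Mb l lM) (eD he i) (sT i iT).
    have [x Mx] : exists x, nth set0 M l x.
      have [h hP _] := has_dim_free ((shelling_pure sM) _ ((Mf _).2 (ex_intro2 _ _ l lM erefl))).
      by exists (h 0%N); apply: hP.
    have [||i0 i0j si0] := @polytope_cover R t (nth set0 M l) (nth set0 L) j
        (D_polytope hD (MD l lM)) (ex_intro _ x Mx).
    + by move=> i0 i0j; apply: (D_faceI hD); [apply: MD | apply: Lj; apply: ltn_trans jL].
    + move=> y My; have [_ [i0 i0j Ly]] := (U1 y).1 (ex_intro2 _ _ l lr My).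
      by exists i0.
    by exists i0 => // i iT y iy; apply: si0; apply: (sT i iT).
  have r0 : (0 < r)%N by apply: U0; apply: leq_ltn_trans i0j.
  have [T0|Tn] := eqVneq T finset.set0.
    exists 0%N => //; rewrite nth_take //; apply/(h2 _ M0); split=> // i.
    by rewrite T0 finset.in_set0.
  have [h hT th] := chain_top he cT Tn.
  have [||l lr sl] := @polytope_cover R t (e h) (nth set0 M) r
      (D_polytope hD (eD he h)) (e_ex he h).
  + move=> l lr; apply: (D_faceI hD); [exact: (eD he) | apply: MD; exact: leq_trans rM].
  + move=> y hy; apply/U1; split; last by exists i0 => //; apply: (sT h hT).
    by have /(bdE hD _ hF)[_ sF _] := bT h hT; apply: sF.
  exists l => //; rewrite nth_take //; apply/(h2 l (leq_trans lr rM)); split=> // i iT y iy.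
  by apply: sl; have /leP' := th i iT; apply.
exact: h4.
Qed.

Lemma subdivision k C L : dcl C -> shelling k C L -> exists ss, subdivided k L ss.
Proof.
elim: k C L => [|k IH] C L dC sC.
  apply: (subdivide dC (shelling_pure sC) (shelling_facets sC)) => j jL.
  exact: (child0 dC (shelling_pure sC) (shelling_facets sC) jL).
apply: (subdivide dC (shelling_pure sC) (shelling_facets sC)) => j jL.
exact: (childS dC sC jL IH).
Qed.

Theorem sd_shelling k : pure_dim Delta k -> shellable Delta ->
  exists s : seq cell, [/\ s != [::], shell s,
    forall c, c \in s -> #|c.1| = k.+1,
    forall T, inS s T = (T \in sd_complex e) & almostL k.+1 s].
Proof.
move=> pD [k' [L sL]].
have dD : dcl Delta by apply: dcl_Delta.
have [Linj Lf] := shelling_facets sL.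
(* A nonempty facet on which the dimensions [k] and [k'] can be compared. The complex consisting of
   the empty face alone is excluded, as [pure_dim] provides its facet with a point. *)
have [g fg] : exists g, facet Delta (e g).
  have [P DP] : exists P, Delta P by case: hD => _ [P ?]; exists P.
  case: (pselect (exists x, P x)) => [exP|nP].
    by have [g fg _] := facet_ex he dD.1 DP exP; exists g.
  case: (pselect (exists g : 'I_n, True)) => [[i _]|nI].
    by have [g fg _] := facet_ex he dD.1 (eD he i) (e_ex he i); exists g.
  have fP : facet Delta P.
    split=> // G DG _; apply/seteqP; split=> x Gx; last by case: nP; exists x.
    by have [i _] := label he DG (ex_intro _ x Gx); case: nI; exists i.
  have [h hP _] := has_dim_free (pD _ fP).
  by case: nP; exists (h 0%N); apply: hP.
have ek : k' = k.
  by apply: has_dim_uniq (pD _ fg); apply: (shelling_pure sL).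
subst k'; have [ss [hs h1 h2 h3 h4]] := subdivision dD sL.
have L0 : (0 < size L)%N by have [l lL _] := (Lf (e g)).1 fg; apply: leq_ltn_trans lL.
have cov T : inS (flatten ss) T <-> chain T.
  rewrite inS_flatten hs; split=> [[l lM /(h2 l lM)[]]//|cT].
  have [T0|Tn] := eqVneq T finset.set0.
    by exists 0%N => //; apply/(h2 _ L0); split=> // i; rewrite T0 finset.in_set0.
  have [h hT th] := chain_top he cT Tn.
  have [g' /Lf[l lM eg] sg] := facet_ex he dD.1 (eD he h) (e_ex he h).
  exists l => //; apply/(h2 l lM); split=> // i iT x ix.
  by rewrite -eg; apply: sg; have /leP' := th i iT; apply.
exists (flatten ss); split=> //.
- have /hasP[c] : inS (flatten ss) finset.set0.
    by apply/cov/chainP => i j; rewrite finset.in_set0.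
  by case: (flatten ss).
- move=> T; rewrite finset.in_set; apply/idP/asboolP => [/cov/chainP h i j iT jT|h].
    by have /orP[/leP'|/leP'] := h i j iT jT; [left|right].
  apply/cov/chainP => i j iT jT; apply/orP.
  by have [hh|hh] := h i j iT jT; [left|right]; apply/leP'.
by have := h4 (size L) (leqnn _); rewrite -hs take_size.
Qed.

End Induction.

Local Open Scope classical_set_scope.
Local Open Scope ring_scope.

Theorem theorem3p4 (R : realType) (t : nat) (Delta : set (set 'rV[R]_t))
  (k : nat) (n : nat) (e : 'I_n -> set 'rV[R]_t) :
  polytopal_complex Delta -> pure_dim Delta k -> shellable Delta ->
  labels_nonempty_faces Delta e ->
  almost_strong_lefschetz R (sd_complex e) /\ M_sequence (gvec (sd_complex e)).
Proof.
move=> hD pD shD he; have [s [s0 sh sk sG Ls]] := sd_shelling hD he pD shD.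
(* A default vertex for the enumeration of facets; it exists because a facet has [k.+1] vertices. *)
have [v0 _] : exists v0 : 'I_n, True.
  case: (s) s0 sk => // c s' _ /(_ c (mem_head _ _)) ck.
  have /card_gt0P[v _] : (0 < #|c.1|)%N by rewrite ck.
  by exists v.
have [a sd inj] := lefschetz_point R v0 sh sk Ls.
split; first exact: (lefschetz_ideal sG s0 sh sk sd inj).
exact: (gvec_M_sequence sG s0 sh sk sd inj).
Qed.
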